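(* Let $n\ge 3$, let $(M^n,\Phi)$ be a reference manifold with background metric structure $(h,r)$, let $g$ be a $W^{1,2}_{-(n-2)/2}$-asymptotically Euclidean metric on $M$ that has distributional scalar curvature in $L^1$, and let $\{\chi_\alpha\}_{\alpha\ge1}$ be a sequence of cutoff functions. Then the weak ADM mass $m_{\mathrm W}(g,\Phi,\{\chi_\alpha\}_{\alpha\ge 1})$ of $g$ is finite (in particular the defining limit exists) and independent of the choice of the sequence of cutoff functions.
   Context: **Reference manifold.** A reference manifold $(M^n,\Phi)$ is a smooth manifold $M^n$ together with a compact set $K\subseteq M$, a radius $R\ge1$ and a diffeomorphism $\Phi\colon M\setminus K\to\mathbb R^n\setminus B_R$ (the chart at infinity), where $B_R$ is the closed ball of radius $R$ about $0$. A background metric structure $(h,r)$ for it is a smooth Riemannian metric $h$ on $M$ and a smooth function $r\colon M\to(0,\infty)$ such that $\Phi\colon(M\setminus K,h)\to(\mathbb R^n\setminus B_R,\delta)$ is an isometry ($\delta$ the Euclidean metric) and $(r\circ\Phi^{-1})(x)=|x|$ for $x\in\mathbb R^n\setminus B_R$. $D$ is the Levi-Civita connection of $h$ (and $D\phi$ also denotes the $h$-gradient of a function), $d\mu_h$ the volume measure of $h$. **Weighted spaces.** For an integer $k\ge0$, $p\in[1,\infty]$, $\tau\in\mathbb R$, $W^{k,p}_{-\tau}$ is the set of tensors $T\in W^{k,p}_{\mathrm{loc}}$ with finite norm $\sum_{l=0}^k\big(\int_M r^{p(\tau+l)-n}|D^{(l)}T|_h^p\,d\mu_h\big)^{1/p}$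 if $p<\infty$, resp. $\sum_{l=0}^k\operatorname{ess\,sup}_M(r^{\tau+l}|D^{(l)}T|_h)$ if $p=\infty$; $L^p_{-\tau}=W^{0,p}_{-\tau}$. In particular $L^1_{-n}=L^1(M,d\mu_h)$. **Asymptotically Euclidean.** A complete Riemannian metric $g$ on $M$ is $W^{k,p}_{-\tau}$-asymptotically Euclidean if $g,g^{-1}\in L^\infty_0$, $e:=g-h\in W^{k,p}_{-\tau}$, and $C^{-1}h\le g\le Ch$ as quadratic forms for some $C>1$. Here $g^{-1}$ is the inverse metric on $T^*M$. **Distributional scalar curvature.** Put $e=g-h$, $f=g^{-1}-h^{-1}$, $\Gamma_{ij}^k=\tfrac12 g^{kl}(D_ie_{jl}+D_je_{il}-D_le_{ij})$ and $$\mathcal Q^S=\mathrm{Scal}^h+f^{ij}\mathrm{Ric}^h_{ij}+g^{ij}(\Gamma_{ij}^u\Gamma_{vu}^v-\Gamma_{vi}^u\Gamma_{ju}^v)-(D_vg^{ij})\Gamma_{ij}^v+(D_ig^{ij})\Gamma_{vj}^v .$$ For $g\in W^{1,2}_{\mathrm{loc}}\cap L^\infty_{\mathrm{loc}}$ with $g^{-1}\in L^\infty_{\mathrm{loc}}$, the scalar curvature distribution is $$\langle\langle\mathrm{Scal}^g,\phi\rangle\rangle:=\int_M\big((g^{ij}g^{kl}-g^{ik}g^{jl})D_ke_{jl}(-D_i\phi)+\phi\,\mathcal Q^S\big)\,d\mu_h$$ for locally Lipschitz $\phi\colon M\to\mathbb R$ with compact support. $g$ has distributional scalar curvature in $L^1$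 if there is $\mathcal S^g\in L^1_{-n}$ with $\langle\langle\mathrm{Scal}^g,\phi\rangle\rangle=\int_M\phi\,\mathcal S^g\,d\mu_h$ for all such $\phi$. **Cutoff functions.** A sequence of cutoff functions is a sequence $\{\chi_\alpha\colon M\to\mathbb R\}_{\alpha\ge1}$ of compactly supported locally Lipschitz functions with $\sup_\alpha\sup_M(|\chi_\alpha|+r|D\chi_\alpha|_h)\le C$ for some $C>0$, $K\subseteq\chi_\alpha^{-1}(1)\subseteq\chi_{\alpha+1}^{-1}(1)$ for all $\alpha$, and $\bigcup_\alpha\chi_\alpha^{-1}(1)=M$. **Weak ADM mass.** With $\omega_{n-1}$ the volume of the unit sphere in $\mathbb R^n$, $$m_{\mathrm W}(g,\Phi,\{\chi_\alpha\}_{\alpha\ge1}):=\frac1{2(n-1)\omega_{n-1}}\lim_{\alpha\to\infty}\int_M(h^{ij}h^{kl}-h^{ik}h^{jl})D_ke_{jl}(-D_i\chi_\alpha)\,d\mu_h$$ whenever the limit exists. *)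

(* Defs.v *)
From HB Require Import structures.
From mathcomp Require Import all_boot all_order all_algebra.
From mathcomp Require Import all_classical all_reals all_analysis.
From mathcomp Require Import measurable_realfun ess_sup_inf.
Set Implicit Arguments. Unset Strict Implicit. Unset Printing Implicit Defensive.
Import Order.TTheory GRing.Theory Num.Theory.
Import numFieldNormedType.Exports.
Local Open Scope classical_set_scope.
Local Open Scope ring_scope.

Notation borel T := (g_sigma_algebraType (@open T)).

Section lebesgue_rV.
Context {R : realType}.
Local Notation RR := (measurableTypeR R).

Definition tuple_cons n (p : n.-tuple RR * RR) : n.+1.-tuple RR :=
  [tuple of p.2 :: p.1].

Lemma measurable_tuple_cons n : measurable_fun setT (@tuple_cons n).
Proof. exact: measurable_cons measurable_snd measurable_fst. Qed.

Fixpoint lebesgue_tuple n : {measure set (n.-tuple RR) -> \bar R} :=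
  match n with
  | 0 => dirac [tuple]
  | n'.+1 => measure_function_pushforward__canonical__measure_function_Measure
      (lebesgue_tuple n' \x @lebesgue_measure R)%E (@measurable_tuple_cons n')
  end.

Definition row_of_tuple n (t : n.-tuple RR) : borel 'rV[R]_n :=
  \row_i (tnth t i : R).

Lemma measurable_row_of_tuple n : measurable_fun setT (@row_of_tuple n).
Proof.
apply: (@measurability _ _ (n.-tuple RR) (borel 'rV[R]_n) setT _
          (@open 'rV[R]_n)) => //.
move=> _ [U oU <-]; rewrite setTI.
pose box (k : 'rV[rat]_n * nat) : set (n.-tuple RR) :=
  [set t | forall i, `|ratr (k.1 0 i) - tnth t i : R| < k.2.+1%:R^-1].
pose F k := if `[< box k `<=` @row_of_tuple n @^-1` U >] then box k else set0.
rewrite (_ : _ @^-1` _ = \bigcup_k F k).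
  apply: countable_bigcupT_measurable => // k; rewrite /F; case: ifP => // _.
  rewrite (_ : box k = \bigcap_(i in [set: 'I_n]) ((@tnth n RR ^~ i) @^-1`
    (ball (ratr (k.1 0 i) : R) k.2.+1%:R^-1))); last first.
    by apply/seteqP; split => [t bt i _|t bt i]; [exact: bt|exact: bt i I].
  apply: fin_bigcap_measurable; first exact: finite_finset.
  move=> i _; rewrite -[X in measurable X]setTI; apply: measurable_tnth => //.
  exact: measurable_ball.
apply/seteqP; split=> [t Ut|t [k _]]; last first.
  by rewrite /F; case: ifP => // /asboolP kU /kU.
have /nbhs_ballP[e /= e0 eU] : nbhs (row_of_tuple t : 'rV[R]_n) U.
  exact: open_nbhs_nbhs.
have [m me] : exists m : nat, m.+1%:R^-1 < e / 2.
  exists (Num.bound (e / 2)^-1); rewrite invf_plt ?posrE ?divr_gt0//.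
  rewrite (lt_trans (archi_boundP _)) ?ltr_nat// invr_ge0 ltW// divr_gt0//.
have m0 : 0 < m.+1%:R^-1 :> R by rewrite invr_gt0.
have qP (i : 'I_n) : exists q : rat, `|ratr q - tnth t i : R| < m.+1%:R^-1.
  have [|q] := @rat_in_itvoo R (tnth t i - m.+1%:R^-1) (tnth t i + m.+1%:R^-1).
    by rewrite ltrD2l gtrN.
  by rewrite in_itv/= => qi; exists q; rewrite ltr_distl.
have [q qt] := choice qP.
have sU : box (\row_i q i, m) `<=` @row_of_tuple n @^-1` U.
  move=> s bs; apply: eU; split => // i j; rewrite /ball/= !mxE.
  rewrite (le_lt_trans (ler_distD (ratr (q j)) _ _))// (splitr e) ltrD//.
    by rewrite distrC (lt_trans (qt j)).
  by have := bs j; rewrite /= mxE => /lt_trans; exact.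
by exists (\row_i q i, m) => //; rewrite /F asboolT// => i; rewrite /= mxE.
Qed.

(* n-dimensional Lebesgue measure: the image of the n-fold product of the
   one-dimensional one under the identification of tuples with row vectors. *)
Definition lebesgue n : {measure set (borel 'rV[R]_n) -> \bar R} :=
  measure_function_pushforward__canonical__measure_function_Measure
    (lebesgue_tuple n) (@measurable_row_of_tuple n).
End lebesgue_rV.

Section euclidean.
Context {R : realType} {n : nat}.
Local Notation E := 'rV[R]_n.
Implicit Types (U : set E) (u v : E -> R).

(* The norm of the library on 'rV[R]_n is the sup norm. *)
Definition enorm (x : E) : R := Num.sqrt (\sum_i x 0 i ^+ 2).

Definition partial (k : 'I_n) u : E -> R := 'D_(delta_mx 0 k) u.

Definition iter_partial (s : seq 'I_n) u : E -> R := foldr partial u s.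

(* C^infty on an open set U: all iterated partial derivatives exist and are
   continuous at the points of U. *)
Definition smooth_on U u := forall (s : seq 'I_n) x, U x ->
  {for x, continuous (iter_partial s u)} /\
  forall k, derivable (iter_partial s u) x (delta_mx 0 k).

Definition test_function U (phi : E -> R) :=
  [/\ smooth_on setT phi, compact (closure [set x | phi x != 0]) &
      closure [set x | phi x != 0] `<=` U].

Local Open Scope ereal_scope.

Definition Lp_loc (p : \bar R) U u :=
  measurable_fun (U : set (borel E)) (u : borel E -> R) /\
  forall Q : set E, compact Q -> Q `<=` U ->
    'N[lebesgue n]_p [EFin \o (u \_ Q)] < +oo.

Definition is_weak_partial U k u v :=
  [/\ Lp_loc 1 U u, Lp_loc 1 U v & forall phi, test_function U phi ->
    \int[lebesgue n]_(x in U) (u x * partial k phi x)%:E =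
    - \int[lebesgue n]_(x in U) (v x * phi x)%:E].

(* A representative of the weak partial derivative, which is unique almost
   everywhere (and the zero function if there is none). *)
Definition weak_partial U k u : E -> R :=
  xget (fun=> 0%R) (is_weak_partial U k u).

Definition W1p_loc (p : \bar R) U u :=
  Lp_loc p U u /\ forall k, is_weak_partial U k u (weak_partial U k u) /\
                            Lp_loc p U (weak_partial U k u).

(* The (n-1)-volume of the unit sphere, as n times the volume of the unit
   ball. *)
Definition sphere_volume : R :=
  (n%:R * fine (lebesgue n [set x | (enorm x <= 1)%R]))%R.

End euclidean.

(* Tensor calculus in one coordinate domain U of R^n; H and G are the matrices
   of covariant components of the metrics h and g. *)
Section local_formulas.
Context {R : realType} {n : nat}.
Local Notation E := 'rV[R]_n.
Implicit Types (U : set E) (H G T : E -> 'M[R]_n) (phi : E -> R)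
  (i j k l u v : 'I_n) (x : E).

(* The inverse metric; invmx is the matrix inverse. *)
Definition inv_metric G : E -> 'M[R]_n := fun x => invmx (G x).

Definition christoffel H k i j x : R :=
  2^-1 * \sum_l inv_metric H x k l *
    (partial i (fun y => H y j l) x + partial j (fun y => H y i l) x
     - partial l (fun y => H y i j) x).

Definition ricci H i j x : R :=
  \sum_k (partial k (christoffel H k i j) x - partial j (christoffel H k i k) x)
  + \sum_k \sum_l (christoffel H k k l x * christoffel H l i j x
                   - christoffel H k j l x * christoffel H l i k x).

Definition scal H x : R := \sum_i \sum_j inv_metric H x i j * ricci H i j x.

(* D_k T_{ij} and D_k S^{ij}, for the Levi-Civita connection D of h and weak
   derivatives of the components. *)
Definition cov_deriv02 U H T k i j x : R :=
  weak_partial U k (fun y => T y i j) x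
  - \sum_l (christoffel H l k i x * T x l j + christoffel H l k j x * T x i l).

Definition cov_deriv20 U H S k i j x : R :=
  weak_partial U k (fun y => S y i j) x
  + \sum_l (christoffel H i k l x * S x l j + christoffel H j k l x * S x i l).

Definition diff_metric H G : E -> 'M[R]_n := fun x => G x - H x.

Definition De U H G : 'I_n -> 'I_n -> 'I_n -> E -> R :=
  cov_deriv02 U H (diff_metric H G).

(* Gamma_{ij}^k *)
Definition Gam U H G k i j x : R :=
  2^-1 * \sum_l inv_metric G x k l *
    (De U H G i j l x + De U H G j i l x - De U H G l i j x).

Definition QS U H G x : R :=
  let gi := inv_metric G x in
  let Dgi := cov_deriv20 U H (inv_metric G) in
  let Ga := fun k i j => Gam U H G k i j x in
  scal H x
  + \sum_i \sum_j (gi i j - inv_metric H x i j) * ricci H i j x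
  + \sum_i \sum_j \sum_u \sum_v
      gi i j * (Ga u i j * Ga v v u - Ga u v i * Ga v j u)
  - \sum_i \sum_j \sum_v Dgi v i j x * Ga v i j
  + \sum_i \sum_j \sum_v Dgi i i j x * Ga v v j.

(* (A^{ij} A^{kl} - A^{ik} A^{jl}) D_k e_{jl} (- D_i phi) *)
Definition flux (A : E -> 'M[R]_n) U H G phi x : R :=
  \sum_i \sum_j \sum_k \sum_l
    (A x i j * A x k l - A x i k * A x j l) * De U H G k j l x
    * (- partial i phi x).

(* |T|_h for a covariant 2-tensor, a contravariant 2-tensor, a covariant
   3-tensor, and |d phi|_h. *)
Definition norm02 H T x : R :=
  Num.sqrt (\sum_i \sum_j \sum_k \sum_l
    inv_metric H x i k * inv_metric H x j l * T x i j * T x k l).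

Definition norm20 H S x : R :=
  Num.sqrt (\sum_i \sum_j \sum_k \sum_l
    H x i k * H x j l * S x i j * S x k l).

Definition norm03 H (V : 'I_n -> 'I_n -> 'I_n -> E -> R) x : R :=
  Num.sqrt (\sum_i \sum_j \sum_k \sum_a \sum_b \sum_c
    inv_metric H x i a * inv_metric H x j b * inv_metric H x k c
    * V i j k x * V a b c x).

Definition grad_norm H phi x : R :=
  Num.sqrt (\sum_i \sum_j inv_metric H x i j * partial i phi x * partial j phi x).

Definition quad (A : 'M[R]_n) (w : E) : R := (w *m A *m w^T) 0 0.

Definition inner_product (A : 'M[R]_n) :=
  A^T = A /\ forall w : E, w != 0 -> 0 < quad A w.

End local_formulas.

Section manifold.
Context {R : realType} {n : nat} {M : ptopologicalType}.
Local Notation E := 'rV[R]_n.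

Record chart := Chart {
  chart_dom : set M; chart_map : M -> E; chart_inv : E -> M }.

Definition chart_img (c : chart) : set E := chart_map c @` chart_dom c.

(* chart_map is a homeomorphism of the open set chart_dom onto the open set
   chart_img, with inverse chart_inv. *)
Definition is_chart (c : chart) :=
  [/\ open (chart_dom c) /\ open (chart_img c),
      forall q, chart_dom c q -> chart_inv c (chart_map c q) = q,
      forall q, chart_dom c q -> {for q, continuous (chart_map c)} &
      forall x, chart_img c x -> {for x, continuous (chart_inv c)}].

Definition transition (c d : chart) : E -> E := chart_map d \o chart_inv c.

Definition smooth_transition (c d : chart) := forall k : 'I_n,
  smooth_on (chart_map c @` (chart_dom c `&` chart_dom d))
    (fun x => transition c d x 0 k).

Variable A : nat -> chart.

(* Hausdorffness together with a countable atlas (with second countable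
   targets) gives the usual notion of smooth manifold: second countability of M
   amounts to the existence of such an atlas. Repeated or empty charts are
   allowed. *)
Definition smooth_atlas :=
  [/\ hausdorff_space M, forall i, is_chart (A i),
      forall i j, smooth_transition (A i) (A j) &
      forall q, exists i, chart_dom (A i) q].

Notation U i := (chart_img (A i)).

(* A covariant 2-tensor field is given by its matrix of components in each chart
   A i, as a function on U i. The (i, k) entry of the library's jacobian is the
   i-th partial derivative of the k-th component. *)
Definition tensor2 := nat -> E -> 'M[R]_n.
Implicit Types (h g T : tensor2) (phi : M -> R).

Definition covariant_at T i j x :=
  chart_dom (A j) (chart_inv (A i) x) ->
  let J := jacobian (transition (A i) (A j)) x in
  T i x = J *m T j (transition (A i) (A j) x) *m J^T.

Definition smooth_metric h := forall i,
  [/\ forall a b : 'I_n, smooth_on (U i) (fun x => h i x a b),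
      forall x, U i x -> inner_product (h i x) &
      forall j x, U i x -> covariant_at h i j x].

(* Metrics of low regularity are only defined up to null sets. *)
Definition ae_metric g := forall i,
  (\forall x \ae lebesgue n, U i x -> inner_product (g i x)) /\
  (forall j, \forall x \ae lebesgue n, U i x -> covariant_at g i j x).

Definition in_chart phi i : E -> R := phi \o chart_inv (A i).

Definition smooth_fun phi := forall i, smooth_on (U i) (in_chart phi i).

Definition locally_lipschitz phi := forall i x, U i x ->
  exists2 V : set E, nbhs x V & [lipschitz in_chart phi i y | y in V].

(* A scalar built by contracting tensors is computed at a point in any chart
   around it; for definiteness, the chart with the smallest index is used. *)
Definition chart_at (q : M) : nat :=
  xget 0%N [set i | chart_dom (A i) q /\
                    forall j, (j < i)%N -> ~ chart_dom (A j) q].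

Definition eval_scalar (F : nat -> E -> R) : M -> R :=
  fun q => F (chart_at q) (chart_map (A (chart_at q)) q).

Local Open Scope ereal_scope.

(* mu is the volume measure of h (these equations determine it). *)
Definition volume_measure h (mu : {measure set (borel M) -> \bar R}) :=
  forall i (B : set (borel M)), measurable B -> B `<=` chart_dom (A i) ->
  mu B = \int[lebesgue n]_(x in chart_map (A i) @` B)
           (Num.sqrt (\det (h i x)))%:E.

(* Phi is a diffeomorphism from the complement of K onto the complement of the
   closed ball of radius R0; as M and R^n have the same dimension, this means
   that it is a chart which is compatible with the atlas. *)
Definition reference_manifold (K : set M) (R0 : R) (Phi : chart) :=
  [/\ smooth_atlas, compact K, (1 <= R0)%R, is_chart Phi &
   [/\ chart_dom Phi = ~` K, chart_img Phi = [set x | (R0 < enorm x)%R] &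
    forall i, smooth_transition (A i) Phi /\ smooth_transition Phi (A i)]].

Definition background_metric (K : set M) (Phi : chart) h (r : M -> R) :=
  [/\ smooth_metric h, smooth_fun r, forall q, (0 < r q)%R,
      (forall i x, U i x -> ~ K (chart_inv (A i) x) ->
         let J := jacobian (transition (A i) Phi) x in h i x = J *m J^T)%R &
      forall x, chart_img Phi x -> r (chart_inv Phi x) = enorm x].

Section weighted.
Variables (h : tensor2) (r : M -> R) (mu : {measure set (borel M) -> \bar R}).

(* The norm of L^p_{-tau}, as a function of the pointwise norm N = |T|_h; used
   for 1 <= p <= +oo. *)
Definition weighted_norm (p : \bar R) (tau : R) (N : M -> R) : \bar R :=
  match p with
  | p%:E =>
      (\int[mu]_q (r q `^ (p * tau - n%:R) * N q `^ p)%R%:E) `^ p^-1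
  | _ => ess_sup mu (fun q => (r q `^ tau * N q)%R%:E)
  end.

Definition measurable_components T := forall i (a b : 'I_n),
  measurable_fun (U i : set (borel E)) ((fun x => T i x a b) : borel E -> R).

(* W^{1,p}_{-tau}, for covariant 2-tensors *)
Definition W1p (p : \bar R) (tau : R) T :=
  (forall i (a b : 'I_n), W1p_loc p (U i) (fun x => T i x a b)) /\
  weighted_norm p tau (eval_scalar (fun i => norm02 (h i) (T i))) +
  weighted_norm p (tau + 1)%R
    (eval_scalar (fun i => norm03 (h i) (cov_deriv02 (U i) (h i) (T i)))) < +oo.

(* The distance of a metric of low regularity: the supremum of
   |phi q - phi q'| over the locally Lipschitz functions phi with |d phi|_g <= 1
   almost everywhere. It is the usual Riemannian distance if g is continuous,
   and does not depend on the choice of g on null sets. *)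
Definition distance g (q q' : M) : \bar R :=
  ereal_sup [set `|phi q - phi q'|%:E | phi in
    [set phi | locally_lipschitz phi /\
      \forall s \ae mu,
        (eval_scalar (fun i => grad_norm (g i) (in_chart phi i)) s <= 1)%R]].

Definition complete_metric g := forall s : nat -> M,
  (forall eps : R, (0 < eps)%R -> exists N, forall a b,
     (N <= a)%N -> (N <= b)%N -> distance g (s a) (s b) < eps%:E) ->
  exists q : M, s @ \oo --> q.

Definition asymptotically_euclidean (p : \bar R) (tau : R) g :=
  [/\ ae_metric g /\ complete_metric g,
      measurable_components g /\
        weighted_norm +oo 0 (eval_scalar (fun i => norm02 (h i) (g i))) < +oo,
      measurable_components (fun i => inv_metric (g i)) /\
        weighted_norm +oo 0 (eval_scalar (fun i => norm20 (h i) (inv_metric (g i))))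
          < +oo,
      W1p p tau (fun i => diff_metric (h i) (g i)) &
      exists2 C : R, (1 < C)%R & forall i, \forall x \ae lebesgue n,
        U i x -> forall w : E,
          (C^-1 * quad (h i x) w <= quad (g i x) w <= C * quad (h i x) w)%R].

Definition compactly_supported phi := compact (closure [set q | phi q != 0%R]).

Definition scal_distribution g phi : \bar R :=
  \int[mu]_q (eval_scalar (fun i =>
    flux (inv_metric (g i)) (U i) (h i) (g i) (in_chart phi i)) q
    + phi q * eval_scalar (fun i => QS (U i) (h i) (g i)) q)%R%:E.

Definition has_scal_L1 g := exists2 S : M -> R,
  mu.-integrable setT (EFin \o S) & forall phi,
  locally_lipschitz phi -> compactly_supported phi ->
  scal_distribution g phi = \int[mu]_q (phi q * S q)%R%:E.

Definition cutoff_sequence (K : set M) (chi : nat -> M -> R) :=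
  [/\ forall a, locally_lipschitz (chi a) /\ compactly_supported (chi a),
      (exists2 C : R, (0 < C)%R & forall a, \forall q \ae mu,
         (`|chi a q| + r q * eval_scalar (fun i =>
            grad_norm (h i) (in_chart (chi a) i)) q <= C)%R),
      forall a, K `<=` chi a @^-1` [set 1%R],
      forall a, chi a @^-1` [set 1%R] `<=` chi a.+1 @^-1` [set 1%R] &
      \bigcup_a (chi a @^-1` [set 1%R]) = setT].

Definition mass_sequence g (chi : nat -> M -> R) : nat -> \bar R := fun a =>
  ((2 * (n%:R - 1) * @sphere_volume R n)^-1)%:E *
  \int[mu]_q (eval_scalar (fun i => flux (inv_metric (h i)) (U i) (h i) (g i)
                                 (in_chart (chi a) i)) q)%:E.

Definition weak_ADM_mass g chi : \bar R := limn (mass_sequence g chi).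

End weighted.
End manifold.
Arguments chart : clear implicits.
Arguments tensor2 : clear implicits.

(* Main.v *)
Require Import Defs.
From HB Require Import structures.
From mathcomp Require Import all_boot all_order all_algebra.
From mathcomp Require Import all_classical all_reals all_analysis.
From mathcomp Require Import measurable_realfun ring lra.
Set Implicit Arguments.
Unset Strict Implicit.
Unset Printing Implicit Defensive.
Import Order.TTheory GRing.Theory Num.Theory.
Import numFieldNormedType.Exports.
Local Open Scope classical_set_scope.
Local Open Scope ring_scope.

(** Put e = g - h, and write F_h(chi) for the integrand of the weak mass, that is
    (h^ij h^kl - h^ik h^jl) D_k e_jl (- D_i chi), F_g(chi) for the same
    expression with g^-1 in the place of h^-1, and Q for the quadratic term of
    the scalar curvature distribution. The latter has the integrand
    F_g(chi) + chi Q, and it is represented by an integrable function S. Hence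
<<
  int F_h(chi_a) = int chi_a S - int chi_a Q - int (F_g(chi_a) - F_h(chi_a)).
>>
    The cutoffs are uniformly bounded and at each point eventually equal to 1. So
    if Q is integrable, and if the differences F_g(chi_a) - F_h(chi_a), which
    vanish almost everywhere on the sets chi_a = 1, have a common integrable
    majorant, then dominated convergence shows that the left-hand side converges
    to int S - int Q. This number does not involve the cutoffs
    ([mass_integral_limit]).

    Outside K the background metric is flat, so Q reduces to terms quadratic in De,
    and two pointwise bounds hold ([off_K]): |Q| <= C |De|^2 and
    |F_g(chi) - F_h(chi)| <= C |e| |De| |D chi|. The decay rate (n-2)/2 says
    exactly that r^-2 |e|^2 and |De|^2 are integrable; as r |D chi_a| is bounded,
    the second bound is dominated by their sum. On K all the cutoffs equal 1, so
    the fluxes vanish there almost everywhere ([flux_on_one]), and Q coincides with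
    the integrand F_g(chi) + chi Q of a convergent integral ([integrable_Q]).

    The analysis lies in what these bounds presuppose.

    - The metric has only weak derivatives, and Q contains D g^-1. The formula
      D g^-1 = - g^-1 (De) g^-1 is the differentiation rule for the inverse of a
      weakly differentiable matrix ([weak_partial_inverse]). It is derived from
      the algebraic identity P' - P = - P' (G' - G) P between the inverses of G and
      of its translate G', which reduces the matter to difference quotients: a
      function with an integrable weak derivative w satisfies
      u(x + t e_k) - u(x) = t w(x) + o(t) in L^1 on boxes ([increment_L1_box]).
      That in turn comes from the fundamental theorem of calculus for pairings of
      translates of u with bounded functions, and from the continuity of
      translations in L^1 ([L1_translation_continuous]). The weak derivative is
      determined almost everywhere ([fundamental_lemma]), so it does not matter
      which representative a formula uses.
    - Locally outside K, h is J J^T for the Jacobian matrix J of the change to the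
      chart at infinity, and such a metric has no Ricci curvature ([flat_ricci],
      [end_flat]). The columns of J also give a frame that is orthonormal for the
      inverse metric; in it, tensor norms bound components, which turns the two
      estimates into counting terms ([quadratic_bound], [flux_diff_bound]).
    - The derivative of a cutoff vanishes almost everywhere on the set where the
      cutoff is 1 ([level_set_partial]).
    - Every pointwise statement is proved in the charts. Null sets of the charts
      correspond to null sets of the volume measure, and a scalar on M is evaluated
      in one chart at each point; so almost everywhere statements pass to M one
      chart at a time, and the two formulas for a tensor in overlapping charts
      never have to be compared ([ae_chart_at]). *)

(** * Lebesgue measure and translations *)

Section borel_topology.
Context {T : ptopologicalType}.

Lemma open_measurable_borel (U : set T) : open U -> measurable (U : set (borel T)).
Proof. exact: sub_sigma_algebra. Qed.

Lemma closed_measurable_borel (C : set T) :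
  closed C -> measurable (C : set (borel T)).
Proof.
by move=> /closed_openC/open_measurable_borel/measurableC; rewrite setCK.
Qed.

Lemma measurable_borel_fun (T' : ptopologicalType) (U : set T) (f : T -> T') :
  open U -> (forall x, U x -> {for x, continuous f}) ->
  measurable_fun (U : set (borel T)) (f : borel T -> borel T').
Proof.
move=> oU cf.
apply: (@measurability _ _ (borel T) (borel T') U f (@open T')) => //.
move=> _ [V oV <-]; apply: open_measurable_borel.
rewrite openE => x [Ux Vfx]; apply: filterI; first exact: open_nbhs_nbhs.
by apply: cf => //; exact: open_nbhs_nbhs.
Qed.

Lemma continuous_measurable_borel (R : realType) (U : set T) (f : T -> R) :
  open U -> (forall x, U x -> {for x, continuous f}) ->
  measurable_fun (U : set (borel T)) (f : borel T -> R).
Proof.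
move=> oU cf.
apply: (measurability _ (RGenOpens.measurableE R)) => //.
move=> _ [V [a [b ->]] <-]; apply: open_measurable_borel.
have oV : open (`]a, b[%classic : set R) by exact: interval_open.
rewrite openE => x [Ux Vfx]; apply: filterI; first exact: open_nbhs_nbhs.
by apply: cf => //; exact: open_nbhs_nbhs.
Qed.

End borel_topology.

Section rV_borel.
Context {R : realType} {n : nat}.
Local Notation E := 'rV[R]_n.
Local Notation mE := (borel 'rV[R]_n).

Lemma measurable_coord (i : 'I_n) :
  measurable_fun setT (fun x : mE => (x : E) 0 i : R).
Proof.
apply: continuous_measurable_borel => [|x _]; first exact: openT.
exact: coord_continuous.
Qed.

Lemma measurable_fun_rV d (T : measurableType d) (f : T -> mE) :
  (forall i, measurable_fun setT (fun t => (f t : E) 0 i : R)) ->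
  measurable_fun setT f.
Proof.
move=> mf.
rewrite (_ : f = @row_of_tuple R n \o (fun t => [tuple (f t : E) 0 i | i < n])).
  apply: measurableT_comp; first exact: measurable_row_of_tuple.
  apply/measurable_fun_tnthP => i.
  rewrite (_ : _ \o _ = fun t => (f t : E) 0 i); first exact: mf.
  by apply/funext => t /=; rewrite tnth_mktuple.
by apply/funext => t; apply/rowP => i; rewrite !mxE tnth_mktuple.
Qed.

Lemma measurable_translation (v : E) : measurable_fun setT (fun x : mE => (x : E) + v : mE).
Proof.
apply: measurable_fun_rV => i; under eq_fun do rewrite mxE.
by apply: measurable_funD => //; exact: measurable_coord.
Qed.

End rV_borel.

Section lebesgue_translation.
Context {R : realType}.
Local Notation RR := (measurableTypeR R).
Local Notation leb1 := (@lebesgue_measure R).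

(** The amounts of translation are indexed by all natural numbers, so that the
    induction on the length of the tuple needs no change of index type. *)
Definition tuple_shift n (v : nat -> R) (t : n.-tuple RR) : n.-tuple RR :=
  [tuple (tnth t i + v i : R) | i < n].

Lemma measurable_tuple_shift n v : measurable_fun setT (@tuple_shift n v).
Proof.
apply/measurable_fun_tnthP => i.
rewrite (_ : _ \o _ = fun t => (tnth t i + v i : R)).
  by apply: measurable_funD => //; exact: measurable_tnth.
by apply/funext => t /=; rewrite tnth_mktuple.
Qed.

Lemma lebesgue_measure_shift (a : R) (A : set RR) : measurable A ->
  leb1 ((fun x : RR => x + a : RR) @^-1` A) = leb1 A.
Proof.
move=> mA.
have ms : measurable_fun setT (fun x : RR => x + a : RR) by exact: measurable_funD.
pose m := measure_function_pushforward__canonical__measure_function_Measure leb1 ms.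
apply/esym; apply: (@lebesgue_measure_unique _ m) => //= _ [[b c]] _ <-.
rewrite /pushforward (_ : _ @^-1` _ = [set` `]b - a, c - a]]); last first.
  by apply/seteqP; split => x /=; rewrite !in_itv/= ltrBlDr lerBrDr.
rewrite !lebesgue_measure_itv/= !lte_fin ltrD2r; case: ifP => // _.
by rewrite -!EFinD; congr (_%:E); ring.
Qed.

Definition tuple_cube n (c : R) : set (n.-tuple RR) :=
  [set t | forall i, `|tnth t i : R| <= c].

Lemma measurable_tuple_cube n c : measurable (@tuple_cube n c).
Proof.
rewrite (_ : tuple_cube c = \bigcap_(i in [set: 'I_n])
    ((@tnth n RR ^~ i) @^-1` [set x : R | `|x| <= c])); last first.
  by apply/seteqP; split => [t bt i _|t bt i]; [exact: bt|exact: bt i I].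
apply: fin_bigcap_measurable; first exact: finite_finset.
move=> i _; rewrite -[X in measurable X]setTI; apply: measurable_tnth => //.
rewrite (_ : [set _ | _] = `[- c, c]%classic) ?measurable_itv//.
by apply/seteqP; split => x /=; rewrite in_itv/= ler_norml.
Qed.

Lemma lebesgue_tuple_cube_lty n c : (lebesgue_tuple n (@tuple_cube n c) < +oo)%E.
Proof.
elim: n => [|n IHn] /=; first by rewrite diracE ltry.
rewrite /pushforward (_ : _ @^-1` _ = @tuple_cube n c `*` `[- c, c]%classic); last first.
  apply/seteqP; split => [[t x] /= tx|[t x] [/= tc xc] i].
    split => [i|]; first by have := tx (lift ord0 i); rewrite tnthS.
    by have := tx ord0; rewrite in_itv/= ler_norml tnth0.
  case: (unliftP ord0 i) => [j ->|->]; first by rewrite tnthS.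
  by rewrite tnth0 ler_norml; move: xc; rewrite in_itv.
rewrite product_measure1E//=; last exact: measurable_tuple_cube.
rewrite lte_mul_pinfty// ?ge0_fin_numE//.
by rewrite lebesgue_measure_itv/=; case: ifP => // _; rewrite -EFinD ltry.
Qed.

Lemma lebesgue_tuple_sigma_finite n : sigma_finite setT (@lebesgue_tuple R n).
Proof.
exists (fun k => @tuple_cube n k%:R).
  apply/seteqP; split => // t _.
  have [k tk] : exists k : nat, \sum_i `|tnth t i : R| <= k%:R.
    by exists (Num.bound (\sum_i `|tnth t i : R|)); rewrite ltW// archi_boundP// sumr_ge0.
  exists k => // i; apply: le_trans tk.
  by rewrite (bigD1 i)//= lerDl sumr_ge0.
by move=> k; split; [exact: measurable_tuple_cube|exact: lebesgue_tuple_cube_lty].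
Qed.

(** A second name for the measure, on which the structure of a sigma-finite measure
    can be declared: products of measures are unique only for sigma-finite factors. *)
Definition lebesgue_tuple_sf n : set (n.-tuple RR) -> \bar R := lebesgue_tuple n.

HB.instance Definition _ n := isMeasure.Build _ _ _ (@lebesgue_tuple_sf n)
  (measure0 (lebesgue_tuple n)) (measure_ge0 (lebesgue_tuple n))
  (@measure_semi_sigma_additive _ _ _ (lebesgue_tuple n)).

HB.instance Definition _ n := Measure_isSigmaFinite.Build _ _ _
  (@lebesgue_tuple_sf n) (@lebesgue_tuple_sigma_finite n).

(** Induction on the dimension: both the product measure and its image under the
    translation take the same values on rectangles, and a product measure is
    determined by them. *)
Lemma lebesgue_tuple_shift n (v : nat -> R) (A : set (n.-tuple RR)) : measurable A ->
  lebesgue_tuple n (tuple_shift v @^-1` A) = lebesgue_tuple n A.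
Proof.
elim: n v A => [|n IHn] v A mA.
  by congr (_ _); apply/seteqP; split => t; rewrite /= (tuple0 t) (tuple0 (tuple_shift _ _)).
have mc : measurable_fun setT (fun p : n.-tuple RR * RR =>
    (tuple_shift (v \o S) p.1, p.2 + v 0%N : RR)).
  apply: measurable_fun_pair; last by apply: measurable_funD.
  by apply: measurableT_comp => //; exact: measurable_tuple_shift.
pose m' := measure_function_pushforward__canonical__measure_function_Measure
  (@lebesgue_tuple_sf n \x leb1)%E mc.
rewrite /= /pushforward [RHS](@product_measure_unique _ _ _ _ _ (@lebesgue_tuple_sf n) leb1 m').
- have sE t x : tuple_shift v (tuple_cons (t, x)) =
      tuple_cons (tuple_shift (v \o S) t, x + v 0%N : RR).
    apply: eq_from_tnth => i; rewrite tnth_mktuple /tuple_cons/=.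
    case: (unliftP ord0 i) => [j ->|->]; last by rewrite !tnth0.
    by rewrite !tnthS tnth_mktuple.
  rewrite /m'/= /pushforward; congr (_ _).
  by apply/seteqP; split => -[t x] /=; rewrite sE.
- move=> B C mB mC; rewrite /m'/= /pushforward.
  rewrite (_ : _ @^-1` _ = (tuple_shift (v \o S) @^-1` B) `*` ((fun x : RR => x + v 0%N : RR) @^-1` C)); last first.
    by apply/seteqP; split => -[t x].
  rewrite product_measure1E//=; first by rewrite IHn// lebesgue_measure_shift.
  - by rewrite -[X in measurable X]setTI; exact: measurable_tuple_shift.
  - by rewrite -[X in measurable X]setTI; exact: measurable_funD.
- by rewrite -[X in measurable X]setTI; exact: measurable_tuple_cons.
Qed.

End lebesgue_translation.

Section lebesgue_rV_theory.
Context {R : realType} {n : nat}.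
Local Notation E := 'rV[R]_n.
Local Notation mE := (borel 'rV[R]_n).
Local Notation leb := (@lebesgue R n).

Definition cube (c : R) : set mE := [set x | forall i, `|(x : E) 0 i| <= c].

Lemma lebesgue_cube_lty c : (leb (cube c) < +oo)%E.
Proof.
rewrite /lebesgue /= /pushforward (_ : _ @^-1` _ = @tuple_cube R n c).
  exact: lebesgue_tuple_cube_lty.
by apply/seteqP; split => t tc i; have := tc i; rewrite mxE.
Qed.

Lemma measurable_cube c : measurable (cube c).
Proof.
rewrite (_ : cube c = \bigcap_(i in [set: 'I_n])
    ((fun x : mE => (x : E) 0 i) @^-1` [set y : R | `|y| <= c])); last first.
  by apply/seteqP; split => [t bt i _|t bt i]; [exact: bt|exact: bt i I].
apply: fin_bigcap_measurable; first exact: finite_finset.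
move=> i _; rewrite -[X in measurable X]setTI; apply: measurable_coord => //.
rewrite (_ : [set _ | _] = `[- c, c]%classic) ?measurable_itv//.
by apply/seteqP; split => x /=; rewrite in_itv/= ler_norml.
Qed.

Lemma cube_norm (x : E) : cube `|x| x.
Proof.
move=> i.
by rewrite [leRHS]/Num.norm/= mx_normrE; apply/bigmax_geP; right => /=; exists (0, i).
Qed.

Lemma cube_cover : \bigcup_k cube k%:R = setT.
Proof.
apply/seteqP; split => // x _; exists (Num.bound `|x|) => // i.
by rewrite (le_trans (cube_norm x i))// ltW// archi_boundP.
Qed.

Lemma lebesgue_sigma_finite : sigma_finite setT leb.
Proof.
exists (fun k => cube k%:R); first by rewrite cube_cover.
by move=> k; split; [exact: measurable_cube|exact: lebesgue_cube_lty].
Qed.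

(** The sigma-finite structure is declared on a second name, as for tuples. *)
Definition lebesgue_sf : set mE -> \bar R := leb.

HB.instance Definition _ := isMeasure.Build _ _ _ lebesgue_sf
  (measure0 leb) (measure_ge0 leb) (@measure_semi_sigma_additive _ _ _ leb).

HB.instance Definition _ := Measure_isSigmaFinite.Build _ _ _
  lebesgue_sf lebesgue_sigma_finite.

Lemma lebesgue_shift (v : E) (A : set mE) : measurable A ->
  leb ((fun x : mE => (x : E) + v : mE) @^-1` A) = leb A.
Proof.
move=> mA; rewrite /lebesgue /= /pushforward.
pose w i : R := if insub i is Some j then v 0 j else 0.
rewrite -[RHS](@lebesgue_tuple_shift _ _ w); last first.
  by rewrite -[X in measurable X]setTI; exact: measurable_row_of_tuple.
have sE t : row_of_tuple (tuple_shift w t) = (row_of_tuple t : E) + v.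
  by apply/rowP => i; rewrite !mxE tnth_mktuple /w valK.
by congr (lebesgue_tuple n _); apply/seteqP; split => t /=; rewrite sE.
Qed.

Local Notation shift v := (fun x : mE => (x : E) + v : mE).

Lemma ge0_integral_shift (v : E) (f : mE -> \bar R) : measurable_fun setT f ->
  (forall x, 0 <= f x)%E -> (\int[leb]_x f ((x : E) + v)%R = \int[leb]_x f x)%E.
Proof.
move=> mf f0.
rewrite -[LHS](@ge0_integral_pushforward _ _ _ _ _ (shift v) _ leb setT f)//=.
  apply: (@eq_measure_integral _ _ _ _ leb
    (measure_function_pushforward__canonical__measure_function_Measure leb
      (measurable_translation v))) => A mA _.
  exact: lebesgue_shift.
exact: measurable_translation.
Qed.

Lemma integrable_shift (v : E) (f : mE -> \bar R) :
  leb.-integrable setT f -> leb.-integrable setT (f \o shift v).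
Proof.
move=> /integrableP[mf foo]; apply/integrableP; split.
  exact: (measurableT_comp mf (measurable_translation v)).
rewrite [ltLHS](@ge0_integral_shift v (fun x => `|f x|)%E)//.
exact: measurableT_comp.
Qed.

Lemma integral_shift (v : E) (f : mE -> \bar R) :
  leb.-integrable setT f -> (\int[leb]_x f ((x : E) + v)%R = \int[leb]_x f x)%E.
Proof.
move=> fi; have /integrableP[mf _] := fi.
rewrite -[LHS](@integral_pushforward _ _ _ _ _ (shift v) _ leb setT f)//=.
-   apply: (@eq_measure_integral _ _ _ _ leb
    (measure_function_pushforward__canonical__measure_function_Measure leb
      (measurable_translation v))) => A mA _.
  exact: lebesgue_shift.
- exact: measurable_translation.
- exact: integrable_shift.
Qed.

End lebesgue_rV_theory.

Lemma norm_squeeze_cvg0 (R : realType) (T : Type) (F : set_system T) (f g : T -> R) :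
  Filter F -> (\forall x \near F, `|f x| <= g x) ->
  g x @[x --> F] --> (0 : R) -> f x @[x --> F] --> (0 : R).
Proof.
move=> FF fg g0; apply/norm_cvg0P.
apply: (@squeeze_cvgr _ F FF R (cst 0) g) (@cvg_cst _ (0 : R) _ F FF) g0.
by apply: filterS fg => x ->; rewrite normr_ge0.
Qed.

Lemma aeS d (T : measurableType d) (R : realType) (mu : {measure set T -> \bar R})
    (P Q : T -> Prop) : (forall x, P x -> Q x) ->
  {ae mu, forall x, P x} -> {ae mu, forall x, Q x}.
Proof. by move=> PQ; apply: filterS. Qed.

Lemma aeS2 d (T : measurableType d) (R : realType) (mu : {measure set T -> \bar R})
    (P P' Q : T -> Prop) : (forall x, P x -> P' x -> Q x) ->
  {ae mu, forall x, P x} -> {ae mu, forall x, P' x} -> {ae mu, forall x, Q x}.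
Proof. by move=> PQ; apply: filterS2. Qed.

#[global] Opaque lebesgue.

(** * Smooth bump functions on boxes *)

Section directional.
Context {R : realType} {V : normedModType R}.
Implicit Types (f : V -> R) (x v : V).

Lemma derivable_lineP f x v :
  derivable f x v <-> derivable (fun t : R => f (t *: v + x)) 0 1.
Proof.
rewrite /derivable.
rewrite (_ : (fun h : R => h^-1 *: (f (h *: v + x) - f x)) =
  (fun h : R => h^-1 *: (f ((h *: (1 : R^o) + 0 : R) *: v + x) - f (0 *: v + x))))//.
by apply/funext => h; rewrite scale0r add0r addr0 scaler1.
Qed.

Lemma derive_line f x v : 'D_v f x = 'D_1 (fun t : R => f (t *: v + x)) 0.
Proof.
rewrite /derive.
rewrite (_ : (fun h : R => h^-1 *: (f (h *: v + x) - f x)) =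
  (fun h : R => h^-1 *: (f ((h *: (1 : R^o) + 0 : R) *: v + x) - f (0 *: v + x))))//.
by apply/funext => h; rewrite scale0r add0r addr0 scaler1.
Qed.

Lemma is_derive_lineP f x v (d : R) :
  is_derive (0 : R) 1 (fun t : R => f (t *: v + x)) d -> is_derive x v f d.
Proof.
move=> [d1 d2]; apply: DeriveDef; first exact/derivable_lineP.
by rewrite derive_line.
Qed.

End directional.

Section flat_exponential.
Context {R : realType}.
Variables (p : {poly R}) (c : R).
Hypothesis c_gt0 : 0 < c.

(** The functions q / p^m exp(- c / p) on the set where p > 0, extended by 0. For
    p = (x - a)(b - x) and q = 1, m = 0 this is the usual bump function of an
    interval; the factor q / p^m is there to make the family closed under derivation. *)
Definition flat_exp (q : {poly R}) (m : nat) (x : R) : R :=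
  if 0 < p.[x] then q.[x] / p.[x] ^+ m * expR (- (c / p.[x])) else 0.

Definition flat_exp_deriv (q : {poly R}) (m : nat) : {poly R} :=
  q^`() * p ^+ 2 - m%:R *: (q * p^`() * p) + c *: (q * p^`()).

(** From exp y >= y^(m+1) / (m+1)!: the exponential beats every power of its argument. *)
Let expN_le (m : nat) (y : R) : 0 < y -> expR (- (c / y)) <= m.+1`!%:R * (y / c) ^+ m.+1.
Proof.
move=> y0; have cy : 0 < c / y by rewrite divr_gt0.
rewrite expRN -[leRHS]invrK lef_pV2 ?posrE ?expR_gt0//; last first.
  by rewrite invr_gt0 mulr_gt0// ?exprn_gt0 ?divr_gt0// ltr0n fact_gt0.
apply: le_trans (expR_ge1Dxn m (ltW cy)); rewrite invfM -exprVn invf_div mulrC.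
by rewrite lerDr.
Qed.

(** Where p is nonzero this is the usual computation. At a zero x of p, the
    polynomial p is divisible by y - x, so the exponential, being O(p^(m+2)), makes
    the function O((y - x)^2) in spite of the denominator p^m. *)
Lemma is_derive_flat_exp (q : {poly R}) (m : nat) (x : R) :
  is_derive x (1 : R) (flat_exp q m) (flat_exp (flat_exp_deriv q m) m.+2 x).
Proof.
have cp := @continuous_horner R p x.
have [px|px|px] := ltrgtP p.[x] 0.
- have -> : flat_exp (flat_exp_deriv q m) m.+2 x = 0.
    by rewrite /flat_exp ltNge (ltW px).
  apply: (@near_eq_is_derive _ _ _ (cst 0)).
  have : \forall y \near x, p.[y] < 0 by exact: (@cvgr_lt _ _ _ _ (horner p) p.[x] cp 0 px).
  by apply: filterS => y py; rewrite /flat_exp ltNge (ltW py).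
- apply: (@near_eq_is_derive _ _ _ (fun y => q.[y] / p.[y] ^+ m * expR (- (c / p.[y])))).
  + have : \forall y \near x, 0 < p.[y] by exact: (@cvgr_gt _ _ _ _ (horner p) p.[x] cp 0 px).
    by apply: filterS => y py; rewrite /flat_exp py.
  + have pm0 : p.[x] ^+ m != 0 by rewrite expf_neq0 ?gt_eqF.
    have px0 : p.[x] != 0 by rewrite gt_eqF.
    have d1 := is_derive_poly p x.
    have d2 := is_derive_poly q x.
    have d3 : is_derive x 1 (fun y => (p.[y] ^+ m)^-1) (- (m%:R * p^`().[x]) / p.[x] ^+ m.+1).
      have d3a : is_derive x (1 : R) (fun y => p.[y] ^+ m) (m%:R * p.[x] ^+ m.-1 * p^`().[x]).
        by have := is_deriveX m d1; rewrite exprfctE; move/is_derive_eq; apply.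
      have := @is_deriveV _ (fun y => p.[y] ^+ m) _ _ _ pm0 d3a; move/is_derive_eq; apply.
      rewrite /GRing.scale/=; case: (m) pm0 => [|k] pm0; first by rewrite !(mul0r, mulr0, oppr0).
      by rewrite [k.+1.-1]/= !exprS; field; rewrite px0 expf_neq0.
    have d4 : is_derive x 1 (fun y => expR (- (c / p.[y])))
        (expR (- (c / p.[x])) * (c * p^`().[x] / p.[x] ^+ 2)).
      apply: is_derive1_comp.
      have d5 := is_deriveV px0 d1.
      have := is_deriveN (is_deriveZ c d5); move/is_derive_eq; apply.
      by rewrite /GRing.scale/=; field.
    have := is_deriveM (is_deriveM d2 d3) d4.
    move/is_derive_eq; apply.
    rewrite /flat_exp px /flat_exp_deriv !hornerE /GRing.scale/=.
    rewrite mulrfctE !exprS; move: pm0; set P := p.[x] ^+ m => pm0.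
    by field; rewrite px0 pm0.
- have -> : flat_exp (flat_exp_deriv q m) m.+2 x = 0.
    by rewrite /flat_exp px ltxx.
  have /factor_theorem[s ps] : root p x by apply/eqP.
  pose K := (m.+2)`!%:R / c ^+ m.+2.
  have K0 : 0 <= K by rewrite divr_ge0// exprn_ge0// ltW.
  have fle h : `|flat_exp q m (h + x)| <= `|q.[h + x]| * K * (h * s.[h + x]) ^+ 2.
    have -> : h * s.[h + x] = p.[h + x] by rewrite ps !hornerE; ring.
    rewrite /flat_exp; case: ifPn => [p0|_]; last first.
      by rewrite normr0 mulr_ge0 ?sqr_ge0// mulr_ge0.
    rewrite !normrM -!mulrA ler_wpM2l// normfV normrX (gtr0_norm p0).
    rewrite (ger0_norm (expR_ge0 _)) ler_pdivrMl ?exprn_gt0//.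
    apply: le_trans (expN_le m.+1 p0) _.
    rewrite /K expr_div_n le_eqVlt; apply/orP; left; apply/eqP.
    by rewrite !exprS; field; rewrite expf_neq0 ?gt_eqF.
  suff fl : h^-1 *: (flat_exp q m (h *: (1 : R) + x) - flat_exp q m x) @[h --> 0^'] --> (0 : R).
    by apply: DeriveDef; [apply/cvg_ex; exists 0|exact/cvg_lim].
  pose B (h : R) := `|q.[h + x]| * K * s.[h + x] ^+ 2 * `|h|.
  have Bl : B h @[h --> (0:R)^'] --> (0 : R).
    suff : B h @[h --> (0:R)] --> (0 : R) by apply: cvg_within_filter.
    have hx : h + x @[h --> (0 : R)] --> x.
      by rewrite -[X in _ --> X]add0r; apply: cvgD; [exact: cvg_id|exact: cvg_cst].
    have shp (r : {poly R}) : r.[h + x] @[h --> (0 : R)] --> r.[x].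
      apply: (@cvg_comp _ _ _ (fun h => h + x) (horner r) _ (nbhs x)).
        exact: hx.
      exact: continuous_horner.
    have n0 : `|h| @[h --> (0 : R)] --> (0 : R).
      by rewrite -[X in _ --> X](@normr0 _ R); apply: cvg_norm; exact: cvg_id.
    rewrite /B -[X in _ --> X](mulr0 (`|q.[x]| * K * s.[x] ^+ 2)); apply: cvgM.
      apply: cvgM; first by apply: cvgMl; apply: cvg_norm; exact: shp.
      by rewrite expr2; under eq_fun do rewrite expr2; apply: cvgM; exact: shp.
    exact: n0.
  apply: norm_squeeze_cvg0 Bl; near=> h.
  rewrite [in X in _ - X]/flat_exp px ltxx subr0 normrM normfV.
  rewrite ler_pdivrMl ?normr_gt0//; last by near: h; exact: nbhs_dnbhs_neq.
  rewrite -[_ *: _]/(h * 1) mulr1 (le_trans (fle h))// le_eqVlt; apply/orP; left.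
  have hh : `|h| * `|h| = h ^+ 2 by rewrite -normrM -expr2 normrX real_normK ?num_real.
  by apply/eqP; rewrite /B exprMn -hh; ring.
Unshelve. all: by end_near. Qed.

Lemma continuous_flat_exp q m : continuous (flat_exp q m).
Proof.
move=> x; apply: differentiable_continuous; apply/derivable1_diffP.
by case: (is_derive_flat_exp q m x).
Qed.

End flat_exponential.

Section bump.
Context {R : realType} {n : nat}.
Local Notation E := 'rV[R]_n.
Implicit Types a b : E.

Definition box a b : set E := [set x | forall i, a 0 i < x 0 i < b 0 i].

(** Positive exactly between a_i and b_i when a_i < b_i. *)
Definition box_poly a b (i : 'I_n) : {poly R} := ('X - (a 0 i)%:P) * ((b 0 i)%:P - 'X).

(** The parameters (q i, m i) make the family stable under partial derivatives. *)
Definition bump_family (c : R) (p : 'I_n -> {poly R}) (qm : 'I_n -> {poly R} * nat) (x : E) : R :=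
  \prod_i flat_exp (p i) c (qm i).1 (qm i).2 (x 0 i).

Lemma continuous_prodr (T : topologicalType) (I : Type) (r : seq I) (F : I -> T -> R) :
  (forall i, continuous (F i)) -> continuous (fun x => \prod_(i <- r) F i x).
Proof.
move=> cF; elim: r => [|i r IHr].
  under eq_fun do rewrite big_nil.
  exact: cst_continuous.
under eq_fun do rewrite big_cons.
move=> x; apply: cvgM; [exact: cF|exact: IHr].
Qed.

Lemma continuous_bump_family c p qm : 0 < c -> continuous (bump_family c p qm).
Proof.
move=> c0; apply: continuous_prodr => i x.
apply: (@continuous_comp _ _ _ (fun x : E => x 0 i) (flat_exp (p i) c (qm i).1 (qm i).2)).
  exact: coord_continuous.
exact: continuous_flat_exp.
Qed.

Lemma is_derive_bump_family c p qm k x : 0 < c ->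
  is_derive x (delta_mx 0 k) (bump_family c p qm)
    (bump_family c p (fun i => if i == k then (flat_exp_deriv (p i) c (qm i).1 (qm i).2, (qm i).2.+2) else qm i) x).
Proof.
move=> c0; apply: is_derive_lineP.
pose f i := flat_exp (p i) c (qm i).1 (qm i).2.
pose C := \prod_(i | i != k) f i (x 0 i).
rewrite (_ : (fun t => _) = (fun t => C * f k (t + x 0 k))); last first.
  apply/funext => t; rewrite /bump_family (bigD1 k)//= !mxE !eqxx mulr1 mulrC.
  congr (_ * _); apply: eq_bigr => i ik.
  by rewrite !mxE eqxx (negbTE ik) mulr0 add0r.
rewrite /bump_family (bigD1 k)//= eqxx.
rewrite (eq_bigr (fun i => f i (x 0 i))); last by move=> i /negbTE ->.
rewrite -/C mulrC.
have d1 : is_derive (0 : R) (1 : R) (fun t : R => t + x 0 k) 1.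
  have := is_deriveD (is_derive_id (0 : R) (1 : R)) (is_derive_cst (x 0 k) (0 : R) (1 : R)).
  by move/is_derive_eq; apply; rewrite addr0.
have d2 := is_derive_flat_exp (p k) c0 (qm k).1 (qm k).2 (0 + x 0 k).
have := is_deriveZ C (@is_derive1_comp _ _ (fun t : R => t + x 0 k) 0 _ _ d2 d1).
by move/is_derive_eq; apply; rewrite mulr1 add0r.
Qed.

(** A partial derivative only changes the parameters of one factor of the product. *)
Lemma iter_partial_bump_family c p qm s : 0 < c ->
  exists qm', iter_partial s (bump_family c p qm) = bump_family c p qm'.
Proof.
move=> c0; elim: s => [|k s [qm' IHs]]; first by exists qm.
exists (fun i => if i == k then (flat_exp_deriv (p i) c (qm' i).1 (qm' i).2, (qm' i).2.+2) else qm' i).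
rewrite /= IHs; apply/funext => x; rewrite /partial.
by have /@derive_val := is_derive_bump_family p qm' k x c0.
Qed.

Lemma smooth_bump_family c p qm : 0 < c -> smooth_on setT (bump_family c p qm).
Proof.
move=> c0 s x _; have [qm' ->] := iter_partial_bump_family p qm s c0.
split; first exact: continuous_bump_family.
by move=> k; case: (is_derive_bump_family p qm' k x c0).
Qed.

(** An empty interval is replaced by a polynomial without positive values. *)
Definition bump c a b : E -> R := bump_family c
  (fun i => if a 0 i < b 0 i then box_poly a b i else 0) (fun=> (1, 0%N)).

Lemma bumpE c a b x : 0 < c -> bump c a b x =
  if `[< box a b x >] then \prod_i expR (- (c / ((x 0 i - a 0 i) * (b 0 i - x 0 i)))) else 0.
Proof.
move=> c0; rewrite /bump /bump_family /flat_exp/=; case: asboolP => xab.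
  apply: eq_bigr => i _; have /andP[ai bi] := xab i.
  rewrite (lt_trans ai bi) /box_poly !hornerE invr1 mul1r.
  by rewrite mulr_gt0// subr_gt0.
have [i /negP xi] : exists i, ~ (a 0 i < x 0 i < b 0 i).
  by apply: contrapT => /forallNP H; apply: xab => i; have /contrapT := H i.
rewrite (bigD1 i)//=; case: ifPn; rewrite ?mul0r//.
case: ifPn => ab; rewrite ?horner0 ?ltxx// /box_poly !hornerE => h.
exfalso; move: xi; apply/negP; rewrite negbK; case: (ltP (a 0 i) (x 0 i)) => ax /=.
  by move: h; rewrite pmulr_rgt0 ?subr_gt0.
by move: h; nra.
Qed.

Lemma bump_ge0_le c a b x : 0 < c -> 0 <= bump c a b x <= \1_(box a b) x.
Proof.
move=> c0; rewrite bumpE// indicE; case: asboolP => xab; last by rewrite memNset//= lexx.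
rewrite mem_set//= prodr_ge0/=; last by move=> i _; exact: expR_ge0.
apply: prodr_ile1 => i _; rewrite expR_ge0/= -expR0 ler_expR oppr_le0.
have /andP[ai bi] := xab i.
by apply: divr_ge0; [exact: ltW|apply: mulr_ge0; rewrite subr_ge0 ltW].
Qed.

Definition closed_box a b : set E := [set x | forall i, a 0 i <= x 0 i <= b 0 i].

Lemma closed_closed_box a b : closed (closed_box a b).
Proof.
rewrite (_ : closed_box a b = \bigcap_(i in [set: 'I_n]) ((fun x : E => x 0 i) @^-1` `[a 0 i, b 0 i])).
  apply: closed_bigI => i _; apply: closed_comp; last exact: itv_closed.
  by move=> x _; exact: coord_continuous.
apply/seteqP; split => [t bt i _|t bt i]; first by rewrite /= in_itv; exact: bt.
by have := bt i I; rewrite /= in_itv.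
Qed.

Lemma compact_closed_box a b : compact (closed_box a b).
Proof.
have -> : closed_box a b = [set v : E | forall i, `[a 0 i, b 0 i]%classic (v 0 i)].
  by apply/seteqP; split => x xab i; have := xab i; rewrite /= in_itv.
by apply: (@rV_compact _ _ (fun i => `[a 0 i, b 0 i]%classic)) => i; exact: segment_compact.
Qed.

Lemma test_function_bump c a b (U : set E) : 0 < c -> closed_box a b `<=` U ->
  test_function U (bump c a b).
Proof.
move=> c0 abU.
have sub : closure [set x | bump c a b x != 0] `<=` closed_box a b.
  rewrite [X in _ `<=` X](closure_id _).1; last exact: closed_closed_box.
  apply: closure_subset => x /=; rewrite bumpE//; case: asboolP; rewrite ?eqxx// => xab _ i.
  by have /andP[/ltW -> /ltW ->] := xab i.
split; first exact: smooth_bump_family.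
  apply: subclosed_compact sub; [exact: closed_closure|exact: compact_closed_box].
exact: subset_trans sub abU.
Qed.

(** For fixed x in the box the exponents - c / p tend to 0 as c does, and outside the
    box all the bumps vanish. *)
Lemma bump_cvg a b x : bump k.+1%:R^-1 a b x @[k --> \oo] --> (\1_(box a b) x : R).
Proof.
under eq_fun do rewrite bumpE ?invr_gt0//.
rewrite indicE; case: asboolP => xab; last by rewrite memNset//; exact: cvg_cst.
rewrite mem_set//=.
pose F (c : R) := \prod_(i < n) expR (- (c / ((x 0 i - a 0 i) * (b 0 i - x 0 i)))).
have cF : continuous F.
  apply: continuous_prodr => i c.
  apply: (@continuous_comp _ _ _ (fun c : R => - (c / ((x 0 i - a 0 i) * (b 0 i - x 0 i)))) expR).
    by apply: cvgN; apply: cvgMr_tmp; exact: cvg_id.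
  exact: continuous_expR.
have F0 : F 0 = 1 by rewrite /F big1// => i _; rewrite mul0r oppr0 expR0.
suff: F k.+1%:R^-1 @[k --> \oo] --> F 0 by rewrite F0.
apply: (@cvg_comp _ _ _ (fun k => k.+1%:R^-1 : R) F _ (nbhs (0 : R))); last exact: cF.
exact: cvg_harmonic.
Qed.

End bump.

(** * Bounded functions on a box are generated by bumps *)

Import HBNNSimple.

Section monotone_class.
Context {R : realType} {n : nat}.
Local Notation E := 'rV[R]_n.
Local Notation mE := (borel 'rV[R]_n).
Local Notation leb := (@lebesgue R n).

Lemma boxI (a b c d : E) : box a b `&` box c d =
  box (\row_i Num.max (a 0 i) (c 0 i)) (\row_i Num.min (b 0 i) (d 0 i)).
Proof.
apply/seteqP; split => [x [ab cd] i|x abcd].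
  by rewrite !mxE gt_max lt_min; have /andP[-> ->] := ab i; have /andP[-> ->] := cd i.
by split => i; have := abcd i; rewrite !mxE gt_max lt_min => /andP[/andP[? ?] /andP[? ?]]; apply/andP.
Qed.

Lemma measurable_box (a b : E) : measurable (box a b : set mE).
Proof.
rewrite (_ : box a b = \bigcap_(i in [set: 'I_n])
    ((fun x : mE => (x : E) 0 i) @^-1` `]a 0 i, b 0 i[%classic)); last first.
  apply/seteqP; split => [t bt i _|t bt i]; first by rewrite /= in_itv; exact: bt.
  by have := bt i I; rewrite /= in_itv.
apply: fin_bigcap_measurable; first exact: finite_finset.
by move=> i _; rewrite -[X in measurable X]setTI; apply: measurable_coord.
Qed.

(** The corners of the boxes depend on rational data only, so that countably many
    boxes are enough for all the points of U. *)
Lemma box_neighborhood (U : set E) (x : E) : open U -> U x ->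
  exists k : 'rV[rat]_n * nat,
    let a := \row_i (ratr (k.1 0 i) - k.2.+1%:R^-1 : R) in
    let b := \row_i (ratr (k.1 0 i) + k.2.+1%:R^-1 : R) in
    box a b x /\ closed_box a b `<=` U.
Proof.
move=> oU Ux.
have /nbhs_ballP[e /= e0 eU] : nbhs x U by exact: open_nbhs_nbhs.
have [m me] : exists m : nat, m.+1%:R^-1 < e / 2.
  exists (Num.bound (e / 2)^-1); rewrite invf_plt ?posrE ?divr_gt0//.
  rewrite (lt_trans (archi_boundP _)) ?ltr_nat// invr_ge0 ltW// divr_gt0//.
have m0 : 0 < m.+1%:R^-1 :> R by rewrite invr_gt0.
have qP (i : 'I_n) : exists q : rat, `|ratr q - x 0 i : R| < m.+1%:R^-1.
  have [|q] := @rat_in_itvoo R (x 0 i - m.+1%:R^-1) (x 0 i + m.+1%:R^-1).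
    by rewrite ltrD2l gtrN.
  by rewrite in_itv/= => qi; exists q; rewrite ltr_distl.
have [q qt] := choice qP.
exists (\row_i q i, m); split => [i|s bs].
  by have := qt i; rewrite !mxE/= distrC ltr_distl.
apply: eU; split => // i j; rewrite /ball/= (ord1 i).
have := bs j; rewrite !mxE/= => sj.
have : `|s 0 j - ratr (q j)| <= m.+1%:R^-1 by rewrite ler_distl.
rewrite distrC => sq.
rewrite (le_lt_trans (ler_distD (ratr (q j)) _ _))// (splitr e) ltrD//.
  by rewrite distrC (lt_trans (qt j)).
exact: le_lt_trans sq me.
Qed.

Lemma open_bigcup_box (U : set E) : open U -> U =
  \bigcup_(k in [set k : 'rV[rat]_n * nat | 
      closed_box (\row_i (ratr (k.1 0 i) - k.2.+1%:R^-1 : R))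
                 (\row_i (ratr (k.1 0 i) + k.2.+1%:R^-1 : R)) `<=` U])
    box (\row_i (ratr (k.1 0 i) - k.2.+1%:R^-1 : R))
        (\row_i (ratr (k.1 0 i) + k.2.+1%:R^-1 : R)).
Proof.
move=> oU; apply/seteqP; split => x.
  by move=> /(box_neighborhood oU)[k [kx kU]]; exists k.
by move=> [k kU kx]; apply: kU => i; have /andP[/ltW -> /ltW ->] := kx i.
Qed.

Definition boxes : set (set mE) := [set A | exists a b : E, A = box a b].

Lemma measurable_boxes (A : set mE) : measurable A -> <<s boxes >> A.
Proof.
apply: smallest_sub; first exact: smallest_sigma_algebra.
move=> U oU; rewrite (open_bigcup_box oU).
have -> : forall (D : set ('rV[rat]_n * nat)) F, \bigcup_(k in D) F k =
    \bigcup_k (if k \in D then F k else set0) :> set mE.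
  move=> D F; apply/seteqP; split => [x [k Dk Fk]|x [k _]].
    by exists k => //; rewrite mem_set.
  by case: ifPn => // /set_mem Dk Fk; exists k.
apply: (@countable_bigcupT_measurable _ (g_sigma_algebraType boxes)) => // k.
by case: ifP => // _; apply: sub_sigma_algebra; do 2 eexists.
Qed.

(* The axioms of the monotone class argument: L stands for the property to be
   established for bounded measurable functions vanishing outside the box. *)
Variables (a b : E) (L : (mE -> R) -> Prop).
Hypothesis Lbump : forall k (a' b' : E), 
  (forall i, a 0 i <= a' 0 i /\ b' 0 i <= b 0 i) -> L (bump k.+1%:R^-1 a' b').
Hypothesis Llin : forall (k : R) f g, L f -> L g -> L (fun x => k * f x + g x).
Hypothesis Llim : forall (f_ : nat -> mE -> R) (f : mE -> R) (C : R), (forall m, L (f_ m)) ->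
  (forall m, measurable_fun setT (f_ m)) ->
  (forall m x, `|f_ m x| <= C * \1_(box a b) x) ->
  (forall x, f_ ^~ x @ \oo --> f x) -> L f.

Let Lbox (c d : E) : L (\1_(box a b `&` box c d)).
Proof.
rewrite boxI; set a' := \row_i _; set b' := \row_i _.
apply: (@Llim (fun k => bump k.+1%:R^-1 a' b') _ 1).
- move=> k; apply: Lbump => i.
  by rewrite !mxE le_max lexx ge_min lexx.
- move=> k; apply: continuous_measurable_borel => [|x _]; first exact: openT.
  by apply: continuous_bump_family; rewrite invr_gt0.
- move=> k x; have /(_ _)/andP[|k0 k1] := @bump_ge0_le R n k.+1%:R^-1 a' b' x.
    by rewrite invr_gt0.
  rewrite ger0_norm// mul1r (le_trans k1)// /a' /b' -boxI !indicE ler_nat.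
  by rewrite in_setI; case: (x \in box a b); case: (x \in box c d).
- by move=> x; exact: bump_cvg.
Qed.

Let L0 : L (cst 0).
Proof.
have := Llin (-1) (Lbump 0%N (fun i => conj (lexx _) (lexx _))) (Lbump 0%N (fun i => conj (lexx _) (lexx _))).
by congr L; apply/funext => x; rewrite mulN1r addNr.
Qed.

Let Lscale k f : L f -> L (fun x => k * f x).
Proof. by move=> Lf; have := Llin k Lf L0; congr L; apply/funext => x; rewrite addr0. Qed.

Let LB f g : L f -> L g -> L (fun x => f x - g x).
Proof.
move=> Lf Lg; have := Llin (-1) Lg Lf; congr L; apply/funext => x.
by rewrite mulN1r addrC.
Qed.

Let Lsum (I : Type) (s : seq I) (F : I -> mE -> R) : (forall i, L (F i)) ->
  L (fun x => \sum_(i <- s) F i x).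
Proof.
move=> LF; elim: s => [|i s IHs].
  by have := L0; congr L; apply/funext => x; rewrite big_nil.
have := Llin 1 (LF i) IHs; congr L; apply/funext => x.
by rewrite big_cons mul1r.
Qed.

(** The boxes form a pi-system which generates the Borel sets, and the sets whose
    indicator, restricted to the given box, belongs to L form a lambda-system. *)
Let Lindic (A : set mE) : measurable A -> L (\1_((box a b : set mE) `&` A)).
Proof.
move=> /measurable_boxes.
pose H : set (set mE) := [set A | measurable A /\ L (\1_((box a b : set mE) `&` A))].
suff /[apply] : <<s boxes >> `<=` H by case.
apply: lambda_system_subset => //.
- move=> _ _ [c [d ->]] [c' [d' ->]]; rewrite boxI.
  by do 2 eexists.
- split => //.
  + split; first exact: measurableT.
    have := Lbox a b; congr L; congr (\1_ _); rewrite setIid setIT//.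
  + move=> A' B BA [mA LA] [mB LB']; split; first exact: measurableD.
    have := LB LA LB'; congr L; apply/funext => x.
    rewrite !indicE [_ \in _ `&` (_ `\` _)]in_setI in_setD !in_setI; case: (x \in box a b) => /=; last by rewrite subrr.
    have [xB|xB] := boolP (x \in B); last by rewrite subr0 andbT.
    by rewrite (mem_set (BA _ (set_mem xB))) subrr.
  + move=> F ndF HF; split; first by apply: bigcupT_measurable => i; case: (HF i).
    apply: (@Llim (fun k => \1_((box a b : set mE) `&` F k)) _ 1).
    * by move=> m; case: (HF m).
    * move=> m; apply: measurable_indic; apply: measurableI; first exact: measurable_box.
      by case: (HF m).
    * move=> m x; rewrite !indicE in_setI normr_nat mul1r ler_nat.
      by do 2 case: (_ \in _).
    * move=> x; apply: cvg_near_cst; rewrite indicE in_setI.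
      have [[i _ Fix]|nF] := pselect ((\bigcup_i F i) x).
        exists i => // j /= ij; rewrite indicE in_setI.
        have Fjx : F j x by move: x Fix; exact/subsetPset/ndF.
        have UFx : (\bigcup_i F i) x by exists i.
        by rewrite (mem_set Fjx) (mem_set UFx).
      apply: nearW => j; have nFj : ~ F j x by move=> Fjx; apply: nF; exists j.
      by rewrite indicE in_setI (memNset nF) (memNset nFj).
- move=> _ [c [d ->]]; split; first exact: measurable_box.
  exact: Lbox.
Qed.

Let Lnneg (f : mE -> R) (C : R) : measurable_fun setT f -> (forall x, 0 <= f x) ->
  (forall x, f x <= C * \1_(box a b) x) -> L f.
Proof.
move=> mf f0 fC.
have mEf : measurable_fun setT (EFin \o f) by exact/measurable_EFinP.
have Ef0 x : setT x -> (0 <= (EFin \o f) x)%E by rewrite /= lee_fin.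
pose g k := nnsfun_approx measurableT mEf k.
have gf k x : g k x <= f x.
  by rewrite -lee_fin /g nnsfun_approxE; exact: le_approx.
have g0 k x : 0 <= g k x by exact: fun_ge0.
apply: (@Llim (fun k => g k) _ C).
- move=> k.
  have := @Lsum _ (finmap.enum_fset (fset_set (range (g k)))) (fun y x =>
    y * \1_((box a b : set mE) `&` (g k @^-1` [set y])) x) (fun y => Lscale _ (Lindic (measurable_funPTI (g k) (measurable_set1 y)))).
  congr L; apply/funext => x.
  rewrite (fimfunE (g k) x) fsbig_finite//=; apply: eq_bigr => y _.
  rewrite !indicE in_setI; have [xab//|xab] := boolP (x \in box a b).
  have : g k x <= 0.
    by rewrite (le_trans (gf _ _))// (le_trans (fC _))// indicE (negbTE xab) mulr0.
  rewrite le_eqVlt ltNge g0 orbF => /eqP gx0 /=.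
  case: (boolP (x \in _)) => //; rewrite mulr0 mulr1 inE/= gx0 => <-.
  by [].
- by move=> k; exact: measurable_funPT.
- by move=> k x; rewrite ger0_norm// (le_trans (gf _ _)).
- move=> x; have := cvg_nnsfun_approx measurableT mEf Ef0 (I : setT x).
  exact: fine_cvg.
Qed.

(** A class of functions which contains the bumps supported in a box and is stable
    under linear combinations and dominated pointwise limits contains the indicators
    of the subboxes, as limits of bumps, hence those of all the Borel subsets, hence
    the bounded measurable functions. This is how identities that are known for test
    functions are extended to functions without any regularity, such as signs. *)
Lemma monotone_class_box (f : mE -> R) (C : R) : measurable_fun setT f ->
  (forall x, `|f x| <= C * \1_(box a b) x) -> L f.
Proof.
move=> mf fC.
have Lp : L (fun x => Num.max (f x) 0).
  apply: (@Lnneg _ C) => [|x|x].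
  - exact: measurable_maxr.
  - by rewrite le_max lexx orbT.
  - by rewrite ge_max (le_trans (ler_norm _) (fC x))/= (le_trans (normr_ge0 _) (fC x)).
have Ln : L (fun x => Num.max (- f x) 0).
  apply: (@Lnneg _ C) => [|x|x].
  - by apply: measurable_maxr => //; exact: measurable_funN.
  - by rewrite le_max lexx orbT.
  - by have := fC x; rewrite -normrN => fCx; rewrite ge_max (le_trans (ler_norm _) fCx)/= (le_trans (normr_ge0 _) fCx).
have := LB Lp Ln; congr L; apply/funext => x.
have [f0|f0] := leP 0 (f x).
  by rewrite max_r ?oppr_le0// subr0.
by rewrite max_l ?oppr_ge0 ?ltW// sub0r opprK.
Qed.

End monotone_class.

(** * The fundamental lemma of the calculus of variations *)

Section lebesgue_ae.
Context {R : realType} {n : nat}.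
Local Notation E := 'rV[R]_n.
Local Notation mE := (borel 'rV[R]_n).
Local Notation leb := (@lebesgue R n).

Lemma compact_closed_rV (Q : set E) : compact Q -> closed Q.
Proof. by apply: compact_closed; exact: norm_hausdorff. Qed.

Lemma compact_measurable (Q : set E) : compact Q -> measurable (Q : set mE).
Proof. by move=> /compact_closed_rV; exact: closed_measurable_borel. Qed.

Lemma Lp_loc1_integrable (U : set E) (u : E -> R) (Q : set E) : open U ->
  Lp_loc 1 U u -> compact Q -> Q `<=` U ->
  leb.-integrable setT (EFin \o ((u : mE -> R) \_ Q)).
Proof.
move=> oU [mu Lu] cQ QU; apply/integrableP; split.
  apply/measurable_EFinP/(measurable_restrictT _ _).1; first exact: compact_measurable.
  by apply: measurable_funS mu => //; exact: open_measurable_borel.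
by have := Lu Q cQ QU; rewrite Lnorm1.
Qed.

(** An open set is a countable union of boxes whose closures it contains. *)
Lemma ae_open_cover (U : set E) (P : E -> Prop) : open U ->
  (forall a b : E, closed_box a b `<=` U -> \forall x \ae leb, box a b x -> P x) ->
  \forall x \ae leb, U x -> P x.
Proof.
move=> oU H.
pose a (k : 'rV[rat]_n * nat) : E := \row_i (ratr (k.1 0 i) - k.2.+1%:R^-1 : R).
pose b (k : 'rV[rat]_n * nat) : E := \row_i (ratr (k.1 0 i) + k.2.+1%:R^-1 : R).
have : \forall x \ae leb, forall m : nat,
    if unpickle m is Some k then closed_box (a k) (b k) `<=` U -> box (a k) (b k) x -> P x else True.
  apply/ae_foralln => m; case: unpickle => [k|]; last exact: aeW.
  have [sU|nsU] := pselect (closed_box (a k) (b k) `<=` U); last exact: aeW.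
  by apply: aeS (H _ _ sU) => x Hx _.
apply: aeS => x Hx /(box_neighborhood oU)[k [kx kU]].
by have := Hx (pickle k); rewrite pickleK; exact.
Qed.

Lemma measurable_bump c (a b : E) : 0 < c -> measurable_fun setT (bump c a b : mE -> R).
Proof.
move=> c0; apply: continuous_measurable_borel => [|x _]; first exact: openT.
exact: continuous_bump_family.
Qed.

Lemma integrable_mul_bounded (w f : mE -> R) (C : R) :
  leb.-integrable setT (EFin \o w) -> measurable_fun setT f ->
  (forall x, `|f x| <= C) -> leb.-integrable setT (fun x => (w x * f x)%:E).
Proof.
move=> iw mf fC; have /integrableP[/measurable_EFinP mw _] := iw.
apply: (@le_integrable _ _ _ leb _ measurableT _ (fun x => C%:E * (EFin \o w) x)%E).
- by apply/measurable_EFinP; exact: measurable_funM.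
- move=> x _ /=; rewrite lee_fin !normrM mulrC ler_wpM2r//.
  by rewrite (le_trans (fC x))// ler_norm.
- exact: integrableZl.
Qed.

Lemma box_sub_closed_box (a b : E) : box a b `<=` closed_box a b.
Proof. by move=> x xab i; have /andP[/ltW -> /ltW ->] := xab i. Qed.

(** On a box whose closure lies in U, the vanishing of the integrals against bumps
    extends to all bounded measurable functions by the monotone class argument; with
    indicators of measurable sets this forces v = 0 almost everywhere on the box. *)
Lemma fundamental_lemma (U : set E) (v : E -> R) : open U -> Lp_loc 1 U v ->
  (forall phi, test_function U phi -> (\int[leb]_(x in U) (v x * phi x)%:E = 0)%E) ->
  \forall x \ae leb, U x -> v x = 0.
Proof.
move=> oU Lv Hv; apply: ae_open_cover => // a b abU.
pose Q : set mE := closed_box a b.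
have mQ : measurable Q by apply: compact_measurable; exact: compact_closed_box.
pose w : mE -> R := (v : mE -> R) \_ Q.
have iw : leb.-integrable setT (EFin \o w).
  by apply: Lp_loc1_integrable Lv _ abU => //; exact: compact_closed_box.
have /integrableP[/measurable_EFinP mw _] := iw.
pose L (f : mE -> R) := [/\ measurable_fun setT f, exists C, forall x, `|f x| <= C &
  (\int[leb]_x (w x * f x)%:E = 0)%E].
have Lall (f : mE -> R) (C : R) : measurable_fun setT f ->
    (forall x, `|f x| <= C * \1_(box a b) x) -> L f.
  apply: monotone_class_box.
  - move=> k a' b' ab'; have c0 : 0 < k.+1%:R^-1 :> R by rewrite invr_gt0.
    have sub : closed_box a' b' `<=` Q.
      move=> x xab i; have [? ?] := ab' i; have /andP[? ?] := xab i.
      by apply/andP; split; [apply: le_trans; eassumption|apply: le_trans; eassumption].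
    split.
    + exact: measurable_bump.
    + exists 1 => x; have /andP[b0 b1] := bump_ge0_le a' b' x c0.
      by rewrite ger0_norm// (le_trans b1)// indicE lern1; case: (_ \in _).
    + have := Hv _ (test_function_bump c0 (subset_trans sub abU)).
      rewrite integral_mkcond => <-; apply: eq_integral => x _ /=.
      rewrite /w !patchE; have [xQ|xQ] := boolP (x \in Q).
        by rewrite mem_set//; apply: abU; exact: set_mem xQ.
      rewrite bumpE//; case: asboolP => [xab|_]; last by rewrite !mulr0; case: ifP.
      by have /mem_set := sub _ (box_sub_closed_box xab); rewrite (negbTE xQ).
  - move=> k f1 f2 [m1 [C1 b1] i1] [m2 [C2 b2] i2]; split.
    + by apply: measurable_funD => //; exact: measurable_funM.
    + exists (`|k| * C1 + C2) => x; rewrite (le_trans (ler_normD _ _))// lerD//.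
      by rewrite normrM ler_wpM2l.
    + under eq_integral do rewrite mulrDr mulrCA EFinD EFinM.
      rewrite integralD//=.
      * by rewrite integralZl// ?i1 ?i2 ?mule0 ?adde0//; exact: integrable_mul_bounded b1.
      * by apply: integrableZl => //; exact: integrable_mul_bounded b1.
      * exact: integrable_mul_bounded b2.
  - move=> f_ g C' Lf mf f_C f_g.
    have mg : measurable_fun setT g by apply: measurable_fun_cvg mf _ => x _; exact: f_g.
    split => //.
      exists `|C'| => x.
      have cv : `|f_ m x| @[m --> \oo] --> `|g x| by apply: cvg_norm; exact: f_g.
      rewrite -(cvg_lim _ cv)//; apply: limr_le; first by apply/cvg_ex; exists `|g x|.
      apply: nearW => m.
      rewrite (le_trans (f_C m x))// (le_trans (ler_norm _))// normrM indicE.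
      by rewrite normr_nat ler_piMr// lern1; case: (_ \in _).
    have [|||||_ _] := @dominated_convergence _ _ _ leb setT measurableT
      (fun m x => (w x * f_ m x)%:E) (fun x => (w x * g x)%:E)
      (fun x => `|C'|%:E * `|(EFin \o w) x|)%E.
    + by move=> m; apply/measurable_EFinP; exact: measurable_funM.
    + by apply/measurable_EFinP; exact: measurable_funM.
    + apply: aeW => x _; apply: cvg_EFin; first exact: nearW.
      by apply: cvgMl_tmp; exact: f_g.
    + by apply: integrableZl => //; exact: integrable_abse.
    + apply: aeW => x m _ /=; rewrite lee_fin normrM mulrC ler_wpM2r//.
      rewrite (le_trans (f_C m x))// (le_trans (ler_norm _))// normrM indicE.
      by rewrite normr_nat ler_piMr// lern1; case: (_ \in _).
    + under eq_fun => m do (have [_ _ ->] := Lf m).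
      by move=> /cvg_lim <-//; rewrite lim_cst.
have mbox : measurable (box a b : set mE) by exact: measurable_box.
have : ae_eq leb (box a b : set mE) (EFin \o w) (cst 0%E).
  apply: integral_ae_eq => //; first by apply: integrableS iw.
  move=> A Aab mA; rewrite integral_cst// mul0e integral_mkcond.
  have [] := Lall (\1_A) 1.
  - exact: measurable_indic.
  - move=> x; rewrite mul1r !indicE normr_nat ler_nat.
    have [xA|//] := boolP (x \in A).
    by rewrite mem_set//; apply: Aab; exact: set_mem xA.
  move=> _ _ <-; apply: eq_integral => x _; rewrite patchE indicE.
  by case: (x \in A); rewrite ?mulr1 ?mulr0.
apply: aeS => x + abx => /(_ abx)/= [].
rewrite /w patchE mem_set//; exact: box_sub_closed_box.
Qed.

End lebesgue_ae.

(** * Continuity of translations in L^1 *)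

Lemma cvg_line (R : realType) (V : normedModType R) (T : Type) (F : set_system T)
    (x v : V) (u : T -> R) : Filter F ->
  u t @[t --> F] --> (0 : R) -> x + u t *: v @[t --> F] --> x.
Proof.
move=> FF u0; have uv : u t *: v @[t --> F] --> 0 *: v by exact: cvgZr_tmp.
suff : x + u t *: v @[t --> F] --> x + 0 *: v by rewrite scale0r addr0.
by apply: cvgD; [exact: cvg_cst|exact: uv].
Qed.

(** Reduces limits at a point to sequences, for which dominated convergence is
    stated. The sequences may take the value p, so f p = l comes out as well. *)
Lemma cvg_nbhs_seq (R : realType) (f : R -> R) (p l : R) :
  (forall u : nat -> R, u m @[m --> \oo] --> p -> f (u m) @[m --> \oo] --> l) ->
  f t @[t --> p] --> l.
Proof.
move=> H; have fp : f p = l.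
  by apply: (@cvg_unique _ (@norm_hausdorff _ R) (f p @[_ --> \oo]) _ _ _);
    [exact: cvg_cst|apply: (H (fun=> p)); exact: cvg_cst].
rewrite -fp; apply/continuous_withinNx; rewrite fp.
by apply/cvgr_dnbhsP => u [_ up]; exact: H.
Qed.

Section L1_translation.
Context {R : realType} {n : nat}.
Local Notation E := 'rV[R]_n.
Local Notation mE := (borel 'rV[R]_n).
Local Notation leb := (@lebesgue R n).
Variable v : E.

Definition translate (t : R) (f : mE -> R) : mE -> R := fun x => f ((x : E) + t *: v).

Definition L1dist (f g : mE -> R) : \bar R := (\int[leb]_x `|f x - g x|%:E)%E.

Definition L1_continuous (f : mE -> R) : Prop :=
  leb.-integrable setT (EFin \o f) /\
  forall e : R, 0 < e -> \forall t \near (0 : R), (L1dist (translate t f) f <= e%:E)%E.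

Lemma integrable_translate t f : leb.-integrable setT (EFin \o f) ->
  leb.-integrable setT (EFin \o translate t f).
Proof. by move=> fi; exact: (integrable_shift (t *: v) fi). Qed.

Let mint (f : mE -> R) : leb.-integrable setT (EFin \o f) -> measurable_fun setT f.
Proof. by move=> /integrableP[/measurable_EFinP]. Qed.

Lemma L1dist_triangle (f g h : mE -> R) : measurable_fun setT f ->
  measurable_fun setT g -> measurable_fun setT h ->
  (L1dist f h <= L1dist f g + L1dist g h)%E.
Proof.
move=> mf mg mh; rewrite /L1dist -ge0_integralD//; last first.
- by apply/measurable_EFinP; apply: measurableT_comp => //; exact: measurable_funB.
- by apply/measurable_EFinP; apply: measurableT_comp => //; exact: measurable_funB.
apply: ge0_le_integral => //.
- by apply/measurable_EFinP; apply: measurableT_comp => //; exact: measurable_funB.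
- by apply: emeasurable_funD; apply/measurable_EFinP; apply: measurableT_comp => //; exact: measurable_funB.
- by move=> x _; rewrite -EFinD lee_fin ler_distD.
Qed.

Lemma L1distC f g : L1dist f g = L1dist g f.
Proof. by apply: eq_integral => x _; rewrite distrC. Qed.

Lemma L1dist_translate t f g : measurable_fun setT f -> measurable_fun setT g ->
  L1dist (translate t f) (translate t g) = L1dist f g.
Proof.
move=> mf mg; apply: (@ge0_integral_shift _ _ (t *: v) (fun x => `|f x - g x|%:E)).
  by apply/measurable_EFinP; apply: measurableT_comp => //; exact: measurable_funB.
by move=> x; rewrite lee_fin.
Qed.

Let L1_continuous_lin (k : R) f g : L1_continuous f -> L1_continuous g ->
  L1_continuous (fun x => k * f x + g x).
Proof.
move=> [fi fc] [gi gc]; have mf := mint fi; have mg := mint gi; split.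
  rewrite (_ : EFin \o _ = (fun x => k%:E * (EFin \o f) x + (EFin \o g) x))%E//.
  by apply: integrableD => //; exact: integrableZl.
move=> e e0; have k1 : 0 < `|k| + 1 by rewrite ltr_wpDl.
have e1 : 0 < e / 2 / (`|k| + 1) by rewrite !divr_gt0.
have e2 : 0 < e / 2 by rewrite divr_gt0.
apply: filterS2 (fc _ e1) (gc _ e2) => t ft gt.
have mtf := mint (integrable_translate t fi).
have mtg := mint (integrable_translate t gi).
apply: (@le_trans _ _ (`|k|%:E * L1dist (translate t f) f + L1dist (translate t g) g)%E).
  rewrite /L1dist -ge0_integralZl//; last first.
    by apply/measurable_EFinP; apply: measurableT_comp => //; exact: measurable_funB.
  rewrite -ge0_integralD//.
  - apply: ge0_le_integral => //.
    + apply/measurable_EFinP; apply: measurableT_comp => //; apply: measurable_funB.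
        by apply: measurable_funD => //; exact: measurable_funM.
      by apply: measurable_funD => //; exact: measurable_funM.
    + apply: emeasurable_funD; apply/measurable_EFinP.
        apply: measurable_funM => //.
        by apply: measurableT_comp => //; exact: measurable_funB.
      by apply: measurableT_comp => //; exact: measurable_funB.
    + move=> x _; rewrite -EFinM -EFinD lee_fin /translate -normrM.
      apply: le_trans (ler_normD _ _); rewrite le_eqVlt; apply/orP; left; apply/eqP.
      by congr (`| _ |); ring.
  - apply/measurable_EFinP; apply: measurable_funM => //.
    by apply: measurableT_comp => //; exact: measurable_funB.
  - by apply/measurable_EFinP; apply: measurableT_comp => //; exact: measurable_funB.
rewrite (splitr e) EFinD; apply: leeD => //.
apply: (@le_trans _ _ (`|k|%:E * (e / 2 / (`|k| + 1))%:E)%E).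
  by apply: lee_wpmul2l.
by rewrite -EFinM lee_fin mulrA ler_pdivrMr// [leLHS]mulrC ler_wpM2l ?ltW// ltrDl.
Qed.

(** Translations are isometries of L^1, so the property passes to limits in L^1. *)
Let L1_continuous_lim f : leb.-integrable setT (EFin \o f) ->
  (forall e : R, 0 < e -> exists2 g, L1_continuous g & (L1dist f g <= e%:E)%E) ->
  L1_continuous f.
Proof.
move=> fi H; split => // e e0; have e3 : 0 < e / 3 by rewrite divr_gt0.
have [g [gi gc] fg] := H _ e3.
have mf := mint fi; have mg := mint gi.
apply: filterS (gc _ e3) => t gt.
have mtf := mint (integrable_translate t fi).
have mtg := mint (integrable_translate t gi).
have -> : e = e / 3 + (e / 3 + e / 3) by field.
rewrite EFinD (le_trans (L1dist_triangle mtf mtg mf))//.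
rewrite L1dist_translate// leeD// EFinD (le_trans (L1dist_triangle mtg mg mf))// leeD//.
by rewrite L1distC.
Qed.

Lemma integrable_bounded_cube (f : mE -> R) (C c : R) : measurable_fun setT f ->
  (forall x, `|f x| <= C * \1_(cube c) x) -> leb.-integrable setT (EFin \o f).
Proof.
move=> mf fC; apply: (@le_integrable _ _ _ leb _ measurableT _ (EFin \o (fun x => C * \1_(cube c) x))).
- exact/measurable_EFinP.
- move=> x _ /=; rewrite lee_fin (le_trans (fC x))// ler_norm//.
- rewrite (_ : EFin \o _ = (fun x => C%:E * (\1_(cube c) x)%:E))%E//.
  apply: integrableZl => //; apply/integrableP; split.
    by apply/measurable_EFinP; apply: measurable_indic; exact: measurable_cube.
  under eq_integral do rewrite gee0_abs ?lee_fin//.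
  by rewrite integral_indic ?setIT; [exact: lebesgue_cube_lty|exact: measurableT|exact: measurable_cube].
Qed.

Lemma box_cube (a b : E) : box a b `<=` cube (`|a| + `|b|).
Proof.
move=> x xab i; have /andP[ax xb] := xab i.
have := cube_norm a i; have := cube_norm b i; rewrite !ler_norml => /andP[? ?] /andP[? ?].
by apply/andP; split; have := normr_ge0 a; have := normr_ge0 b; lra.
Qed.

(** Dominated convergence: for |t| <= 1 all the translates of the bump vanish outside
    a fixed cube. *)
Let L1_continuous_bump c (a b : E) : 0 < c -> L1_continuous (bump c a b).
Proof.
move=> c0; have mb := measurable_bump a b c0.
have b01 x : 0 <= bump c a b x <= \1_(box a b) x := bump_ge0_le a b x c0.
split.
  apply: (@integrable_bounded_cube _ 1 (`|a| + `|b|)) => // x.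
  have /andP[b0 b1] := b01 x; rewrite ger0_norm// mul1r (le_trans b1)// !indicE ler_nat.
  by have [xab|//] := boolP (x \in box a b); rewrite mem_set//; apply: box_cube; exact: set_mem xab.
pose F (t : R) (x : mE) : R := if `|t| <= 1 then `|translate t (bump c a b) x - bump c a b x| else 0.
pose I (t : R) : R := fine (\int[leb]_x (F t x)%:E)%E.
have mF t : measurable_fun setT (F t).
  rewrite /F; case: (`|t| <= 1) => //; apply: measurableT_comp => //; apply: measurable_funB => //.
  exact: (measurableT_comp mb (measurable_translation (t *: v))).
pose c' := `|a| + `|b| + `|v|.
have Fle t x : `|F t x| <= 2 * \1_(cube c') x.
  have nn : 0 <= 2 * \1_(cube c') x :> R by rewrite mulr_ge0// indicE.
  rewrite /F; case: ifPn => t1; last by rewrite normr0.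
  rewrite normr_id.
  have cc : forall y : E, box a b y -> `|x - y| <= `|v| -> cube c' x.
    move=> y yab yx i; rewrite -(subrK (y 0 i) (x 0 i)) (le_trans (ler_normD _ _))//.
    rewrite addrC lerD ?(box_cube yab)//; apply: le_trans yx.
    by have := cube_norm (x - y) i; rewrite !mxE.
  have bz (y : E) : ~ cube c' x -> `|x - y| <= `|v| -> bump c a b y = 0.
    move=> nx xy; apply/eqP; rewrite eq_le; have /andP[-> b1] := b01 y; rewrite andbT.
    rewrite (le_trans b1)// indicE memNset// => yab; apply: nx; exact: cc yab xy.
  have tv : `|t *: v| <= `|v| by rewrite normrZ ler_piMl.
  have [xc|xc] := pselect (cube c' x); last first.
    rewrite /translate bz ?bz ?subrr ?normr0//.
    by rewrite opprD addrA subrr sub0r normrN.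
  rewrite indicE mem_set// mulr1.
  have le1 y : 0 <= bump c a b y <= 1.
    have /andP[-> b1] := b01 y; rewrite (le_trans b1)// indicE lern1; by case: (_ \in _).
  rewrite /translate; move: (le1 (x + t *: v : E)) (le1 x); set p := bump _ _ _ _; set q := bump _ _ _ _.
  by move=> /andP[? ?] /andP[? ?]; rewrite ler_norml; apply/andP; split; lra.
have I0 : I t @[t --> (0 : R)] --> (0 : R).
  apply: cvg_nbhs_seq => u u0.
  have [|||||_ _] := @dominated_convergence _ _ _ leb setT measurableT
      (fun m x => (F (u m) x)%:E) (cst 0%E) (fun x => (2 * \1_(cube c') x)%:E).
  - by move=> m; exact/measurable_EFinP.
  - exact: measurable_cst.
  - apply: aeW => x _; apply: cvg_EFin; first exact: nearW.
    apply: (@norm_squeeze_cvg0 _ _ _ _ (fun m => `|translate (u m) (bump c a b) x - bump c a b x|)).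
      by apply: nearW => m; rewrite /F; case: ifP; rewrite ?normr_id ?normr0.
    have cb : bump c a b ((x : E) + u m *: v) @[m --> \oo] --> bump c a b x.
      apply: (@cvg_comp _ _ _ (fun m => (x : E) + u m *: v) (bump c a b) _ (nbhs (x : E))).
        exact: cvg_line.
      exact: continuous_bump_family.
    rewrite -[X in _ --> X](@normr0 _ R); apply: cvg_norm.
    by rewrite -(subrr (bump c a b x)); apply: cvgB; [exact: cb|exact: cvg_cst].
  - apply: (@integrable_bounded_cube _ 2 c').
      by apply: measurable_funM => //; apply: measurable_indic; exact: measurable_cube.
    by move=> x; rewrite ger0_norm// mulr_ge0// indicE.
  - by apply: aeW => x m _; rewrite lee_fin Fle.
  - by rewrite integral0 => /fine_cvg.
move=> e e0.
move/cvgr0_norm_lt : I0 => /(_ _ e0); apply: filterS2 (nbhs0_le (@ltr01 R)) => t t1 It.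
rewrite (_ : L1dist _ _ = (\int[leb]_x (F t x)%:E)%E); last first.
  by apply: eq_integral => x _; rewrite /F t1.
rewrite -(@fineK _ (\int[leb]_x (F t x)%:E)%E).
  by rewrite lee_fin (le_trans (ler_norm _))// ltW.
apply: integrable_fin_num => //; apply: (@integrable_bounded_cube _ 2 c') => //.
Qed.

(** The bumps have this property by dominated convergence, the bounded functions on a
    box inherit it by the monotone class argument, and every integrable function is
    the limit in L^1 of its truncations to large boxes and bounded values. *)
Lemma L1_translation_continuous w : leb.-integrable setT (EFin \o w) -> L1_continuous w.
Proof.
move=> wi; have mw := mint wi.
have bounded_case (a b : E) (f : mE -> R) (C : R) : measurable_fun setT f ->
    (forall x, `|f x| <= C * \1_(box a b) x) -> L1_continuous f.
  have boxi (g : mE -> R) (C' : R) : measurable_fun setT g ->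
     (forall x, `|g x| <= C' * \1_(box a b) x) -> leb.-integrable setT (EFin \o g).
    move=> mg gC; apply: (@integrable_bounded_cube _ `|C'| (`|a| + `|b|)) => // x.
    rewrite (le_trans (gC x))// (le_trans (ler_norm _))// normrM ler_wpM2l//.
    rewrite !indicE normr_nat ler_nat.
    by have [xab|//] := boolP (x \in box a b); rewrite mem_set//; apply: box_cube; exact: set_mem xab.
  apply: monotone_class_box.
  - by move=> k a' b' _; apply: L1_continuous_bump; rewrite invr_gt0.
  - exact: L1_continuous_lin.
  - move=> f_ g C' Lf mf f_C f_g.
    have mg : measurable_fun setT g by apply: measurable_fun_cvg mf _ => x _; exact: f_g.
    have gC x : `|g x| <= C' * \1_(box a b) x.
      have cv : `|f_ m x| @[m --> \oo] --> `|g x| by apply: cvg_norm; exact: f_g.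
      rewrite -(cvg_lim _ cv)//; apply: limr_le; first by apply/cvg_ex; exists `|g x|.
      by apply: nearW => m.
    apply: L1_continuous_lim; first exact: boxi gC.
    have [|||||_ + _] := @dominated_convergence _ _ _ leb setT measurableT
      (fun m x => (f_ m x)%:E) (fun x => (g x)%:E) (fun x => (C' * \1_(box a b) x)%:E).
    + by move=> m; exact/measurable_EFinP.
    + exact/measurable_EFinP.
    + by apply: aeW => x _; apply: cvg_EFin; [exact: nearW|exact: f_g].
    + apply: (boxi _ `|C'|) => [|x].
        by apply: measurable_funM => //; apply: measurable_indic; exact: measurable_box.
      by rewrite normrM !indicE normr_nat.
    + by apply: aeW => x m _; rewrite lee_fin.
    + move=> /fine_cvgP[_ /cvgr0_norm_lt H] e e0.
      have [m _ /(_ m (leqnn _)) /= fm] := H e e0.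
      exists (f_ m) => //; rewrite L1distC.
      have fin : (L1dist (f_ m) g) \is a fin_num.
        rewrite /L1dist; apply: integrable_fin_num => //.
        rewrite (_ : (fun x => _) = EFin \o (fun x => `|f_ m x - g x|))//.
        apply: (boxi _ (C' + C')); first by apply: measurableT_comp => //; exact: measurable_funB.
        by move=> x; rewrite normr_id mulrDl (le_trans (ler_normB _ _))// lerD.
      rewrite -(fineK fin) lee_fin (le_trans (ler_norm _))// ltW//.
pose c (m : nat) : E := const_mx m%:R.
(* Truncation to a box and to values at most m in absolute value. *)
pose A (m : nat) : set mE := (box (- c m) (c m) : set mE) `&` [set x | `|w x| <= m%:R].
have mA m : measurable (A m).
  apply: measurableI; first exact: measurable_box.
  rewrite -[X in measurable X]setTI.
  have mnw : measurable_fun setT (fun x => `|w x|) by exact: measurableT_comp.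
  rewrite (_ : [set x | _] = (fun x => `|w x|) @^-1` `]-oo, m%:R]%classic).
    by apply: mnw => //; exact: measurable_itv.
  by apply/seteqP; split => x /=; rewrite in_itv.
pose f_ m x := w x * \1_(A m) x.
have mf m : measurable_fun setT (f_ m) by apply: measurable_funM => //; exact: measurable_indic.
have Lf m : L1_continuous (f_ m).
  apply: (bounded_case (- c m) (c m) _ m%:R) => // x.
  rewrite normrM !indicE normr_nat in_setI.
  have [xb/=|xb] := boolP (x \in box _ _); last by rewrite !mulr0.
  rewrite mulr1; have [xw|xw] := boolP (_ \in _); last by rewrite mulr0 ler0n.
  by rewrite mulr1; exact: set_mem xw.
apply: L1_continuous_lim => //.
have [|||||_ + _] := @dominated_convergence _ _ _ leb setT measurableT
  (fun m x => (f_ m x)%:E) (fun x => (w x)%:E) (fun x => `|(EFin \o w) x|)%E.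
- by move=> m; exact/measurable_EFinP.
- exact/measurable_EFinP.
- apply: aeW => x _; apply: cvg_EFin; first exact: nearW.
  apply: cvg_near_cst.
  exists (maxn (Num.bound `|w x|) (Num.bound `|x : E|)) => // m /=.
  rewrite geq_max => /andP[m1 m2]; rewrite /f_ indicE mem_set ?mulr1//; split.
    move=> i; rewrite !mxE -ltr_norml (le_lt_trans (cube_norm (x : E) i))//.
    by rewrite (lt_le_trans (archi_boundP _))// ler_nat.
  by rewrite /= ltW// (lt_le_trans (archi_boundP _))// ler_nat.
- exact: integrable_abse.
- apply: aeW => x m _; rewrite /= lee_fin normrM indicE normr_nat ler_piMr// lern1.
  by case: (_ \in _).
- move=> /fine_cvgP[_ /cvgr0_norm_lt H] e e0.
  have [m _ /(_ m (leqnn _)) /= fm] := H e e0.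
  exists (f_ m) => //; rewrite L1distC.
  have fin : (L1dist (f_ m) w) \is a fin_num.
    rewrite /L1dist; apply: integrable_fin_num => //.
    rewrite (_ : (fun x => _) = EFin \o (fun x => `|f_ m x - w x|))//.
    apply: integrable_norm; rewrite (_ : EFin \o _ = (fun x => (EFin \o f_ m) x - (EFin \o w) x)%E)//.
    by apply: integrableB => //; case: (Lf m).
  by rewrite -(fineK fin) lee_fin (le_trans (ler_norm _))// ltW//.
Qed.

End L1_translation.

(** * Increments of weakly differentiable functions on boxes *)

Section integrable_real.
Context d (T : measurableType d) (R : realType) (mu : {measure set T -> \bar R}) (D : set T).
Hypothesis mD : measurable D.
Implicit Types f g : T -> R.

Lemma integrable_realZ (c : R) f : mu.-integrable D (EFin \o f) ->
  mu.-integrable D (EFin \o (fun x => c * f x)).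
Proof. by move=> fi; exact: (integrableZl mD c fi). Qed.

Lemma integrable_realD f g : mu.-integrable D (EFin \o f) ->
  mu.-integrable D (EFin \o g) -> mu.-integrable D (EFin \o (fun x => f x + g x)).
Proof. by move=> fi gi; exact: (integrableD mD fi gi). Qed.

Lemma integrable_realB f g : mu.-integrable D (EFin \o f) ->
  mu.-integrable D (EFin \o g) -> mu.-integrable D (EFin \o (fun x => f x - g x)).
Proof. by move=> fi gi; exact: (integrableB mD fi gi). Qed.

Lemma integrable_real_measurable f : mu.-integrable D (EFin \o f) -> measurable_fun D f.
Proof. by move=> /integrableP[/measurable_EFinP]. Qed.

End integrable_real.

Lemma Rdominated_convergence d (T : measurableType d) (R : realType)
    (mu : {measure set T -> \bar R}) (D : set T) (f_ : nat -> T -> R) (f g : T -> R) :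
  measurable D -> (forall m, measurable_fun D (f_ m)) -> measurable_fun D f ->
  {ae mu, forall x, D x -> f_ ^~ x @ \oo --> f x} ->
  mu.-integrable D (EFin \o g) ->
  {ae mu, forall x m, D x -> `|f_ m x| <= g x} ->
  (\int[mu]_(x in D) f_ m x)%R @[m --> \oo] --> (\int[mu]_(x in D) f x)%R.
Proof.
move=> mD mf_ mf f_f gi f_g.
have [|||||fi _] := @dominated_convergence _ _ _ mu D mD
  (fun m x => (f_ m x)%:E) (fun x => (f x)%:E) (EFin \o g).
- by move=> m; exact/measurable_EFinP.
- exact/measurable_EFinP.
- apply: aeS f_f => x h Dx; apply: cvg_EFin; first exact: nearW.
  exact: h.
- exact: gi.
- by apply: aeS f_g => x h m Dx; rewrite /= lee_fin h.
rewrite -(fineK (integrable_fin_num mD fi)).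
exact: fine_cvg.
Qed.

Section derive_translation.
Context {R : realType} {V : normedModType R}.
Implicit Types (f : V -> R) (x y z v : V).

Lemma is_derive_along f y v (s d : R) : is_derive (y + s *: v) v f d ->
  is_derive s 1 (fun t : R => f (y + t *: v)) d.
Proof.
move=> [d1 d2].
have e : (fun h : R => h^-1 *: (f (h *: v + (y + s *: v)) - f (y + s *: v))) =
   (fun h : R => h^-1 *: (f (y + (h *: (1 : R^o) + s : R) *: v) - f (y + s *: v))).
  by apply/funext => h; rewrite scaler1 scalerDl addrCA.
apply: DeriveDef; first by move: d1; rewrite /derivable e.
by move: d2; rewrite /derive e.
Qed.

Lemma derive_translate f x z v : 'D_v (fun y => f (y - z)) x = 'D_v f (x - z).
Proof.
rewrite /derive; have -> // : (fun h : R => h^-1 *: (f (h *: v + x - z) - f (x - z))) =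
  (fun h : R => h^-1 *: (f (h *: v + (x - z)) - f (x - z))).
by apply/funext => h; rewrite addrA.
Qed.

End derive_translation.

Section test_functions.
Context {R : realType} {n : nat}.
Local Notation E := 'rV[R]_n.
Local Notation mE := (borel 'rV[R]_n).
Local Notation leb := (@lebesgue R n).
Local Notation e_ k := (delta_mx 0 k : E).
Implicit Types (U : set E) (phi : E -> R) (k : 'I_n).

Lemma test_function_continuous U phi : test_function U phi -> continuous phi.
Proof. by move=> [sm _ _] x; have [] := sm [::] x I. Qed.

Lemma test_function_is_derive U phi k x : test_function U phi ->
  is_derive x (e_ k) phi (partial k phi x).
Proof. by move=> [sm _ _]; have [_ d] := sm [::] x I; apply: DeriveDef. Qed.

Lemma test_function_partial_continuous U phi k : test_function U phi -> continuous (partial k phi).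
Proof. by move=> [sm _ _] x; have [] := sm [:: k] x I. Qed.

Lemma test_function_out phi (S : set E) x : closure [set x | phi x != 0] `<=` S -> ~ S x -> phi x = 0.
Proof.
move=> cS nS; apply: contrapT => /eqP px; apply: nS; apply: cS.
exact: subset_closure.
Qed.

Lemma test_function_partial_out phi k (S : set E) x :
  closure [set x | phi x != 0] `<=` S -> ~ S x -> partial k phi x = 0.
Proof.
move=> cS nS; rewrite /partial -[RHS](derive_cst (0 : R) x (e_ k)).
apply: near_eq_derive.
have : nbhs x (~` closure [set x | phi x != 0]).
  by apply: open_nbhs_nbhs; split; [exact/closed_openC/closed_closure|move=> /cS].
apply: filterS => y ny; apply: contrapT => /eqP py; apply: ny.
exact: subset_closure.
Qed.

Lemma compact_support_bounded (f : E -> R) (S : set E) : continuous f -> compact S ->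
  (forall x, ~ S x -> f x = 0) -> exists2 D, 0 <= D & forall x, `|f x| <= D.
Proof.
move=> cf cS f0.
have : compact (f @` S) by apply: continuous_compact => //; exact: continuous_subspaceT.
move=> /compact_bounded[M [_ MP]].
have MS x : S x -> `|f x| <= `|M| + 1.
  by move=> Sx; apply: MP; [rewrite ltr_pwDr// ler_norm|exists x].
exists (`|M| + 1); first by rewrite addr_ge0.
move=> x; have [/MS//|/f0 ->] := pselect (S x).
by rewrite normr0 addr_ge0.
Qed.

Lemma test_function_bounded U phi : test_function U phi ->
  exists2 D, 0 <= D & forall x, `|phi x| <= D.
Proof.
move=> T; have [_ cS _] := T; apply: compact_support_bounded cS _.
  exact: test_function_continuous T.
by move=> x; exact: test_function_out.
Qed.

Lemma test_function_partial_bounded U phi k : test_function U phi ->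
  exists2 D, 0 <= D & forall x, `|partial k phi x| <= D.
Proof.
move=> T; have [_ cS _] := T; apply: compact_support_bounded cS _.
  exact: test_function_partial_continuous T.
by move=> x; exact: test_function_partial_out.
Qed.

Lemma test_function_increment U phi k (D : R) x (t : R) : test_function U phi ->
  (forall x, `|partial k phi x| <= D) -> 0 <= t ->
  `|phi (x + t *: e_ k) - phi x| <= D * t.
Proof.
move=> T HD t0.
have der s : is_derive s (1 : R) (fun s : R => phi (x + s *: e_ k)) (partial k phi (x + s *: e_ k)).
  by apply: is_derive_along; exact: test_function_is_derive T.
have [|c _] := @MVT_segment R (fun s => phi (x + s *: e_ k))
    (fun s => partial k phi (x + s *: e_ k)) 0 t t0 (fun s _ => der s).
  apply: continuous_subspaceT => s; apply: differentiable_continuous.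
  by apply/derivable1_diffP; case: (der s).
rewrite scale0r addr0 subr0 => ->.
by rewrite normrM (ger0_norm t0) ler_wpM2r.
Qed.

End test_functions.

(** Keeps the supports of the translated bumps within the larger box on which u and w
    are integrable. *)
Lemma closed_box_translate (R : realType) (n : nat) (a b a' b' : 'rV[R]_n) (k : 'I_n)
    (s delta : R) : (forall i, a 0 i <= a' 0 i /\ b' 0 i <= b 0 i) -> `|s| < delta ->
  closed_box (a' + s *: delta_mx 0 k) (b' + s *: delta_mx 0 k) `<=`
  closed_box (a - const_mx delta) (b + const_mx delta).
Proof.
move=> ab sd y yab i; have := yab i; rewrite !mxE eqxx/=.
have [? ?] := ab i; move: sd; rewrite ltr_norml => /andP[? ?].
by case: (i == k) => /= /andP[? ?]; apply/andP; split; lra.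
Qed.

(* The functions u and w are only locally integrable on U. They are cut off to a
   closed box Q that exceeds the box (a, b) by delta on every side, so that
   translations by less than delta do not see the cut. *)
Section weak_increments.
Context {R : realType} {n : nat}.
Local Notation E := 'rV[R]_n.
Local Notation mE := (borel 'rV[R]_n).
Local Notation leb := (@lebesgue R n).
Variables (U : set E) (k : 'I_n) (u w : E -> R) (a b : E) (delta : R).
Hypotheses (oU : open U) (uw : is_weak_partial U k u w) (delta0 : 0 < delta).
Local Notation v := (delta_mx 0 k : E).
Let Q : set mE := closed_box (a - const_mx delta) (b + const_mx delta).
Hypothesis QU : Q `<=` U.
Let u' : mE -> R := (u : mE -> R) \_ Q.
Let w' : mE -> R := (w : mE -> R) \_ Q.

Let u'i : leb.-integrable setT (EFin \o u').
Proof. by case: uw => Lu _ _; apply: Lp_loc1_integrable Lu _ QU => //; exact: compact_closed_box. Qed.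

Let w'i : leb.-integrable setT (EFin \o w').
Proof. by case: uw => _ Lw _; apply: Lp_loc1_integrable Lw _ QU => //; exact: compact_closed_box. Qed.

Let mint (f : mE -> R) : leb.-integrable setT (EFin \o f) -> measurable_fun setT f.
Proof. by move=> /integrableP[/measurable_EFinP]. Qed.

(** Keeping the function f fixed and moving g turns questions on translates of g into
    questions on a function of one real variable. *)
Definition pairing (g f : mE -> R) (s : R) : R := (\int[leb]_x (translate v s g x * f x))%R.

Lemma pairing_integrable (g f : mE -> R) (C s : R) : leb.-integrable setT (EFin \o g) ->
  measurable_fun setT f -> (forall x, `|f x| <= C) ->
  leb.-integrable setT (EFin \o (fun x => translate v s g x * f x)).
Proof.
by move=> gi mf fC; apply: integrable_mul_bounded fC => //; exact: integrable_translate.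
Qed.

Lemma pairing_continuous (g f : mE -> R) (C : R) : leb.-integrable setT (EFin \o g) ->
  measurable_fun setT f -> (forall x, `|f x| <= C) -> continuous (pairing g f).
Proof.
move=> gi mf fC s; apply/cvgrPdist_le => e e0.
have C0 : 0 <= C by exact: le_trans (normr_ge0 _) (fC 0).
have C1 : 0 < C + 1 by rewrite ltr_wpDl.
have [_ /(_ (e / (C + 1)))] := L1_translation_continuous v gi.
rewrite divr_gt0// => /(_ isT) H.
near=> t.
have -> : pairing g f s - pairing g f t = - pairing (fun x => translate v (t - s) g x - g x) f s.
  rewrite /pairing -RintegralB//; [|exact: pairing_integrable fC..].
  rewrite -mulN1r -RintegralZl//; last first.
    apply: (@integrable_mul_bounded _ _ _ _ C) => //.
    rewrite (_ : EFin \o _ = (fun x => (EFin \o translate v t g) x - (EFin \o translate v s g) x))%E.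
      by apply: integrableB => //; exact: integrable_translate.
    apply/funext => x /=; rewrite /translate -EFinD; congr (_ - _)%:E.
    by rewrite -addrA -scalerDl (addrC s) subrK.
  apply: eq_Rintegral => x _; rewrite /translate -addrA -scalerDl.
  by rewrite (addrC s) subrK; ring.
rewrite normrN.
have di : leb.-integrable setT (EFin \o (fun x => translate v (t - s) g x - g x)).
  rewrite (_ : EFin \o _ = (fun x => (EFin \o translate v (t - s) g) x - (EFin \o g) x))%E//.
  by apply: integrableB => //; exact: integrable_translate.
apply: le_trans (le_normr_Rintegral measurableT (pairing_integrable s di mf fC)) _.
have Ht : (L1dist (translate v (t - s) g) g <= (e / (C + 1))%:E)%E.
  near: t.
  have ts : t - s @[t --> s] --> (0 : R).
    by rewrite -[X in _ --> X](subrr s); apply: cvgB; [exact: cvg_id|exact: cvg_cst].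
  exact: (ts _ H).
have fin : (L1dist (translate v (t - s) g) g) \is a fin_num.
  by apply: integrable_fin_num => //; exact: (integrable_norm di).
have mg := mint gi.
have md := mint di.
apply: (@le_trans _ _ (\int[leb]_x (C * `|translate v s (fun x => translate v (t - s) g x - g x) x|))%R).
  apply: le_Rintegral => //.
  - by apply: integrable_norm => //; exact: pairing_integrable fC.
  - by apply: integrable_realZ => //; apply: integrable_norm; exact: integrable_translate.
  - by move=> x _; rewrite normrM mulrC ler_wpM2r.
rewrite RintegralZl//; last by apply: integrable_norm; exact: integrable_translate.
have -> : (\int[leb]_x `|translate v s (fun x => translate v (t - s) g x - g x) x|)%R =
    fine (L1dist (translate v (t - s) g) g).
  congr fine; apply: (@ge0_integral_shift _ _ (s *: v) (fun x => `|translate v (t - s) g x - g x|%:E)) => //.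
  by apply/measurable_EFinP; exact: measurableT_comp.
apply: (@le_trans _ _ (C * (e / (C + 1)))).
  by rewrite ler_wpM2l// -lee_fin fineK.
by rewrite mulrA ler_pdivrMr// mulrC ler_wpM2l ?ltW// ltrDl.
Unshelve. all: by end_near. Qed.

Lemma bump_shift c (a' b' z y : E) : 0 < c ->
  bump c (a' + z) (b' + z) y = bump c a' b' (y - z).
Proof.
move=> c0; rewrite !bumpE//.
have -> : `[< box (a' + z) (b' + z) y >] = `[< box a' b' (y - z) >].
  apply: asbool_equiv_eq; split => yab i; have := yab i;
    by rewrite !mxE ltrBrDr ltrBlDr.
case: ifP => // _; apply: eq_bigr => i _; rewrite !mxE.
have -> : y 0 i - (a' 0 i + z 0 i) = y 0 i - z 0 i - a' 0 i by ring.
by have -> : b' 0 i + z 0 i - y 0 i = b' 0 i - (y 0 i - z 0 i) by ring.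
Qed.

(** Translating the bump instead of u', the integral can be differentiated under the
    integral sign; the definition of the weak derivative, applied to the translated
    bump, moves the derivative over to u. *)
Let bump_derivative c (a' b' : E) (s : R) :
  0 < c -> (forall i, a 0 i <= a' 0 i /\ b' 0 i <= b 0 i) -> `|s| < delta ->
  is_derive s (1 : R) (pairing u' (bump c a' b')) (pairing w' (bump c a' b') s).
Proof.
move=> c0 ab sd; pose phi := bump c a' b'.
have Tphi : test_function (closed_box a' b') phi by apply: test_function_bump.
have mphi : measurable_fun setT (phi : mE -> R) by exact: measurable_bump.
have [D D0 HD] := test_function_partial_bounded k Tphi.
have [C C0 HC] := test_function_bounded Tphi.
have mphis t : measurable_fun setT (fun y : mE => phi ((y : E) - t *: v)).
  exact: (measurableT_comp mphi (measurable_translation (- (t *: v)))).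
have shiftE (g : mE -> R) t : leb.-integrable setT (EFin \o g) ->
    pairing g phi t = (\int[leb]_y (g y * phi ((y : E) - t *: v)))%R.
  move=> gi; rewrite /pairing /Rintegral; congr (fine _).
  rewrite -[RHS](@integral_shift _ _ (t *: v) (fun y => (g y * phi ((y : E) - t *: v))%:E)).
    by apply: eq_integral => x _; rewrite addrK.
  exact: (integrable_mul_bounded gi (mphis t) (fun y => HC _)).
have -> : pairing u' phi = (fun t => (\int[leb]_y (u' y * phi ((y : E) - t *: v)))%R).
  by apply/funext => t; exact: shiftE.
have dphi y t : is_derive t (1 : R) (fun t : R => phi (y - t *: v)) (- partial k phi (y - t *: v)).
  have e : (fun t : R => phi (y - t *: v)) = (fun t : R => phi (y + t *: v)) \o -%R.
    by apply/funext => r /=; rewrite scaleNr.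
  rewrite e.
  have d1 : is_derive (- t) (1 : R) (fun t : R => phi (y + t *: v)) (partial k phi (y - t *: v)).
    apply: is_derive_along; rewrite scaleNr; exact: test_function_is_derive Tphi.
  have d2 : is_derive t (1 : R) (-%R : R -> R) (-1) by exact: is_deriveNid.
  have := is_derive1_comp d1 d2; by move/is_derive_eq; apply; rewrite mulrN1.
pose f t y := u' y * phi ((y : E) - t *: v).
have df y t : is_derive t (1 : R) (f^~ y) (u' y * - partial k phi ((y : E) - t *: v)).
  have := is_deriveZ (u' y) (dphi y t); by [].
have d1f t y : partial1of2 f t y = u' y * - partial k phi ((y : E) - t *: v).
  by rewrite /partial1of2 derive1E; exact: (@derive_val _ _ _ _ _ _ _ (df y t)).
have hyp : [/\ setT s, forall t, `](s - 1), (s + 1)[%classic t -> leb.-integrable setT (EFin \o f t),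
   forall t y, `](s - 1), (s + 1)[%classic t -> setT y -> derivable (f^~ y) t 1 &
   forall t y, `](s - 1), (s + 1)[%classic t -> setT y -> `|partial1of2 f t y| <= D * `|u' y|].
  split => //.
  - by move=> t _; exact: (integrable_mul_bounded u'i (mphis t) (fun y => HC _)).
  - by move=> t y _ _; rewrite d1f normrM normrN mulrC ler_wpM2r.
have [_ h1 h2 h3] := hyp.
have Is : `](s - 1), (s + 1)[%classic s by rewrite /= in_itv/= gtrBl ltr01 ltrDl ltr01.
have G0 y : 0 <= D * `|u' y| by rewrite mulr_ge0.
have Gi : leb.-integrable setT (EFin \o (fun y => D * `|u' y|)).
  by apply: integrable_realZ => //; exact: integrable_norm.
have Fd := @derivable_under_integral R _ mE leb f setT measurableT s (s - 1) (s + 1) Is h1 h2 _ G0 Gi h3.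
have Fd' := @differentiation_under_integral R _ mE leb f setT measurableT s (s - 1) (s + 1) Is h1 h2 _ G0 Gi h3.
apply: DeriveDef; first exact: Fd.
rewrite -derive1E [LHS]Fd' shiftE//.
pose phis := bump c (a' + s *: v) (b' + s *: v).
have phisE y : phis y = phi (y - s *: v) by exact: bump_shift.
have sub : closed_box (a' + s *: v) (b' + s *: v) `<=` Q by exact: closed_box_translate.
have Tphis : test_function Q phis by exact: test_function_bump.
have [_ _ sQ] := Tphis.
have [_ _ /(_ phis (test_function_bump c0 (subset_trans sub QU)))] := uw.
rewrite /= => H.
have -> : (\int[leb]_y partial1of2 f^~ y s)%R = fine (- \int[leb]_(x in U) (u x * partial k phis x)%:E).
  have HE : (\int[leb]_(x in U) (u x * partial k phis x)%:E)%E =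
      (\int[leb]_x (u' x * partial k phi ((x : E) - s *: v))%:E)%E.
    rewrite integral_mkcond; apply: eq_integral => x _; rewrite /u' !patchE.
    have pE : partial k phis x = partial k phi ((x : E) - s *: v).
      rewrite /partial -derive_translate; congr ('D_v _ x).
      by apply/funext => y; exact: phisE.
    have [xQ|xQ] := boolP (x \in Q).
      by rewrite mem_set ?pE//; apply: QU; exact: set_mem xQ.
    rewrite -pE (test_function_partial_out k sQ) ?mulr0 ?if_same//.
    by move/mem_set; rewrite (negbTE xQ).
  have mdphi : measurable_fun setT (fun y : mE => partial k phi ((y : E) - s *: v)).
    apply: (@measurableT_comp _ _ _ _ _ _ (partial k phi : mE -> R) _ (fun y : mE => ((y : E) - s *: v) : mE)).
      apply: continuous_measurable_borel => [|z _]; first exact: openT.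
      exact: test_function_partial_continuous Tphi z.
    exact: (measurable_translation (- (s *: v))).
  rewrite HE fineN -mulN1r -[RHS](RintegralZl _ measurableT); last first.
    exact: (integrable_mul_bounded u'i mdphi (fun y => HD _)).
  by apply: eq_Rintegral => y _; rewrite d1f mulN1r mulrN.
rewrite H oppeK.
have -> : (\int[leb]_(x in U) (w x * phis x)%:E)%E =
    (\int[leb]_x (w' x * phi ((x : E) - s *: v))%:E)%E.
  rewrite integral_mkcond; apply: eq_integral => x _.
  rewrite /w' !patchE; have [xQ|xQ] := boolP (x \in Q).
    by rewrite mem_set ?phisE//; apply: QU; exact: set_mem xQ.
  rewrite -phisE (test_function_out sQ) ?mulr0 ?if_same//.
  by move/mem_set; rewrite (negbTE xQ).
by [].
Qed.

Lemma pairing_diff_bound (g g' f : mE -> R) (C s s' : R) :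
  leb.-integrable setT (EFin \o g) -> leb.-integrable setT (EFin \o g') ->
  measurable_fun setT f -> (forall x, `|f x| <= C) ->
  `|pairing g f s - pairing g' f s'| <= C * fine (L1dist (translate v s g) (translate v s' g')).
Proof.
move=> gi gi' mf fC.
have di : leb.-integrable setT (EFin \o (fun x => translate v s g x - translate v s' g' x)).
  by apply: integrable_realB => //; exact: integrable_translate.
have dfi := integrable_mul_bounded di mf fC.
rewrite /pairing -RintegralB//; [|exact: pairing_integrable fC..].
rewrite (_ : Rintegral _ _ _ = (\int[leb]_x ((translate v s g x - translate v s' g' x) * f x))%R); last first.
  by apply: eq_Rintegral => x _; rewrite mulrBl.
apply: le_trans (le_normr_Rintegral measurableT dfi) _.
rewrite -[leRHS]RintegralZl//; last exact: integrable_norm.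
apply: le_Rintegral => //.
- exact: integrable_norm.
- by apply: integrable_realZ => //; exact: integrable_norm.
- by move=> x _; rewrite normrM mulrC ler_wpM2r.
Qed.

Lemma pairing_bound (g f : mE -> R) (C s : R) :
  leb.-integrable setT (EFin \o g) -> measurable_fun setT f -> (forall x, `|f x| <= C) ->
  `|pairing g f s| <= C * fine (L1dist g (cst 0)).
Proof.
move=> gi mf fC.
have zi : leb.-integrable setT (EFin \o (cst 0 : mE -> R)) by exact: integrable0.
have := pairing_diff_bound s s gi zi mf fC.
rewrite L1dist_translate//; last exact: mint.
rewrite (_ : pairing (cst 0) f s = 0) ?subr0//.
rewrite /pairing (@eq_Rintegral _ _ _ _ _ (fun=> 0)) ?Rintegral_cst ?mul0r// => x _.
by rewrite /translate/= mul0r.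
Qed.

Let bounded_box (f : mE -> R) C : (forall x, `|f x| <= C * \1_(box a b) x) ->
  forall x, `|f x| <= `|C|.
Proof.
move=> fC x; rewrite (le_trans (fC x))// (le_trans (ler_norm _))// normrM indicE.
by rewrite normr_nat ler_piMr// lern1; case: (_ \in _).
Qed.

Let pairing_itv_integrable (f : mE -> R) C (t : R) : measurable_fun setT f ->
  (forall x, `|f x| <= C) ->
  (@lebesgue_measure R).-integrable `[0, t]%classic (EFin \o pairing w' f).
Proof.
move=> mf fC; apply: continuous_compact_integrable; first exact: segment_compact.
by apply: continuous_subspaceT => s; exact: (pairing_continuous w'i mf fC).
Qed.

(** For bumps this is the fundamental theorem of calculus. Both sides are linear in f
    and continuous under dominated convergence, hence the monotone class argument.
    Stating it with the pairing inside the integral over s avoids exchanging the two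
    integrals. *)
Lemma pairing_increment (f : mE -> R) (C t : R) : 0 < t < delta -> measurable_fun setT f ->
  (forall x, `|f x| <= C * \1_(box a b) x) ->
  pairing u' f t - pairing u' f 0 = (\int[@lebesgue_measure R]_(s in `[0, t]) pairing w' f s)%R.
Proof.
move=> /andP[t0 td] mf fC.
pose L (f : mE -> R) := [/\ measurable_fun setT f, exists C, forall x, `|f x| <= C &
  pairing u' f t - pairing u' f 0 = (\int[@lebesgue_measure R]_(s in `[0, t]) pairing w' f s)%R].
suff : L f by case.
apply: (@monotone_class_box R n a b L _ _ _ f C mf fC).
- move=> m a' b' ab; have c0 : 0 < m.+1%:R^-1 :> R by rewrite invr_gt0.
  have mb := measurable_bump a' b' c0.
  have [B B0 HB] := test_function_bounded (test_function_bump c0 (@subset_refl _ (closed_box a' b'))).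
  split => //; first by exists B.
  have cu := pairing_continuous u'i mb HB; have cw := pairing_continuous w'i mb HB.
  have dt s : s \in `]0, t[ -> is_derive s (1 : R) (pairing u' (bump m.+1%:R^-1 a' b')) (pairing w' (bump m.+1%:R^-1 a' b') s).
    rewrite in_itv/= => /andP[s0 st]; apply: bump_derivative => //.
    by rewrite gtr0_norm// (lt_trans st).
  have := @continuous_FTC2 _ (pairing w' (bump m.+1%:R^-1 a' b')) (pairing u' (bump m.+1%:R^-1 a' b')) 0 t t0.
  rewrite /Rintegral => ->//.
  + by apply: continuous_subspaceT => s; exact: cw.
  + split.
    * by move=> s /dt[].
    * by apply: cvg_at_right_filter; exact: cu.
    * by apply: cvg_at_left_filter; exact: cu.
  + by move=> s /dt ds; rewrite derive1E; exact: (@derive_val _ _ _ _ _ _ _ ds).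
- move=> c f1 f2 [m1 [C1 b1] i1] [m2 [C2 b2] i2].
  have lin g s : leb.-integrable setT (EFin \o g) ->
      pairing g (fun x => c * f1 x + f2 x) s = c * pairing g f1 s + pairing g f2 s.
    move=> gi; rewrite /pairing -RintegralZl//; last exact: pairing_integrable b1.
    rewrite -RintegralD//.
    + by apply: eq_Rintegral => x _; ring.
    + by apply: integrable_realZ => //; exact: pairing_integrable b1.
    + exact: pairing_integrable b2.
  split.
  + by apply: measurable_funD => //; exact: measurable_funM.
  + exists (`|c| * C1 + C2) => x; rewrite (le_trans (ler_normD _ _))// lerD//.
    by rewrite normrM ler_wpM2l.
  + have -> : (\int[@lebesgue_measure R]_(s in `[0, t]) pairing w' (fun x => (c * f1 x + f2 x)%R) s)%R =
        (\int[@lebesgue_measure R]_(s in `[0, t]) (c * pairing w' f1 s + pairing w' f2 s))%R.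
      by apply: eq_Rintegral => s _; rewrite lin.
    rewrite !lin//.
    rewrite RintegralD//; last exact: pairing_itv_integrable b2.
      rewrite RintegralZl//; last exact: pairing_itv_integrable b1.
      by rewrite -i1 -i2; ring.
    by apply: integrable_realZ => //; exact: pairing_itv_integrable b1.
- move=> f_ g C' Lf mf_ f_C f_g.
  have mg : measurable_fun setT g by apply: measurable_fun_cvg mf_ _ => x _; exact: f_g.
  have fb m x : `|f_ m x| <= `|C'| by exact: bounded_box (f_C m) x.
  have gb x : `|g x| <= `|C'|.
    have cv : `|f_ m x| @[m --> \oo] --> `|g x| by apply: cvg_norm; exact: f_g.
    rewrite -(cvg_lim _ cv)//; apply: limr_le; first by apply/cvg_ex; exists `|g x|.
    exact: nearW.
  split => //; first by exists `|C'|.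
  have pc h s : leb.-integrable setT (EFin \o h) ->
      pairing h (f_ m) s @[m --> \oo] --> pairing h g s.
    move=> hi; have hti := integrable_translate v s hi; have mh := mint hti.
    apply: (@Rdominated_convergence _ _ _ _ _ _ _ (fun x => `|C'| * `|translate v s h x|)) => //.
    + by move=> m; exact: measurable_funM.
    + exact: measurable_funM.
    + by apply: aeW => x _; apply: cvgMl_tmp; exact: f_g.
    + by apply: integrable_realZ => //; exact: integrable_norm.
    + by apply: aeW => x m _; rewrite normrM mulrC ler_wpM2r.
  have lim1 : pairing u' (f_ m) t - pairing u' (f_ m) 0 @[m --> \oo] --> pairing u' g t - pairing u' g 0.
    by apply: cvgB; exact: pc.
  have uE : (fun m => pairing u' (f_ m) t - pairing u' (f_ m) 0) =
      (fun m => (\int[@lebesgue_measure R]_(s in `[0, t]) pairing w' (f_ m) s)%R).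
    by apply/funext => m; have [_ _ ->] := Lf m.
  rewrite uE in lim1; apply: (cvg_unique (@norm_hausdorff _ R) lim1).
  apply: (@Rdominated_convergence _ _ _ _ _ _ _ (fun x => `|C'| * fine (L1dist w' (cst 0)))) => //.
  + by move=> m; apply: integrable_real_measurable; exact: pairing_itv_integrable (fb m).
  + by apply: integrable_real_measurable; exact: pairing_itv_integrable gb.
  + by apply: aeW => s _; exact: pc.
  + apply: continuous_compact_integrable; first exact: segment_compact.
    by apply: continuous_subspaceT => s; exact: cvg_cst.
  + by apply: aeW => s m _; exact: pairing_bound.
Qed.

(** The L^1 norm of the error d is its integral against the sign f of d on the box.
    Since f is bounded, that integral equals the integral over s in [0, t] of
    pairing w' f s - pairing w' f 0, which is at most t times the supremum of the L^1
    distances of w' to its translates by s e_k, small by continuity of translations. *)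
Lemma increment_L1_box (e : R) : 0 < e -> exists2 eta : R, 0 < eta < delta & forall t, 0 < t < eta ->
  (\int[leb]_(x in box a b) `|translate v t u' x - u' x - t * w' x|%:E <= (e * t)%:E)%E.
Proof.
move=> e0; have [_ /(_ e e0)/nbhs_ballP[r /= r0 Hr]] := L1_translation_continuous v w'i.
exists (Num.min r delta / 2).
  by rewrite divr_gt0 ?lt_min ?r0//= ltr_pdivrMr// gt_min; apply/orP; right; rewrite ltr_pMr// ltr1n.
move=> t /andP[t0 tr].
have [tr' td] : t < r /\ t < delta.
  move: tr; rewrite ltr_pdivlMr// lt_min => /andP[? ?]; split; lra.
have mw := mint w'i; have mu := mint u'i.
pose d x := translate v t u' x - u' x - t * w' x.
have di : leb.-integrable setT (EFin \o d).
  apply: integrable_realB => //; last exact: integrable_realZ.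
  by apply: integrable_realB => //; exact: integrable_translate.
have md := mint di.
pose B : set mE := box a b; have mB : measurable B by exact: measurable_box.
pose P : set mE := [set x | 0 <= d x].
have mP : measurable P.
  rewrite -[X in measurable X]setTI (_ : P = d @^-1` `[0, +oo[%classic).
    by apply: md => //; exact: measurable_itv.
  by apply/seteqP; split => x; rewrite /P/= in_itv/= andbT.
(* The sign of d on the box, 0 elsewhere. *)
pose f x : R := \1_(B `&` P) x - \1_(B `\` P) x.
have mf : measurable_fun setT f.
  by apply: measurable_funB; apply: measurable_indic; [exact: measurableI|exact: measurableD].
have fE x : f x = \1_B x * (if 0 <= d x then 1 else -1).
  have [xB|xB] := pselect (B x); last first.
    rewrite /f !indicE (memNset xB) (memNset (_ : ~ (B `&` P) x)); last by case.
    by rewrite memNset ?subr0 ?mul0r//; case.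
  rewrite /f !indicE (mem_set xB) mul1r; case: ifPn => dx.
    by rewrite mem_set// memNset ?subr0//; case.
  by rewrite memNset ?mem_set ?sub0r//; [split => //; exact/negP|case=> _; exact/negP].
have f1 x : `|f x| <= 1 * \1_(box a b) x.
  by rewrite fE normrM indicE normr_nat; case: ifP; rewrite ?normrN normr1 mulr1 mul1r.
have f1' x : `|f x| <= 1 by have := bounded_box f1 x; rewrite normr1.
have E1 : (\int[leb]_(x in box a b) `|d x|%:E)%E = (\int[leb]_x (d x * f x)%:E)%E.
  rewrite integral_mkcond; apply: eq_integral => x _; rewrite patchE fE indicE.
  case: (x \in B); last by rewrite mul0r mulr0.
  rewrite mul1r; case: ifPn => dx; first by rewrite ger0_norm ?mulr1.
  by rewrite ltr0_norm ?mulrN1// ltNge.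
rewrite [leLHS]E1 -(fineK (integrable_fin_num measurableT (integrable_mul_bounded di mf f1'))) lee_fin.
have tr0 (g : mE -> R) : translate v 0 g = g.
  by apply/funext => x; rewrite /translate scale0r addr0.
have -> : fine (\int[leb]_x (d x * f x)%:E) =
    pairing u' f t - pairing u' f 0 - t * pairing w' f 0.
  rewrite /pairing !tr0 -RintegralB//; last 2 first.
  - exact: pairing_integrable f1'.
  - exact: integrable_mul_bounded f1'.
  rewrite -RintegralZl//; last exact: integrable_mul_bounded f1'.
  rewrite -RintegralB//; last 2 first.
  - apply: integrable_realB => //; first exact: pairing_integrable f1'.
    exact: integrable_mul_bounded f1'.
  - by apply: integrable_realZ => //; exact: integrable_mul_bounded f1'.
  by apply: eq_Rintegral => x _; rewrite /d; ring.
rewrite (pairing_increment _ mf f1); last by rewrite t0 td.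
have mt : fine (@lebesgue_measure R `[0, t]%classic) = t.
  by rewrite lebesgue_measure_itv/= lte_fin t0 oppr0 adde0.
have tc c : t * c = (\int[@lebesgue_measure R]_(s in `[0, t]) c)%R.
  by rewrite Rintegral_cst// mt mulrC.
have ci c : (@lebesgue_measure R).-integrable `[0, t]%classic (EFin \o (fun=> c : R)).
  apply: continuous_compact_integrable; first exact: segment_compact.
  by apply: continuous_subspaceT => s; exact: cvg_cst.
rewrite tc -RintegralB//; last exact: pairing_itv_integrable f1'.
rewrite (mulrC e) tc; apply: le_Rintegral => //.
  by apply: integrable_realB => //; exact: pairing_itv_integrable f1'.
move=> s /=; rewrite in_itv/= => /andP[s0 st].
rewrite (le_trans (ler_norm _))// (le_trans (pairing_diff_bound s 0 w'i w'i mf f1'))// mul1r tr0.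
have fin : L1dist (translate v s w') w' \is a fin_num.
  apply: integrable_fin_num => //; apply: integrable_norm.
  by apply: integrable_realB => //; exact: integrable_translate.
rewrite -lee_fin fineK//; apply: Hr; rewrite /ball/= sub0r normrN ger0_norm//.
exact: le_lt_trans st tr'.
Qed.

End weak_increments.

(** * Increments on compact sets *)

(** Compactness as an induction principle: a property of sets that holds locally and
    is stable under subsets and finite unions holds for compact sets. *)
Lemma compact_ind (T : topologicalType) (S : set T) (P : set T -> Prop) : compact S ->
  P set0 -> (forall A B, P A -> P B -> P (A `|` B)) ->
  (forall A B, A `<=` B -> P B -> P A) ->
  (forall x, S x -> exists2 V, nbhs x V & P V) -> P S.
Proof.
move=> cS P0 PU Psub Ploc; apply: contrapT => nPS.
pose F : set_system T := [set A | P (S `\` A)].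
have FF : ProperFilter F.
  apply: Build_ProperFilter_ex.
    move=> A FA; apply: contrapT => nA; apply: nPS.
    apply: Psub FA => x Sx; split => // Ax; apply: nA; by exists x.
  split.
  - by rewrite /F/= setDT.
  - by move=> A B FA FB; rewrite /F/= setDIr; exact: PU.
  - by move=> A B AB; apply: Psub => x [Sx nB]; split => // /AB.
have FS : F S by rewrite /F/= setDv.
have [x [Sx cx]] := cS F FF FS.
have [V Vx PV] := Ploc x Sx.
have FV : F (~` V) by apply: Psub PV => y [_ /contrapT].
by have [y []] := cx _ _ FV Vx.
Qed.

Section increments.
Context {R : realType} {n : nat}.
Local Notation E := 'rV[R]_n.
Local Notation mE := (borel 'rV[R]_n).
Local Notation leb := (@lebesgue R n).
Variables (U : set E) (k : 'I_n).
Hypothesis oU : open U.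
Local Notation v := (delta_mx 0 k : E).

Lemma lebesgue_compact_lty (S : set E) : compact S -> (leb S < +oo)%E.
Proof.
move=> cS; have mS : measurable (S : set mE) by exact: compact_measurable.
have [M [_ MP]] := compact_bounded cS.
have sub : S `<=` cube (`|M| + 1).
  move=> x Sx i; apply: le_trans (cube_norm x i) _; apply: MP => //.
  by rewrite ltr_pwDr// ler_norm.
apply: le_lt_trans (lebesgue_cube_lty (`|M| + 1)).
by apply: le_measure => //; rewrite inE//; exact: measurable_cube.
Qed.

Lemma enlarged_box (x : E) : U x -> exists a b : E, exists2 delta : R, 0 < delta &
  [/\ nbhs x (box a b), box a b x & closed_box (a - const_mx delta) (b + const_mx delta) `<=` U].
Proof.
move=> Ux.
have /nbhs_ballP[e /= e0 eU] : nbhs x U by exact: open_nbhs_nbhs.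
pose d := e / 4; have d0 : 0 < d by rewrite divr_gt0.
exists (x - const_mx d), (x + const_mx d), d => //; split.
- apply/nbhs_ballP; exists d => //= y [_ xy] i; have := xy 0 i.
  by rewrite /ball/= !mxE ltr_norml => /andP[? ?]; apply/andP; split; lra.
- by move=> i; rewrite !mxE; apply/andP; split; lra.
move=> y yb; apply: eU; split => // i j; rewrite (ord1 i).
have := yb j; rewrite !mxE /ball/= ltr_norml => /andP[? ?].
have de : d * 4 = e by rewrite /d; field.
by apply/andP; split; lra.
Qed.

Lemma box_translate (a b x : E) (delta t : R) : box a b x -> `|t| <= delta ->
  closed_box (a - const_mx delta) (b + const_mx delta) (x + t *: v).
Proof.
move=> xab tde i; have /andP[? ?] := xab i; rewrite !mxE eqxx/=.
have : `|t * (i == k)%:R| <= delta.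
  by case: (i == k); rewrite ?mulr1 ?mulr0 ?normr0// (le_trans _ tde).
by rewrite ler_norml => /andP[? ?]; apply/andP; split; lra.
Qed.

(** Extending by zero makes the increments of a function defined on U total. *)
Definition zero_ext (g : E -> R) : mE -> R := g \_ U.

Lemma zero_extE (g : E -> R) x : U x -> zero_ext g x = g x.
Proof. by move=> Ux; rewrite /zero_ext patchE mem_set. Qed.

Lemma measurable_zero_ext (g : E -> R) : measurable_fun (U : set mE) (g : mE -> R) ->
  measurable_fun setT (zero_ext g).
Proof.
by move=> mg; exact: ((measurable_restrictT (g : mE -> R) (open_measurable_borel oU)).1 mg).
Qed.

Definition increment_error (g z : E -> R) (t : R) : mE -> R := fun x =>
  translate v t (zero_ext g) x - zero_ext g x - t * zero_ext z x.

(** The expansion g(x + t e_k) = g(x) + t z(x) + o(t) in L^1(S) as t tends to 0 from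
    above. It holds for C^1 functions as well as for weakly differentiable ones and is
    stable under sums, so it applies to g = h + e without discussing whether the
    smooth metric h is weakly differentiable. *)
Definition L1_increment (S : set mE) (g z : E -> R) : Prop :=
  forall e : R, 0 < e -> exists2 eta : R, 0 < eta & forall t, 0 < t < eta ->
  (\int[leb]_(x in S) `|increment_error g z t x|%:E <= (e * t)%:E)%E.

Section fixed_function.
Variables g z : E -> R.
Hypotheses (mg : measurable_fun (U : set mE) (g : mE -> R))
  (mz : measurable_fun (U : set mE) (z : mE -> R)).

Lemma measurable_increment_error (t : R) : measurable_fun setT (increment_error g z t).
Proof.
have mg' := measurable_zero_ext mg; have mz' := measurable_zero_ext mz.
apply: measurable_funB; last exact: measurable_funM.
by apply: measurable_funB => //; exact: (measurableT_comp mg' (measurable_translation (t *: v))).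
Qed.

Let mnorm (S : set mE) t : measurable S ->
  measurable_fun S (fun x => `|increment_error g z t x|%:E).
Proof.
move=> mS; apply/measurable_EFinP/measurable_funTS; apply: measurableT_comp => //.
exact: measurable_increment_error.
Qed.

Lemma L1_increment_sub (S S' : set mE) :
  measurable S -> measurable S' -> S `<=` S' ->
  L1_increment S' g z -> L1_increment S g z.
Proof.
move=> mS mS' SS' H e e0; have [eta eta0 Heta] := H e e0.
exists eta => // t /Heta; apply: le_trans; apply: ge0_subset_integral => //.
exact: mnorm.
Qed.

Lemma L1_increment_setU (S S' : set mE) : measurable S -> measurable S' ->
  L1_increment S g z -> L1_increment S' g z -> L1_increment (S `|` S') g z.
Proof.
move=> mS mS' H H' e e0; have e2 : 0 < e / 2 by rewrite divr_gt0.
have [eta eta0 Heta] := H _ e2; have [eta' eta'0 Heta'] := H' _ e2.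
exists (Num.min eta eta'); first by rewrite lt_min eta0.
move=> t /andP[t0]; rewrite lt_min => /andP[t1 t2].
rewrite (splitr e) mulrDl EFinD.
have -> : S `|` S' = S `|` (S' `\` S) by rewrite setUDr setDv setD0.
have mD : measurable (S' `\` S) by exact: measurableD.
rewrite ge0_integral_setU//; last 2 first.
- by apply: mnorm; exact: measurableU.
- by apply/disj_setPS => x [Sx [_]].
apply: leeD; first by apply: Heta; rewrite t0.
apply: le_trans (Heta' t _); last by rewrite t0.
by apply: ge0_subset_integral => //; exact: mnorm.
Qed.

Lemma L1_increment_compact (S : set E) : compact S ->
  (forall x, S x -> exists a b : E, nbhs x (box a b) /\ L1_increment (box a b) g z) ->
  L1_increment S g z.
Proof.
move=> cS H; have mS : measurable (S : set mE) by exact: compact_measurable.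
pose P (A : set E) := exists B : set mE, [/\ A `<=` B, measurable B & L1_increment B g z].
suff [B [SB mB HB]] : P S by exact: L1_increment_sub HB.
apply: compact_ind => //.
- exists set0; split => // e e0; exists 1 => // t /andP[t0 _].
  by rewrite integral_set0 lee_fin mulr_ge0// ltW.
- move=> A B [A' [AA' mA' HA']] [B' [BB' mB' HB']]; exists (A' `|` B'); split.
  + exact: setUSS.
  + exact: measurableU.
  + exact: L1_increment_setU.
- by move=> A B AB [B' [BB' mB' HB']]; exists B'; split => //; exact: subset_trans BB'.
- move=> x /H[a [b [xab Hab]]]; exists (box a b) => //.
  by exists (box a b); split => //; exact: measurable_box.
Qed.

End fixed_function.

Lemma L1_increment_weak (u w : E -> R) (S : set E) : is_weak_partial U k u w ->
  compact S -> S `<=` U -> L1_increment S u w.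
Proof.
move=> uw cS SU; have [[mu _] [mw _] _] := uw.
apply: L1_increment_compact => // x Sx.
have [a [b [delta d0 [xab _ QU]]]] := enlarged_box (SU _ Sx).
exists a, b; split => // e e0.
have [eta /andP[eta0 etad] Heta] := increment_L1_box oU uw d0 QU e0.
exists eta => // t t01; apply: le_trans (Heta t t01).
have /andP[t0 t1] := t01.
rewrite le_eqVlt; apply/orP; left; apply/eqP; apply: eq_integral => y /set_mem yab.
have yQ s : `|s| <= delta -> closed_box (a - const_mx delta) (b + const_mx delta) ((y : E) + s *: v).
  by move=> sd; exact: box_translate.
have y0 := yQ 0; rewrite normr0 scale0r addr0 in y0.
have {}y0 := y0 (ltW d0).
have yt : closed_box (a - const_mx delta) (b + const_mx delta) ((y : E) + t *: v).
  by apply: yQ; rewrite gtr0_norm// ltW// (lt_trans t1).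
have Uy := QU _ y0; have Ut := QU _ yt.
by rewrite /increment_error /translate !zero_extE// !patchE !mem_set.
Qed.

(** The mean value theorem along the line bounds the error by the oscillation of the
    partial derivative, which is small near each point of S. *)
Lemma L1_increment_C1 (h : E -> R) (S : set E) :
  (forall x, U x -> {for x, continuous h}) ->
  (forall x, U x -> derivable h x v /\ {for x, continuous (partial k h)}) ->
  compact S -> S `<=` U -> L1_increment S h (partial k h).
Proof.
move=> ch dh cS SU e e0.
have mS : measurable (S : set mE) by exact: compact_measurable.
pose M := fine (leb S).
have Mfin : leb S \is a fin_num by rewrite ge0_fin_numE// lebesgue_compact_lty.
have M0 : 0 <= M by rewrite fine_ge0.
pose e' := e / (M + 1); have e'0 : 0 < e' by rewrite divr_gt0// ltr_wpDl.
pose P (A : set E) := exists2 eta : R, 0 < eta & forall t, 0 < t < eta -> forall x, A x -> S x ->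
  `|increment_error h (partial k h) t x| <= e' * t.
have [eta eta0 Heta] : P S.
  apply: compact_ind => //.
  - by exists 1.
  - move=> A B [eta eta0 He] [eta' eta'0 He']; exists (Num.min eta eta'); first by rewrite lt_min eta0.
    move=> t /andP[t0]; rewrite lt_min => /andP[t1 t2] x [Ax|Bx] Sx.
      by apply: He; rewrite ?t0.
    by apply: He'; rewrite ?t0.
  - by move=> A B AB [eta eta0 He]; exists eta => // t t01 x Ax; apply: He => //; exact: AB.
  - move=> x0 Sx0; have Ux0 := SU _ Sx0.
    have [_ cd] := dh _ Ux0.
    have e'2 : 0 < e' / 2 by rewrite divr_gt0.
    have near1 : \forall x \near x0, U x /\ `|partial k h x0 - partial k h x| <= e' / 2.
      move/cvgrPdist_le : (cd) => /(_ _ e'2) cd'.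
      near=> x; split; last by near: x; exact: cd'.
      by near: x; exact: open_nbhs_nbhs.
    have /nbhs_ballP[r /= r0 Hr] := near1.
    exists (ball x0 (r / 2)); first by apply: nbhsx_ballx; rewrite divr_gt0.
    exists (r / 2); first by rewrite divr_gt0.
    move=> t /andP[t0 tr] x [_ xb] Sx.
    have xs s : 0 <= s <= t -> ball x0 r (x + s *: v).
      move=> /andP[s0 st]; split => // i j; have := xb i j; rewrite /ball/= !mxE (ord1 i) eqxx/=.
      have : `|s * (j == k)%:R| <= t.
        by case: (j == k); rewrite ?mulr1 ?mulr0 ?normr0 ?ger0_norm// (le_trans s0 st).
      by rewrite ler_norml !ltr_norml => /andP[? ?] /andP[? ?]; apply/andP; split; lra.
    have der s : s \in `]0, t[ -> is_derive s (1 : R) (fun s : R => h (x + s *: v)) (partial k h (x + s *: v)).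
      rewrite in_itv/= => /andP[s0 st]; apply: is_derive_along.
      have s0t : 0 <= s <= t by rewrite !ltW.
      have [Us _] := Hr _ (xs s s0t).
      by apply: DeriveDef => //; case: (dh _ Us).
    have [|c] := @MVT_segment R (fun s => h (x + s *: v)) (fun s => partial k h (x + s *: v)) 0 t (ltW t0) der.
      apply: continuous_in_subspaceT => s; rewrite inE/= in_itv/= => st.
      have [Us _] := Hr _ (xs s st).
      apply: (@continuous_comp _ _ _ (fun s : R => x + s *: v) h); last exact: ch.
      apply: cvgD; first exact: cvg_cst.
      by apply: cvgZr_tmp; exact: cvg_id.
    rewrite in_itv/= scale0r addr0 subr0 => ct E1.
    have t0t : 0 <= t <= t by rewrite ltW// lexx.
    have z0t : (0 : R) <= 0 <= t by apply/andP; split => //; exact: ltW.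
    have [Ut _] := Hr _ (xs t t0t).
    have [Ux0' Hx] := Hr _ (xs 0 z0t).
    have [_ Hc] := Hr _ (xs c ct).
    rewrite scale0r addr0 in Ux0' Hx.
    rewrite /increment_error /translate !zero_extE// E1 mulrC -mulrBr normrM gtr0_norm// mulrC ler_wpM2r ?(ltW t0)//.
    rewrite -(subrKA (partial k h x0)) (le_trans (ler_normD _ _))// (splitr e') lerD//.
    by rewrite distrC.
exists eta => // t t01; have /andP[t0 _] := t01.
apply: (@le_trans _ _ (\int[leb]_(x in S) (e' * t)%:E)%E).
  apply: ge0_le_integral => //.
  - apply/measurable_EFinP/measurable_funTS; apply: measurableT_comp => //.
    apply: measurable_increment_error; apply: continuous_measurable_borel => // x Ux.
    by case: (dh _ Ux).
  - by move=> x Sx; rewrite lee_fin Heta.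
rewrite integral_cst//= -(fineK Mfin) -/M -EFinM lee_fin /e'.
rewrite [leLHS](_ : _ = e * t * (M / (M + 1))); last by field; rewrite gt_eqF// ltr_wpDl.
by rewrite ler_piMr ?mulr_ge0 ?ltW// ltr_pdivrMr ?mul1r ?ltrDl// ltr_wpDl.
Unshelve. all: by end_near. Qed.

Lemma L1_incrementD (S : set E) (g z g' z' : E -> R) : compact S ->
  measurable_fun (U : set mE) (g : mE -> R) -> measurable_fun (U : set mE) (z : mE -> R) ->
  measurable_fun (U : set mE) (g' : mE -> R) -> measurable_fun (U : set mE) (z' : mE -> R) ->
  L1_increment S g z -> L1_increment S g' z' ->
  L1_increment S (fun x => g x + g' x) (fun x => z x + z' x).
Proof.
move=> cS mg mz mg' mz' H H' e e0; have e2 : 0 < e / 2 by rewrite divr_gt0.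
have mS : measurable (S : set mE) by exact: compact_measurable.
have [eta eta0 Heta] := H _ e2; have [eta' eta'0 Heta'] := H' _ e2.
exists (Num.min eta eta'); first by rewrite lt_min eta0.
move=> t /andP[t0]; rewrite lt_min => /andP[t1 t2].
have m1 := measurable_increment_error mg mz t.
have m2 := measurable_increment_error mg' mz' t.
have -> : increment_error (fun x => g x + g' x) (fun x => z x + z' x) t =
    (fun x => increment_error g z t x + increment_error g' z' t x).
  apply/funext => x; rewrite /increment_error /translate /zero_ext !patchE.
  have p0 : (point : R) = 0 by [].
  by case: ifP => _; case: ifP => _; rewrite ?p0; ring.
rewrite (splitr e) mulrDl EFinD.
apply: le_trans (leeD (Heta t _) (Heta' t _)); rewrite ?t0 ?t1 ?t2//.
rewrite -ge0_integralD//; last 2 first.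
- by apply/measurable_EFinP/measurable_funTS; exact: measurableT_comp.
- by apply/measurable_EFinP/measurable_funTS; exact: measurableT_comp.
apply: ge0_le_integral => //.
- apply/measurable_EFinP/measurable_funTS; apply: measurableT_comp => //; exact: measurable_funD.
- by apply: emeasurable_funD; apply/measurable_EFinP/measurable_funTS; exact: measurableT_comp.
- by move=> x _; rewrite -EFinD lee_fin ler_normD.
Qed.

End increments.

(** * Limits of difference quotients *)

Section difference_quotients.
Context {R : realType} {n : nat}.
Local Notation E := 'rV[R]_n.
Local Notation mE := (borel 'rV[R]_n).
Local Notation leb := (@lebesgue R n).
Variables (U : set E) (k : 'I_n).
Hypothesis oU : open U.
Local Notation v := (delta_mx 0 k : E).
Local Notation zext := (zero_ext U).

Lemma integrable_mul_supported (S : set mE) (f q : mE -> R) (C : R) : measurable S ->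
  leb.-integrable S (EFin \o f) -> measurable_fun setT q -> (forall x, `|q x| <= C) ->
  (forall x, ~ S x -> q x = 0) -> leb.-integrable setT (EFin \o (fun x => f x * q x)).
Proof.
move=> mS fi mq qC q0.
have -> : (fun x => f x * q x) = (fun x => (f \_ S) x * q x).
  apply/funext => x; rewrite patchE; case: ifPn => // xS.
  by rewrite q0 ?mulr0// => /mem_set; rewrite (negbTE xS).
apply: integrable_mul_bounded qC => //.
have := (integrable_mkcond (EFin \o f) mS).1 fi.
by rewrite -restrict_EFin.
Qed.

Lemma le_Rintegral_abs_supported (S : set mE) (f q : mE -> R) (C : R) : measurable S ->
  leb.-integrable S (EFin \o f) -> measurable_fun setT q -> (forall x, `|q x| <= C) ->
  (forall x, ~ S x -> q x = 0) ->
  `|(\int[leb]_x (f x * q x))%R| <= C * fine (\int[leb]_(x in S) `|f x|%:E).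
Proof.
move=> mS fi mq qC q0.
have ii := integrable_mul_supported mS fi mq qC q0.
have C0 : 0 <= C by exact: le_trans (normr_ge0 _) (qC 0).
apply: le_trans (le_normr_Rintegral measurableT ii) _.
have fS : leb.-integrable setT (EFin \o (f \_ S)).
  by have := (integrable_mkcond (EFin \o f) mS).1 fi; rewrite -restrict_EFin.
have -> : fine (\int[leb]_(x in S) `|f x|%:E) = (\int[leb]_x `|(f \_ S) x|)%R.
  have -> // : (\int[leb]_(x in S) `|f x|%:E = \int[leb]_x `|(f \_ S) x|%:E)%E.
  rewrite integral_mkcond; apply: eq_integral => x _.
  by rewrite !patchE; case: ifP => // _; rewrite normr0.
rewrite -RintegralZl//; last exact: integrable_norm.
apply: le_Rintegral => //.
- exact: integrable_norm.
- by apply: integrable_realZ => //; exact: integrable_norm.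
- move=> x _; rewrite normrM patchE; case: ifPn => xS; first by rewrite mulrC ler_wpM2r.
  by rewrite q0 ?normr0 ?mulr0// => /mem_set; rewrite (negbTE xS).
Qed.

(** Write the increment of g as t z plus an error. The error is o(t) in L^1(S), and
    the factors p and q are bounded. In the main term, moving the translation from p
    to z q leaves a pairing, which is continuous in the translation. The translated
    factor p is the inverse matrix at the displaced point, about whose increments
    nothing is known yet. *)
Lemma difference_quotient_limit (S : set E) (g z : E -> R) (p q : mE -> R) (C C' : R)
    (t_ : nat -> R) :
  compact S -> S `<=` U ->
  measurable_fun (U : set mE) (g : mE -> R) -> Lp_loc 1 U z -> L1_increment U k S g z ->
  measurable_fun setT p -> (forall x, `|p x| <= C) ->
  measurable_fun setT q -> (forall x, `|q x| <= C') -> (forall x, ~ S x -> q x = 0) ->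
  (forall m, 0 < t_ m) -> t_ m @[m --> \oo] --> (0 : R) ->
  (\forall m \near \oo, leb.-integrable setT (EFin \o (fun x =>
      (translate v (t_ m) (zext g) x - zext g x) * (translate v (t_ m) p x * q x)))) /\
  (t_ m)^-1 * (\int[leb]_x ((translate v (t_ m) (zext g) x - zext g x) *
      (translate v (t_ m) p x * q x)))%R @[m --> \oo] -->
  (\int[leb]_x (zext z x * (p x * q x)))%R.
Proof.
move=> cS SU mg Lz ig mp pC mq qC q0 t0 tlim.
have mS : measurable (S : set mE) by exact: compact_measurable.
have C0 : 0 <= C by exact: le_trans (normr_ge0 _) (pC 0).
have C'0 : 0 <= C' by exact: le_trans (normr_ge0 _) (qC 0).
have [mz _] := Lz.
have mzz := measurable_zero_ext oU mz; have mgg := measurable_zero_ext oU mg.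
pose Q m (x : mE) : R := translate v (t_ m) p x * q x.
have mQ m : measurable_fun setT (Q m).
  by apply: measurable_funM => //; exact: (measurableT_comp mp (measurable_translation (t_ m *: v))).
have QC m x : `|Q m x| <= C * C' by rewrite normrM ler_pM// /translate.
have Q0 m x : ~ S x -> Q m x = 0 by move=> Sx; rewrite /Q q0 ?mulr0.
have ziS : leb.-integrable (S : set mE) (EFin \o zext z).
  have := Lp_loc1_integrable oU Lz cS SU.
  rewrite -restrict_EFin => /(integrable_mkcond (EFin \o (z : mE -> R)) mS).2.
  by apply: eq_integrable => // x /set_mem Sx /=; rewrite zero_extE//; exact: SU.
have zQi m : leb.-integrable setT (EFin \o (fun x => zext z x * Q m x)).
  exact: integrable_mul_supported (QC m) (Q0 m).
pose err m := increment_error U k g z (t_ m).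
have merr m : measurable_fun setT (err m) by exact: measurable_increment_error.
have near_err e : 0 < e -> \forall m \near \oo,
    (\int[leb]_(x in S) `|err m x|%:E <= (e * t_ m)%:E)%E.
  move=> e0; have [eta eta0 Heta] := ig e e0.
  have : \forall m \near \oo, t_ m < eta.
    move/cvgrPdist_lt : tlim => /(_ _ eta0); apply: filterS => m.
    by rewrite sub0r normrN gtr0_norm.
  by apply: filterS => m tm; apply: Heta; rewrite t0.
have err_int m : (\int[leb]_(x in S) `|err m x|%:E <= (1 * t_ m)%:E)%E ->
    leb.-integrable (S : set mE) (EFin \o err m).
  move=> H; apply/integrableP; split; first exact/measurable_EFinP/measurable_funTS.
  by apply: le_lt_trans H _; exact: ltry.
have split_err m x : (translate v (t_ m) (zext g) x - zext g x) * Q m x =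
    err m x * Q m x + t_ m * (zext z x * Q m x).
  by rewrite /err /increment_error; ring.
have Ii m : (\int[leb]_(x in S) `|err m x|%:E <= (1 * t_ m)%:E)%E ->
    leb.-integrable setT (EFin \o (fun x => err m x * Q m x)).
  by move=> H; apply: integrable_mul_supported (QC m) (Q0 m) => //; exact: err_int.
split.
  apply: filterS (near_err 1 ltr01) => m Hm.
  rewrite (_ : (fun x => _) = (fun x => err m x * Q m x + t_ m * (zext z x * Q m x))).
    exact: (integrable_realD measurableT (Ii m Hm) (integrable_realZ measurableT (t_ m) (zQi m))).
  by apply/funext => x; exact: split_err.
have lim2 : (\int[leb]_x (zext z x * Q m x))%R @[m --> \oo] -->
    (\int[leb]_x (zext z x * (p x * q x)))%R.
  pose zz (x : mE) := zext z x * q x.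
  have zzi : leb.-integrable setT (EFin \o zz) by exact: integrable_mul_supported qC q0.
  have E m : (\int[leb]_x (zext z x * Q m x))%R = pairing k zz p (- t_ m).
    rewrite /pairing /Rintegral; congr (fine _).
    have := @integral_shift R n (- t_ m *: v) _ (zQi m).
    move=> <-; apply: eq_integral => x _; rewrite /zz /Q /translate /=; congr (_%:E).
    by rewrite -addrA -scalerDl addNr scale0r addr0 mulrA mulrAC.
  rewrite (_ : (\int[leb]_x (zext z x * (p x * q x)))%R = pairing k zz p 0); last first.
    apply: eq_Rintegral => x _; rewrite /zz /translate scale0r addr0.
    by rewrite mulrA mulrAC.
  rewrite (_ : (fun m => _) = (fun m => pairing k zz p (- t_ m))); last by apply/funext.
  apply: (@cvg_comp _ _ _ (fun m => - t_ m) (pairing k zz p) _ (nbhs (0 : R))).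
    have H : - t_ m @[m --> \oo] --> - (0 : R) by exact: cvgN.
    by rewrite oppr0 in H.
  exact: (@pairing_continuous R n k zz p C zzi mp pC 0).
have lim1 : (t_ m)^-1 * (\int[leb]_x ((translate v (t_ m) (zext g) x - zext g x) * Q m x))%R -
    (\int[leb]_x (zext z x * Q m x))%R @[m --> \oo] --> (0 : R).
  apply/cvgr0Pnorm_le => e e0.
  have CC : 0 < C * C' + 1 by rewrite ltr_wpDl// mulr_ge0.
  have e'0 : 0 < e / (C * C' + 1) by rewrite divr_gt0.
  apply: filterS2 (near_err 1 ltr01) (near_err _ e'0) => m H1 He.
  have -> : (\int[leb]_x ((translate v (t_ m) (zext g) x - zext g x) * Q m x))%R =
     (\int[leb]_x (err m x * Q m x))%R + t_ m * (\int[leb]_x (zext z x * Q m x))%R.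
    have D := RintegralD measurableT (Ii m H1) (integrable_realZ measurableT (t_ m) (zQi m)).
    have Z := RintegralZl (t_ m) measurableT (zQi m).
    apply: (etrans _ (etrans D _)); last by congr (_ + _); exact: Z.
    by apply: eq_Rintegral => x _; exact: split_err.
  rewrite mulrDr mulKf ?gt_eqF// addrK normrM gtr0_norm ?invr_gt0// ler_pdivrMl//.
  apply: le_trans (le_Rintegral_abs_supported mS (err_int m H1) (mQ m) (QC m) (Q0 m)) _.
  have fin : (\int[leb]_(x in S) `|err m x|%:E)%E \is a fin_num.
    rewrite ge0_fin_numE; first by apply: le_lt_trans H1 _; exact: ltry.
    by apply: integral_ge0 => x _; rewrite lee_fin.
  move: He; rewrite -(fineK fin) lee_fin => He.
  apply: (@le_trans _ _ (C * C' * (e / (C * C' + 1) * t_ m))).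
    by rewrite ler_wpM2l// mulr_ge0.
  rewrite [leLHS](_ : _ = t_ m * e * (C * C' / (C * C' + 1))); last by field; rewrite gt_eqF.
  rewrite ler_piMr ?mulr_ge0 ?(ltW (t0 m)) ?(ltW e0)//.
  by rewrite ler_pdivrMr// mul1r lerDl.
exact: (cvg_sub0 lim1 lim2).
Qed.

End difference_quotients.

(** * The weak derivative of an inverse matrix *)

Lemma Rintegral_sum d (T : measurableType d) (R : realType) (mu : {measure set T -> \bar R})
    (I : Type) (s : seq I) (f : I -> T -> R) :
  (forall i, mu.-integrable setT (EFin \o f i)) ->
  mu.-integrable setT (EFin \o (fun x => \sum_(i <- s) f i x)) /\
  (\int[mu]_x (\sum_(i <- s) f i x))%R = \sum_(i <- s) (\int[mu]_x f i x)%R.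
Proof.
move=> fi; elim: s => [|i s [IH1 IH2]].
  split; first by under eq_fun do rewrite big_nil; exact: (integrable0 mu setT).
  rewrite big_nil; under eq_Rintegral do rewrite big_nil.
  by rewrite Rintegral_cst// mul0r.
split.
  rewrite (_ : (fun x => _) = fun x => f i x + \sum_(j <- s) f j x).
    exact: (integrable_realD measurableT (fi i) IH1).
  by apply/funext => x; rewrite big_cons.
rewrite big_cons -IH2 -(RintegralD measurableT (fi i) IH1).
by apply: eq_Rintegral => x _; rewrite big_cons.
Qed.

Lemma cvg_sumr (R : realType) (T : Type) (F : set_system T) {FF : Filter F} (I : Type)
    (s : seq I) (f : I -> T -> R) (l : I -> R) :
  (forall i, f i t @[t --> F] --> l i) ->
  (\sum_(i <- s) f i t) @[t --> F] --> \sum_(i <- s) l i.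
Proof.
move=> fl; elim: s => [|i s IH].
  rewrite big_nil (_ : (fun t => _) = cst 0); first exact: cvg_cst.
  by apply/funext => t; rewrite big_nil.
rewrite big_cons (_ : (fun t => _) = fun t => f i t + \sum_(j <- s) f j t).
  exact: (cvgD (fl i) IH).
by apply/funext => t; rewrite big_cons.
Qed.

(** The resolvent identity: it expresses the increment of the inverse by the increment
    of the matrix. *)
Lemma invmx_diff (F : fieldType) (n : nat) (A B : 'M[F]_n) (i j : 'I_n) :
  A \in unitmx -> B \in unitmx ->
  invmx A i j - invmx B i j =
  - \sum_a \sum_b invmx A i a * (A a b - B a b) * invmx B b j.
Proof.
move=> uA uB.
have -> : invmx A i j - invmx B i j = (invmx A - invmx B) i j by rewrite !mxE.
have -> : invmx A - invmx B = - (invmx A *m (A - B) *m invmx B).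
  by rewrite mulmxBr mulmxBl mulVmx// mul1mx -mulmxA mulmxV// mulmx1 opprB.
rewrite mxE; congr (- _); rewrite exchange_big mxE; apply: eq_bigr => b _.
by rewrite mxE big_distrl; apply: eq_bigr => a _; rewrite !mxE.
Qed.

Section inverse_matrix.
Context {R : realType} {n : nat}.
Local Notation E := 'rV[R]_n.
Local Notation mE := (borel 'rV[R]_n).
Local Notation leb := (@lebesgue R n).
Variables (U : set E) (k : 'I_n).
Hypothesis oU : open U.
Local Notation v := (delta_mx 0 k : E).
Local Notation zext := (zero_ext U).

Lemma enlarged_compact (S : set E) : compact S -> S `<=` U ->
  exists Q : set E, exists2 delta : R, 0 < delta & [/\ compact Q, Q `<=` U &
    forall x t, S x -> `|t| <= delta -> Q (x + t *: v)].
Proof.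
move=> cS SU; pose P (A : set E) := exists Q : set E, exists2 delta : R, 0 < delta &
  [/\ compact Q, Q `<=` U & forall x t, A x -> `|t| <= delta -> Q (x + t *: v)].
apply: (@compact_ind _ S P) => //.
- by exists set0, 1 => //; split => //; exact: compact0.
- move=> A B [Q [d d0 [cQ QU HQ]]] [Q' [d' d'0 [cQ' QU' HQ']]].
  exists (Q `|` Q'), (Num.min d d'); first by rewrite lt_min d0.
  split; [exact: compactU|by move=> x [/QU|/QU']|].
  move=> x t xAB; rewrite le_min => /andP[td td'].
  by case: xAB => [/HQ/(_ td)|/HQ'/(_ td')]; [left|right].
- move=> A B AB [Q [d d0 [cQ QU HQ]]]; exists Q, d => //; split => // x t /AB; exact: HQ.
- move=> x /SU/(enlarged_box oU)[a [b [d d0 [xab _ sub]]]]; exists (box a b) => //.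
  exists (closed_box (a - const_mx d) (b + const_mx d)), d => //; split => //.
    exact: compact_closed_box.
  by move=> y t yab td; exact: box_translate.
Qed.

Lemma Lp_loc1_ae (u : E -> R) : measurable_fun (U : set mE) (u : mE -> R) ->
  (forall Q : set E, compact Q -> Q `<=` U -> exists2 f : mE -> R,
     leb.-integrable setT (EFin \o f) & \forall x \ae leb, Q x -> u x = f x) ->
  Lp_loc 1 U u.
Proof.
move=> mu H; split => // Q cQ QU; have [f fi uf] := H Q cQ QU.
have mQ : measurable (Q : set mE) by exact: compact_measurable.
have mf : measurable_fun setT f by exact: integrable_real_measurable fi.
have mnf : measurable_fun (Q : set mE) (fun x : mE => `|f x|%:E).
  apply/measurable_EFinP; apply: (measurableT_comp (@normr_measurable R setT)).
  exact: measurable_funTS.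
have muQ : measurable_fun setT (fun x : mE => (u \_ Q) x).
  have muQ : measurable_fun (Q : set mE) (u : mE -> R).
    by apply: measurable_funS mu => //; exact: open_measurable_borel.
  exact: ((measurable_restrictT (u : mE -> R) mQ).1 muQ).
rewrite Lnorm1.
rewrite (_ : (\int[leb]_x _ = \int[leb]_(x in Q) `|f x|%:E)%E).
  have /integrableP[_] := integrableS measurableT mQ (@subsetT _ _) fi.
  by [].
rewrite [RHS]integral_mkcond; apply: (@ae_eq_integral _ _ _ leb setT); first exact: measurableT.
- by apply: measurableT_comp => //; exact/measurable_EFinP.
- exact: ((measurable_restrictT (fun x : mE => `|f x|%:E) mQ).1 mnf).
- apply: aeS uf => x xf _; rewrite /= !patchE; case: ifP => [/set_mem/xf -> //|_].
  by rewrite normr0.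
Qed.

Variables (G : E -> 'M[R]_n) (z : 'I_n -> 'I_n -> E -> R).
Local Notation P i j := (fun x => invmx (G x) i j).
Hypotheses (mG : forall a b, measurable_fun (U : set mE) ((fun x => G x a b) : mE -> R))
  (mP : forall a b, measurable_fun (U : set mE) (P a b : mE -> R))
  (bP : forall Q : set E, compact Q -> Q `<=` U -> exists C : R, \forall x \ae leb,
     Q x -> G x \in unitmx /\ forall i j, `|invmx (G x) i j| <= C).

(** Bounded measurable functions on the whole space which agree with the entries of
    the inverse on Q, off a null set. The exceptional set N is kept explicitly, since
    its translates have to be avoided too. *)
Lemma truncated_inverse (Q : set E) : compact Q -> Q `<=` U ->
  exists (Pb : 'I_n -> 'I_n -> mE -> R) (C : R) (N : set mE),
  [/\ measurable N, leb N = 0%E, 0 <= C, forall i j, measurable_fun setT (Pb i j) &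
    [/\ forall i j x, `|Pb i j x| <= C, forall i j x, ~ Q x -> Pb i j x = 0 &
     forall x, Q x -> ~ N x -> G x \in unitmx /\ forall i j, Pb i j x = invmx (G x) i j]].
Proof.
move=> cQ QU; have mQ : measurable (Q : set mE) by exact: compact_measurable.
have [C [N [mN N0 HN]]] := bP cQ QU.
have good x : ~ N x -> Q x -> G x \in unitmx /\ forall i j, `|invmx (G x) i j| <= C.
  by move=> Nx; apply: contrapT => H; apply: Nx; apply: HN.
exists (fun i j => (P i j : mE -> R) \_ (Q `\` N)), `|C|, N; split => //.
  move=> i j; apply/(measurable_restrictT _ _).1; first exact: measurableD.
  apply: measurable_funS (mP i j); first exact: open_measurable_borel.
  by move=> x [/QU].
split.
- move=> i j x; rewrite patchE; case: ifPn => [/set_mem[Qx Nx]|_]; last by rewrite normr0.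
  by have [_ /(_ i j) H] := good x Nx Qx; apply: le_trans H (ler_norm _).
- move=> i j x Qx; rewrite patchE; case: ifPn => // /set_mem[] //.
- move=> x Qx Nx; split; first by have [] := good x Nx Qx.
  by move=> i j; rewrite patchE mem_set.
Qed.

Hypothesis Lz : forall a b, Lp_loc 1 U (z a b).

Lemma integrable_compact (S : set E) (f : E -> R) : compact S -> S `<=` U -> Lp_loc 1 U f ->
  leb.-integrable (S : set mE) (EFin \o zext f).
Proof.
move=> cS SU Lf; have mS : measurable (S : set mE) by exact: compact_measurable.
have := Lp_loc1_integrable oU Lf cS SU.
rewrite -restrict_EFin => /(integrable_mkcond (EFin \o (f : mE -> R)) mS).2.
by apply: eq_integrable => // x /set_mem Sx /=; rewrite zero_extE//; exact: SU.
Qed.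

Lemma integrable_compact_bounded (Q : set E) (C : R) (f : mE -> R) : compact Q ->
  measurable_fun setT f -> (forall x, `|f x| <= C) -> (forall x, ~ Q x -> f x = 0) ->
  leb.-integrable setT (EFin \o f).
Proof.
move=> cQ mf fC f0; have mQ : measurable (Q : set mE) by exact: compact_measurable.
have i1 : leb.-integrable (Q : set mE) (EFin \o (cst 1 : mE -> R)).
  apply/integrableP; split; first exact/measurable_EFinP.
  rewrite (eq_integral (cst 1%E)) => [|x _]; last by rewrite /= normr1.
  by rewrite integral_cst// mul1e; exact: lebesgue_compact_lty.
have := integrable_mul_supported mQ i1 mf fC f0.
by under eq_fun do rewrite mul1r.
Qed.

Local Notation w i j := (fun x => - \sum_a \sum_b invmx (G x) i a * z a b x * invmx (G x) b j).

Lemma Lp_loc1_inverse i j : Lp_loc 1 U (P i j) /\ Lp_loc 1 U (w i j).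
Proof.
split.
  apply: Lp_loc1_ae => // Q cQ QU.
  have [Pb [C [N [mN N0 C0 mPb [PbC Pb0 PbP]]]]] := truncated_inverse cQ QU.
  exists (Pb i j); first exact: (integrable_compact_bounded cQ (mPb i j) (PbC i j) (Pb0 i j)).
  exists N; split => // x H; apply: contrapT => Nx; apply: H => Qx.
  by have [_ ->] := PbP x Qx Nx.
apply: Lp_loc1_ae.
  apply: measurable_funN; apply: measurable_sum => a; apply: measurable_sum => b.
  by apply: measurable_funM => //; apply: measurable_funM => //; case: (Lz a b).
move=> Q cQ QU; have mQ : measurable (Q : set mE) by exact: compact_measurable.
have [Pb [C [N [mN N0 C0 mPb [PbC Pb0 PbP]]]]] := truncated_inverse cQ QU.
exists (fun x => -1 * \sum_a \sum_b (zext (z a b) x * (Pb i a x * Pb b j x))).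
  apply: integrable_realZ => //.
  apply: (Rintegral_sum _ _).1 => a; apply: (Rintegral_sum _ _).1 => b.
  apply: (@integrable_mul_supported _ _ Q _ _ (C * C)) => //.
  - exact: integrable_compact.
  - exact: measurable_funM.
  - by move=> x; rewrite normrM ler_pM.
  - by move=> x Qx; rewrite Pb0// mul0r.
exists N; split => // x H; apply: contrapT => Nx; apply: H => Qx.
have [_ PbE] := PbP x Qx Nx; rewrite mulN1r; congr (- _).
apply: eq_bigr => a _; apply: eq_bigr => b _; rewrite !PbE zero_extE; last exact: QU.
by rewrite mulrCA mulrA.
Qed.

Lemma ae_shift (N : set mE) (t : E) : measurable N -> leb N = 0%E ->
  \forall x \ae leb, ~ N ((x : E) + t).
Proof.
move=> mN N0; exists ((fun x : mE => ((x : E) + t : mE)) @^-1` N); split.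
- by rewrite -[X in measurable X]setTI; exact: measurable_translation.
- exact: etrans (lebesgue_shift t mN) N0.
- by move=> x /contrapT.
Qed.

Lemma difference_quotient_seq (f : E -> R) (x : E) (t_ : nat -> R) :
  derivable f x v -> (forall m, 0 < t_ m) -> t_ m @[m --> \oo] --> (0 : R) ->
  (t_ m)^-1 * (f x - f (x + (- t_ m) *: v)) @[m --> \oo] --> partial k f x.
Proof.
move=> df t0 tlim.
have H : - t_ m @[m --> \oo] --> (0 : R)^'.
  have H0 : - t_ m @[m --> \oo] --> - (0 : R) by exact: cvgN.
  rewrite oppr0 in H0; move=> A; rewrite /dnbhs /within /= => HA.
  have H1 : \forall m \near \oo, - t_ m != 0 -> A (- t_ m) by exact: (H0 _ HA).
  by apply: filterS H1 => m; apply; rewrite oppr_eq0 gt_eqF.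
have := cvg_comp _ _ H df.
apply: cvg_trans; apply: near_eq_cvg; apply: nearW => m.
by rewrite /= [(- t_ m) *: _ + x]addrC invrN scaleNr -scalerN opprB.
Qed.

Hypothesis Iz : forall a b S, compact S -> S `<=` U ->
  L1_increment U k S (fun x => G x a b) (z a b).

(** Let X(t) be the integral of (P(x + t e_k) - P(x)) phi(x). By the resolvent identity
    X(t) / t is a sum of integrals to which the limit theorem for difference quotients
    applies; the limit is the integral of - P z P phi. After a change of variables,
    X(t) / t is also the integral of P against difference quotients of phi, which
    converge boundedly to - d_k phi. Comparison of the limits gives the claim. *)
Lemma weak_partial_inverse i j : is_weak_partial U k (P i j) (w i j).
Proof.
have [LP Lw] := Lp_loc1_inverse i j; split => // phi tphi.
have [sphi cS SU] := tphi.
set S := closure _ in cS SU.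
have mS : measurable (S : set mE) by exact: compact_measurable.
have [Q [delta d0 [cQ QU SQ]]] := enlarged_compact cS SU.
have [Pb [C [N [mN N0 C0 mPb [PbC Pb0 PbP]]]]] := truncated_inverse cQ QU.
have [D D0 phiD] := test_function_bounded tphi.
have [D' D'0 dphiD] := @test_function_partial_bounded _ _ _ _ k tphi.
have cphi := test_function_continuous tphi.
have mphi : measurable_fun setT (phi : mE -> R).
  by apply: continuous_measurable_borel => [|x _]; [exact: openT|exact: cphi].
have cdphi := @test_function_partial_continuous _ _ _ _ k tphi.
have mdphi : measurable_fun setT (partial k phi : mE -> R).
  by apply: continuous_measurable_borel => [|x _]; [exact: openT|exact: cdphi].
have phi0 x : ~ S x -> phi x = 0 by exact: test_function_out.
have dphi0 x : ~ S x -> partial k phi x = 0 by exact: test_function_partial_out.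
have SQ0 x : S x -> Q x.
  by move=> Sx; have := SQ x 0 Sx; rewrite scale0r addr0 normr0; apply; exact: ltW.
pose t_ m : R := delta / m.+1%:R.
have t0 m : 0 < t_ m by rewrite divr_gt0.
have td m : `|t_ m| <= delta by rewrite gtr0_norm// ler_pdivrMr// ler_peMr ?ler1n// ltW.
have tlim : t_ m @[m --> \oo] --> (0 : R).
  have H : delta * harmonic m @[m --> \oo] --> delta * 0.
    by exact: (cvgM (cvg_cst delta) cvg_harmonic).
  by rewrite mulr0 in H.
pose q b (x : mE) : R := Pb b j x * phi x.
have mq b : measurable_fun setT (q b) by exact: measurable_funM.
have qC b x : `|q b x| <= C * D by rewrite normrM ler_pM.
have q0 b x : ~ S x -> q b x = 0 by move=> Sx; rewrite /q phi0 ?mulr0.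
pose J a b : R := (\int[leb]_x (zext (z a b) x * (Pb i a x * q b x)))%R.
pose F a b m (x : mE) := (translate v (t_ m) (zext (fun y => G y a b)) x
  - zext (fun y => G y a b) x) * (translate v (t_ m) (Pb i a) x * q b x).
have DQ a b := difference_quotient_limit oU cS SU (mG a b) (Lz a b) (Iz a b cS SU)
  (mPb i a) (PbC i a) (mq b) (qC b) (q0 b) t0 tlim.
pose X m := (\int[leb]_x ((translate v (t_ m) (Pb i j) x - Pb i j x) * phi x))%R.
have near_int : \forall m \near \oo, forall ab : 'I_n * 'I_n,
    leb.-integrable setT (EFin \o F ab.1 ab.2 m).
  by apply: filter_forall => ab; have [] := DQ ab.1 ab.2.
have mTPb m : measurable_fun setT (translate v (t_ m) (Pb i j)).
  exact: (measurableT_comp (mPb i j) (measurable_translation (t_ m *: v))).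
(* The limit by way of the increments of G. *)
have lim1 : (t_ m)^-1 * X m @[m --> \oo] --> - \sum_a \sum_b J a b.
  have H : - \sum_a \sum_b ((t_ m)^-1 * (\int[leb]_x F a b m x)%R) @[m --> \oo] -->
      - \sum_a \sum_b J a b.
    apply: cvgN; apply: cvg_sumr => a; apply: cvg_sumr => b.
    by have [_] := DQ a b.
  apply: cvg_trans H; apply: near_eq_cvg; apply: filterS near_int => m Hm.
  rewrite (_ : X m = - \sum_a \sum_b (\int[leb]_x F a b m x)%R).
    rewrite mulrN mulr_sumr; congr (- _); apply: eq_bigr => a _.
    by rewrite mulr_sumr.
  have HS a := Rintegral_sum (index_enum 'I_n) (fun b => Hm (a, b)).
  rewrite -(eq_bigr _ (fun a _ => (HS a).2)).
  have [HS1 HS2] := Rintegral_sum (index_enum 'I_n) (fun a => (HS a).1).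
  rewrite -HS2 -mulN1r -(RintegralZl _ measurableT HS1).
  rewrite /X /Rintegral; congr (fine _).
  apply: (@ae_eq_integral _ _ _ leb setT); first exact: measurableT.
  - by apply/measurable_EFinP; apply: measurable_funM => //; exact: measurable_funB.
  - apply/measurable_EFinP; exact: integrable_real_measurable (integrable_realZ _ _ HS1).
  have AN : \forall x \ae leb, ~ N x by exists N; split => // x /contrapT.
  apply: aeS2 AN (ae_shift (t_ m *: v) mN N0) => x Nx Nxt _; congr (_%:E); rewrite mulN1r.
  have [Sx|nSx] := pselect (S x); last first.
    rewrite phi0// mulr0 big1 ?oppr0// => a _; rewrite big1// => b _.
    by rewrite /F q0// !mulr0.
  have Qx := SQ0 _ Sx; have Qxt := SQ x _ Sx (td m).
  have [ux Px] := PbP _ Qx Nx; have [uxt Pxt] := PbP _ Qxt Nxt.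
  rewrite {1}/translate Px Pxt invmx_diff// mulNr big_distrl; congr (- _).
  apply: eq_bigr => a _; rewrite big_distrl; apply: eq_bigr => b _.
  rewrite /F /translate /q !zero_extE ?Pxt ?Px; [|exact: QU..].
  by rewrite !mulrA; congr (_ * _); congr (_ * _); rewrite mulrC.
have iPb : leb.-integrable setT (EFin \o Pb i j).
  exact: (integrable_compact_bounded cQ (mPb i j) (PbC i j) (Pb0 i j)).
have iPphi : leb.-integrable setT (EFin \o (fun x => Pb i j x * phi x)).
  exact: integrable_mul_bounded phiD.
(* The limit by way of the increments of phi: the translation is moved from Pb to phi. *)
have lim2 : (t_ m)^-1 * X m @[m --> \oo] --> - (\int[leb]_x (Pb i j x * partial k phi x))%R.
  pose dq m (x : mE) := (t_ m)^-1 * (phi x - translate v (- t_ m) phi x).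
  have mdq m : measurable_fun setT (dq m).
    apply: measurable_funM => //; apply: measurable_funB => //.
    exact: (measurableT_comp mphi (measurable_translation (- t_ m *: v))).
  have dqD m x : `|dq m x| <= D'.
    rewrite normrM gtr0_norm ?invr_gt0// ler_pdivrMl// mulrC.
    have := @test_function_increment _ _ U phi k D' (x + (- t_ m) *: v) (t_ m) tphi dphiD (ltW (t0 m)).
    by rewrite -addrA -scalerDl addNr scale0r addr0.
  have E m : (t_ m)^-1 * X m = - (\int[leb]_x (Pb i j x * dq m x))%R.
    have i1 : leb.-integrable setT (EFin \o (fun x => translate v (t_ m) (Pb i j) x * phi x)).
      exact: integrable_mul_bounded (integrable_translate v (t_ m) iPb) mphi phiD.
    have -> : X m = (\int[leb]_x (translate v (t_ m) (Pb i j) x * phi x))%R -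
        (\int[leb]_x (Pb i j x * phi x))%R.
      rewrite -(RintegralB measurableT i1 iPphi); apply: eq_Rintegral => x _.
      by rewrite mulrBl.
    have mTphi : measurable_fun setT (translate v (- t_ m) (phi : mE -> R)).
      exact: (measurableT_comp mphi (measurable_translation (- t_ m *: v))).
    have i2 : leb.-integrable setT (EFin \o (fun x => Pb i j x * translate v (- t_ m) phi x)).
      by apply: integrable_mul_bounded iPb mTphi _ => x; exact: phiD.
    have -> : (\int[leb]_x (translate v (t_ m) (Pb i j) x * phi x))%R =
        (\int[leb]_x (Pb i j x * translate v (- t_ m) phi x))%R.
      rewrite /Rintegral; congr (fine _).
      have := @integral_shift R n (t_ m *: v) _ i2.
      move=> <-; apply: eq_integral => x _; rewrite /translate /=; congr (_%:E).
      by rewrite -addrA -scalerDl subrr scale0r addr0.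
    rewrite -(RintegralB measurableT i2 iPphi) -RintegralZl//; last exact: integrable_realB.
    have Z := RintegralZl (-1) measurableT (integrable_mul_bounded iPb (mdq m) (dqD m)).
    rewrite mulN1r in Z; rewrite -Z.
    by apply: eq_Rintegral => x _; rewrite /dq; ring.
  rewrite (_ : (fun m => _) = (fun m => - (\int[leb]_x (Pb i j x * dq m x))%R)); last first.
    by apply/funext.
  apply: cvgN; apply: (@Rdominated_convergence _ _ _ _ _ _ _ (fun x => `|Pb i j x| * D')) => //.
  - by move=> m; exact: measurable_funM.
  - exact: measurable_funM.
  - apply: aeW => x _; apply: cvgMl_tmp; apply: difference_quotient_seq => //.
    by have [] := @test_function_is_derive _ _ _ _ k x tphi.
  - by under eq_fun do rewrite mulrC; apply: integrable_realZ => //; exact: integrable_norm.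
  - by apply: aeW => x m _; rewrite normrM ler_wpM2l.
have key : (\int[leb]_x (Pb i j x * partial k phi x))%R = \sum_a \sum_b J a b.
  apply: oppr_inj; exact: (cvg_unique (@norm_hausdorff _ R^o) lim2 lim1).
have iJ a b : leb.-integrable setT (EFin \o (fun x => zext (z a b) x * (Pb i a x * q b x))).
  apply: (@integrable_mul_supported _ _ S _ _ (C * (C * D))) => //.
  - exact: integrable_compact.
  - exact: measurable_funM.
  - by move=> x; rewrite normrM ler_pM.
  - by move=> x Sx; rewrite q0// mulr0.
have iJa a := Rintegral_sum (index_enum 'I_n) (iJ a).
have [iJJ EJ] := Rintegral_sum (index_enum 'I_n) (fun a => (iJa a).1).
have {}EJ : (\int[leb]_x (\sum_a \sum_b (zext (z a b) x * (Pb i a x * q b x))))%R =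
    \sum_a \sum_b J a b.
  by rewrite EJ; apply: eq_bigr => a _; rewrite (iJa a).2.
have toR (f g : mE -> R) : leb.-integrable setT (EFin \o g) ->
    (forall x, ~ S x -> f x = 0 /\ g x = 0) -> measurable_fun (U : set mE) f ->
    (forall x, S x -> ~ N x -> f x = g x) ->
    (\int[leb]_(x in U) (f x)%:E = (\int[leb]_x g x)%R%:E)%E.
  move=> gi fg0 mf fg; rewrite /Rintegral fineK; last exact: integrable_fin_num gi.
  rewrite [LHS]integral_mkcond; apply: (@ae_eq_integral _ _ _ leb setT); first exact: measurableT.
  - have mfE : measurable_fun (U : set mE) (fun x : mE => (f x)%:E) by exact/measurable_EFinP.
    exact: ((measurable_restrictT (fun x : mE => (f x)%:E) (open_measurable_borel oU)).1 mfE).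
  - apply/measurable_EFinP; exact: integrable_real_measurable gi.
  exists N; split => // x H; apply: contrapT => Nx; apply: H => _ /=.
  have [Sx|Sx] := pselect (S x).
    by rewrite patchE mem_set ?fg//; exact: SU.
  by have [f0 ->] := fg0 x Sx; rewrite patchE f0; case: ifP.
have -> : (\int[leb]_(x in U) (invmx (G x) i j * partial k phi x)%:E =
    (\int[leb]_x (Pb i j x * partial k phi x))%R%:E)%E.
  apply: toR.
  - exact: integrable_mul_bounded dphiD.
  - by move=> x Sx; rewrite dphi0// !mulr0.
  - by apply: measurable_funM => //; exact: measurable_funTS.
  - by move=> x Sx Nx; have [_ ->] := PbP x (SQ0 _ Sx) Nx.
rewrite key -EJ.
have -> : (\int[leb]_(x in U) (w i j x * phi x)%:E = (\int[leb]_x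
    (-1 * \sum_a \sum_b (zext (z a b) x * (Pb i a x * q b x))))%R%:E)%E.
  apply: toR.
  - exact: integrable_realZ.
  - move=> x Sx; rewrite phi0// mulr0; split => //.
    by rewrite big1 ?mulr0// => a _; rewrite big1// => b _; rewrite q0// !mulr0.
  - by apply: measurable_funM; [case: Lw|exact: measurable_funTS].
  - move=> x Sx Nx; have [_ Px] := PbP x (SQ0 _ Sx) Nx.
    rewrite mulN1r mulNr big_distrl; congr (- _); apply: eq_bigr => a _.
    rewrite big_distrl; apply: eq_bigr => b _; rewrite /q !Px zero_extE; last exact: SU.
    by rewrite /=; ring.
by rewrite RintegralZl// mulN1r EFinN oppeK.
Qed.

End inverse_matrix.

(** * Partial derivatives of continuous functions *)

(** By continuity an inequality needs to be known at the rational points only, which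
    makes conditions on difference quotients countable. *)
Lemma le_rational_dense (R : realType) (u : R -> R) (eta c s : R) : 0 < `|s| < eta ->
  {for s, continuous u} ->
  (forall q : rat, 0 < `|ratr q : R| < eta -> u (ratr q) <= c) -> u s <= c.
Proof.
move=> /andP[s0 se] cu H; rewrite leNgt; apply/negP => cs.
have cn : `|t| @[t --> s] --> `|s| := @norm_continuous R R^o s.
have n1 : \forall t \near s, c < u t by exact: (cvgr_gt (u s) cu).
have n2 : \forall t \near s, `|t| < eta.
  exact: (cvgr_lt `|s| cn).
have n3 : \forall t \near s, 0 < `|t|.
  exact: (cvgr_gt `|s| cn).
have : \forall t \near s, c < u t /\ (`|t| < eta /\ 0 < `|t|) by exact: filterI n1 (filterI n2 n3).
move=> /nbhs_ballP[e /= e0 sub].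
have [q] := @rat_in_itvoo R (s - e) (s + e) (ltac:(lra)).
rewrite in_itv /= => /andP[q1 q2].
have [|uq [qe q0]] := sub (ratr q).
  by rewrite /ball /= ltr_distlC; apply/andP; split; lra.
by have := H q; rewrite q0 qe leNgt uq => /(_ isT).
Qed.

Section countable_measurable.
Context d (T : measurableType d).

Lemma measurable_forall_count (J : countType) (P : J -> T -> Prop) :
  (forall i, measurable [set x | P i x]) -> measurable [set x | forall i, P i x].
Proof.
move=> mP; rewrite (_ : [set x | _] = ~` (\bigcup_i ~` [set x | P i x])).
  by apply: measurableC; apply: countable_bigcupT_measurable => // i; exact: measurableC.
rewrite setC_bigcup; apply/seteqP; split => x /=.
  by move=> H i _; rewrite setCK; exact: H.
by move=> H i; have := H i I; rewrite setCK.
Qed.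

Lemma measurable_exists_count (J : countType) (P : J -> T -> Prop) :
  (forall i, measurable [set x | P i x]) -> measurable [set x | exists i, P i x].
Proof.
move=> mP; rewrite (_ : [set x | _] = \bigcup_i [set x | P i x]).
  exact: countable_bigcupT_measurable.
by apply/seteqP; split => x /= [i]; [exists i|exists i].
Qed.

Lemma measurable_imply (A : Prop) (P : T -> Prop) :
  (A -> measurable [set x | P x]) -> measurable [set x | A -> P x].
Proof.
move=> mP; have [a|na] := pselect A.
  by rewrite (_ : [set x | _] = [set x | P x]); [exact: mP|apply/seteqP; split => x /=; [exact|]].
rewrite (_ : [set x | _] = setT); first exact: measurableT.
by apply/seteqP; split => // x _ /na.
Qed.

Lemma measurable_le_cst (R : realType) (f : T -> R) (c : R) : measurable_fun setT f ->
  measurable [set x | f x <= c].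
Proof.
move=> mf; rewrite (_ : [set x | _] = setT `&` f @^-1` `]-oo, c]).
  by apply: mf => //; exact: measurable_itv.
by rewrite setTI; apply/seteqP; split => x /=; rewrite in_itv.
Qed.

Lemma measurable_ge_cst (R : realType) (f : T -> R) (c : R) : measurable_fun setT f ->
  measurable [set x | c <= f x].
Proof.
move=> mf; rewrite (_ : [set x | _] = setT `&` f @^-1` `[c, +oo[).
  by apply: mf => //; exact: measurable_itv.
by rewrite setTI; apply/seteqP; split => x /=; rewrite in_itv /= andbT.
Qed.

Lemma measurable_eq_cst (R : realType) (f : T -> R) (c : R) : measurable_fun setT f ->
  measurable [set x | f x = c].
Proof.
move=> mf; rewrite (_ : [set x | _] = setT `&` f @^-1` [set c]).
  by apply: mf => //; exact: measurable_set1.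
by rewrite setTI.
Qed.

End countable_measurable.

Section partial_continuous.
Context {R : realType} {n : nat}.
Local Notation E := 'rV[R]_n.
Local Notation mE := (borel 'rV[R]_n).
Local Notation leb := (@lebesgue R n).
Variables (U : set E) (k : 'I_n) (f : E -> R).
Hypothesis oU : open U.
Hypothesis cf : forall x, U x -> {for x, continuous f}.
Local Notation v := (delta_mx 0 k : E).
Local Notation zf := (zero_ext U f).

Lemma measurable_zero_ext_translate h : measurable_fun setT (translate v h zf).
Proof.
have mz : measurable_fun setT zf.
  by apply: measurable_zero_ext => //; exact: continuous_measurable_borel.
exact: (measurableT_comp mz (measurable_translation (h *: v))).
Qed.

Let q h (x : mE) : R := h^-1 * (translate v h zf x - zf x).

Let mq h : measurable_fun setT (q h).
Proof.
apply: measurable_funM => //; apply: measurable_funB; first exact: measurable_zero_ext_translate.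
by apply: measurable_zero_ext => //; exact: continuous_measurable_borel.
Qed.

Let small (a : rat) (m : nat) := 0 < `|ratr a : R| < m.+1%:R^-1.

(** By completeness, within U these are the points at which f has a partial derivative. *)
Let D : set mE := [set x | forall p : nat, exists m : nat, forall ab : rat * rat,
  small ab.1 m && small ab.2 m ->
  `|q (ratr ab.1) x - q (ratr ab.2) x| <= p.+1%:R^-1].

Let mD : measurable D.
Proof.
apply: measurable_forall_count => p; apply: measurable_exists_count => m.
apply: measurable_forall_count => ab; apply: measurable_imply => _.
apply: measurable_le_cst; apply: measurableT_comp => //.
exact: measurable_funB.
Qed.

Lemma line_nbhs x : U x -> exists2 d : R, 0 < d & forall h, `|h| < d -> U (x + h *: v).
Proof.
move=> Ux; have : \forall h \near (0 : R), U (x + h *: v).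
  have H : x + h *: v @[h --> (0 : R)] --> x by apply: cvg_line; exact: cvg_id.
  by apply: H; exact: open_nbhs_nbhs.
move=> /nbhs_ballP[d /= d0 sub]; exists d => // h hd; apply: sub.
by rewrite /ball /= sub0r normrN.
Qed.

Lemma line_continuous x h : U (x + h *: v) ->
  {for h, continuous (fun t : R => f (x + t *: v))}.
Proof.
move=> Uh; have := cf Uh; apply: (@continuous_comp _ _ _ (fun t : R => x + t *: v) f).
apply: continuousD; first exact: cvg_cst.
exact: (@scalel_continuous R E v).
Qed.

Let line_continuousC x h : U (x + h *: v) ->
  {for h, continuous (fun t : R => f (t *: v + x))}.
Proof.
move=> Uh; rewrite (_ : (fun t : R => _) = (fun t : R => f (x + t *: v))).
  exact: line_continuous.
by apply/funext => t; rewrite addrC.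
Qed.

Let quotientE x d h : U x -> (forall h, `|h| < d -> U (x + h *: v)) -> `|h| < d ->
  q h x = h^-1 *: (f (h *: v + x) - f x).
Proof.
by move=> Ux Ud hd; rewrite /q /translate !zero_extE 1?[h *: v + x]addrC//; exact: Ud.
Qed.

(** The rational quotients converge by completeness, and by continuity of f along the
    line the real ones are controlled by the rational ones. *)
Let partial_cvg x : U x -> D x -> exists l : R,
  h^-1 *: (f (h *: v + x) - f x) @[h --> (0 : R)^'] --> l.
Proof.
move=> Ux Dx; have [d d0 Ud] := line_nbhs Ux.
pose s j : R := ratr j.+1%:R^-1.
have sE j : s j = j.+1%:R^-1 by rewrite /s fmorphV rmorph_nat.
have Hs m j : (m < j)%N -> small j.+1%:R^-1 m.
  move=> mj; rewrite /small -/(s j) sE.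
  have j0 : 0 < j.+1%:R^-1 :> R by rewrite invr_gt0.
  rewrite gtr0_norm// j0 /=.
  by rewrite ltf_pV2 ?posrE// ltr_nat ltnS.
have cau : cauchy (q (s j) x @[j --> \oo]).
  apply: cauchy_exP => e e0.
  have [p pe] : exists p : nat, p.+1%:R^-1 < e.
    exists (Num.bound e^-1); rewrite invf_plt ?posrE//.
    by apply: (lt_trans (archi_boundP _)); rewrite ?ltr_nat// invr_ge0 ltW.
  have [m Hm] := Dx p; exists (q (s m.+1) x).
  have : \forall j \near \oo, ball (q (s m.+1) x) e (q (s j) x).
    near=> j; rewrite /ball /=; apply: le_lt_trans pe.
    apply: (Hm (m.+2%:R^-1, j.+1%:R^-1)); apply/andP; split => /=; first exact: Hs.
    by apply: Hs; near: j; exact: nbhs_infty_gt.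
  by [].
have [l Hl] : exists l : R, q (s j) x @[j --> \oo] --> l.
  by exists (lim (q (s j) x @[j --> \oo])); exact: (@R_complete R _ _ cau).
exists l; apply/cvgrPdist_le => e e0.
have [p pe] : exists p : nat, p.+1%:R^-1 < e.
  exists (Num.bound e^-1); rewrite invf_plt ?posrE//.
  by apply: (lt_trans (archi_boundP _)); rewrite ?ltr_nat// invr_ge0 ltW.
have [m Hm] := Dx p.
have rat_bound (a : rat) : small a m -> `|l - q (ratr a) x| <= e.
  move=> sa.
  have H : `|q (s j) x - q (ratr a) x| @[j --> \oo] --> `|l - q (ratr a) x|.
    by apply: cvg_norm; apply: cvgB => //; exact: cvg_cst.
  have <- := cvg_lim (@norm_hausdorff _ R^o) H.
  apply: le_trans (ltW pe); apply: limr_le; first by apply/cvg_ex; eexists; exact: H.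
  near=> j; apply: (Hm (j.+1%:R^-1, a)); rewrite /= sa andbT; apply: Hs.
  by near: j; exact: nbhs_infty_gt.
have eta0 : 0 < Num.min d m.+1%:R^-1 by rewrite lt_min d0 invr_gt0 ltr0n.
have : \forall h \near (0 : R), h != 0 -> 
    `|l - h^-1 *: (f (h *: v + x) - f x)| <= e.
  apply/nbhs_ballP; exists (Num.min d m.+1%:R^-1) => //= h; rewrite /ball /= sub0r normrN.
  rewrite lt_min => /andP[hd hm] h0.
  have hh : 0 < `|h| < Num.min d m.+1%:R^-1 by rewrite normr_gt0 h0 lt_min hd.
  apply: (@le_rational_dense R (fun h => `|l - h^-1 *: (f (h *: v + x) - f x)|) _ e h hh).
    apply: cvg_norm; apply: cvgB; first exact: cvg_cst.
    apply: cvgZ; first exact: cvgV.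
    apply: cvgB; last exact: cvg_cst.
    by apply: line_continuousC; exact: Ud.
  move=> a; rewrite lt_min andbCA => /andP[ad am].
  by rewrite -(quotientE Ux Ud ad); exact: rat_bound.
by [].
Unshelve. all: by end_near. Qed.

Let derivable_D x : U x -> derivable f x v -> D x.
Proof.
move=> Ux /cvg_ex[l Hl] p.
have [d d0 Ud] := line_nbhs Ux.
have p0 : 0 < p.+1%:R^-1 / 2 :> R by rewrite divr_gt0// invr_gt0.
move/cvgrPdist_lt : Hl => /(_ _ p0) /nbhs_ballP[e /= e0 He].
have [m me] : exists m : nat, m.+1%:R^-1 < Num.min d e.
  exists (Num.bound (Num.min d e)^-1); rewrite invf_plt ?posrE ?lt_min ?d0//.
  by apply: (lt_trans (archi_boundP _)); rewrite ?ltr_nat// invr_ge0 le_min (ltW d0) ltW.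
exists m => -[a b] /= /andP[/andP[a0 am] /andP[b0 bm]].
have H c : 0 < `|ratr c : R| -> `|ratr c : R| < m.+1%:R^-1 -> `|l - q (ratr c) x| <= p.+1%:R^-1 / 2.
  move=> c0 cm; have := lt_trans cm me; rewrite lt_min => /andP[cd ce].
  rewrite (quotientE Ux Ud cd) ltW//; apply: He; first by rewrite /ball /= sub0r normrN.
  by rewrite -normr_gt0.
rewrite (splitr (p.+1%:R^-1)) (le_trans (ler_distD l _ _))// lerD//; last exact: H.
by rewrite distrC; exact: H.
Qed.

(** The points of differentiability are those of D, a countable combination of
    measurable conditions. On D the partial derivative is a limit of difference
    quotients, and elsewhere it is 0 by convention. *)
Lemma measurable_partial : measurable_fun (U : set mE) (partial k f : mE -> R).
Proof.
have mU : measurable (U : set mE) by exact: open_measurable_borel.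
apply: (@measurable_fun_cvg _ _ _ _ (fun j (x : mE) => q j.+1%:R^-1 x * \1_D x)).
  move=> j; apply: measurable_funM; first exact: measurable_funTS.
  by apply: measurable_funTS; exact: measurable_indic.
move=> x Ux.
have [d d0 Ud] := line_nbhs Ux.
have [Dx|Dx] := pselect (D x); last first.
  have -> : partial k f x = 0.
    by apply: dvgP => df; apply: Dx; exact: derivable_D.
  rewrite (_ : (fun j => _) = cst 0); first exact: cvg_cst.
  by apply/funext => j; rewrite indicE memNset// mulr0.
have [l Hl] := partial_cvg Ux Dx.
have -> : partial k f x = l by exact: cvg_lim Hl.
have Hj : (j.+1%:R^-1 : R) @[j --> \oo] --> (0 : R)^'.
  move=> A; rewrite /dnbhs /within /= => HA.
  have H1 : \forall j \near \oo, (j.+1%:R^-1 : R) != 0 -> A (j.+1%:R^-1) by exact: (cvg_harmonic HA).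
  by apply: filterS H1 => j; apply; rewrite invr_eq0.
have H2 := cvg_comp _ _ Hj Hl.
apply: cvg_trans H2; apply: near_eq_cvg.
have : \forall j \near \oo, `|j.+1%:R^-1 : R| < d.
  by have /cvgrPdist_lt/(_ _ d0) := @cvg_harmonic R; apply: filterS => j; rewrite sub0r normrN.
apply: filterS => j jd /=.
by rewrite indicE mem_set// mulr1 (quotientE Ux Ud jd).
Qed.

(** If f x = c and the partial derivative at x is not 0, then for some m the inequality
    |f (x + s e_k) - c| >= |s| / (m + 1) holds for all small s. The points x of a box
    where it holds for |s| < eta form a measurable set N m. No two points of N m lie on
    a common line in the direction e_k at a distance less than eta, so the translates
    of N m by infinitely many distinct s e_k, |s| < eta, are disjoint. They have the same
    measure and lie in a compact set; hence N m is a null set. *)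
Lemma level_set_partial (c : R) : \forall x \ae leb, U x -> f x = c -> partial k f x = 0.
Proof.
apply: ae_open_cover => // a b abU.
have cab : compact (closed_box a b) by exact: compact_closed_box.
have [Q [delta d0 [cQ QU SQ]]] := @enlarged_compact R n U k oU _ cab abU.
pose eta m : R := Num.min delta m.+1%:R^-1.
have eta0 m : 0 < eta m by rewrite lt_min d0 invr_gt0 ltr0n.
pose N m : set mE := [set x | box a b x] `&` [set x | zf x = c] `&`
  [set x | forall s : rat, 0 < `|ratr s : R| < eta m -> `|ratr s| / m.+1%:R <= `|translate v (ratr s) zf x - c|].
have mzf : measurable_fun setT zf.
  by apply: measurable_zero_ext => //; exact: continuous_measurable_borel.
have mN m : measurable (N m).
  apply: measurableI; first apply: measurableI.
  - exact: measurable_box.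
  - exact: measurable_eq_cst.
  apply: measurable_forall_count => s; apply: measurable_imply => _.
  apply: measurable_ge_cst; apply: measurableT_comp => //; apply: measurable_funB => //.
  exact: measurable_zero_ext_translate.
suff N0 m : leb (N m) = 0%E.
  have : \forall x \ae leb, forall m, ~ N m x.
    by apply/ae_foralln => m; exists (N m); split => // x /contrapT.
  apply: aeS => x Nx xab fxc; apply: contrapT => px0.
  have Ux : U x by apply: abU; exact: box_sub_closed_box.
  have [d' d'0 Ud] := line_nbhs Ux.
  have /cvg_ex[l Hl] : derivable f x v by apply: contrapT => /dvgP p0; apply: px0; exact: p0.
  have lE : partial k f x = l by exact: cvg_lim Hl.
  rewrite lE in px0; have l0 : 0 < `|l| / 2 by rewrite divr_gt0// normr_gt0; exact/eqP.
  move/cvgrPdist_lt : Hl => /(_ _ l0) /nbhs_ballP[e /= e0 He].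
  have M0 : 0 < Num.min (Num.min d' e) (`|l| / 2) by rewrite !lt_min d'0 e0.
  have [m me] : exists m : nat, m.+1%:R^-1 < Num.min (Num.min d' e) (`|l| / 2).
    exists (Num.bound (Num.min (Num.min d' e) (`|l| / 2))^-1); rewrite invf_plt ?posrE//.
    by apply: (lt_trans (archi_boundP _)); rewrite ?ltr_nat// invr_ge0 ltW.
  apply: (Nx m); split; first by split => //=; rewrite zero_extE.
  move=> s /andP[s0 sm].
  move: me; rewrite !lt_min -andbA => /and3P[m1 m2 m3].
  move: sm; rewrite lt_min => /andP[sd sm].
  have sd' := lt_trans sm m1; have se := lt_trans sm m2.
  rewrite /translate zero_extE; last exact: Ud.
  have := He (ratr s); rewrite /ball /= sub0r normrN => /(_ se).
  rewrite -normr_gt0 => /(_ s0) H.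
  have H2 : `|l| / 2 <= `|(ratr s)^-1 * (f (ratr s *: v + x) - f x)|.
    move: H; set y := (ratr s)^-1 *: _ => H; rewrite -/y.
    have := ler_normD (l - y) y; rewrite subrK => H3.
    by rewrite -(lerD2l (`|l| / 2)) -splitr (le_trans H3)// lerD2r ltW.
  rewrite mulrC; apply: (@le_trans _ _ (`|ratr s| * (`|l| / 2))).
    by rewrite mulrC ler_wpM2l// ltW.
  apply: le_trans (ler_wpM2l _ H2) _ => //.
  have r0 : ratr s != 0 :> R by rewrite -normr_gt0.
  by rewrite -normrM (mulVKf r0) fxc [ratr s *: _ + x]addrC.
(* The inequality extends from rational to real increments by continuity. *)
move: m; have isolated m x (s : R) : N m x -> 0 < `|s| < eta m -> f (x + s *: v) <> c.
  move=> [[xab fxc] Hx] sm fs.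
  have Us h : `|h| < eta m -> U (x + h *: v).
    rewrite lt_min => /andP[/ltW hd _]; apply: QU; apply: SQ hd; exact: box_sub_closed_box.
  have /andP[s0 se] := sm.
  have : `|s| / m.+1%:R - `|f (x + s *: v) - c| <= 0.
    apply: (@le_rational_dense R (fun s => `|s| / m.+1%:R - `|f (x + s *: v) - c|) _ 0 s sm).
      apply: cvgB; first by apply: cvgMr_tmp; exact: (@norm_continuous _ R^o).
      apply: cvg_norm; apply: cvgB; last exact: cvg_cst.
      by apply: line_continuous; exact: Us.
    move=> r rm; have /andP[_ re] := rm.
    rewrite subr_le0; apply: le_trans (Hx r rm) _.
    by rewrite /translate zero_extE//; exact: Us.
  by rewrite fs subrr normr0 subr0 leNgt divr_gt0// ltr0n.
(* The amounts eta / (j + 2) lie strictly between 0 and eta, and so do the absolute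
   values of their differences. *)
pose s m j : R := eta m / j.+2%:R.
have s0 m j : 0 < s m j by rewrite divr_gt0.
have se m j : s m j < eta m by rewrite ltr_pdivrMr// ltr_pMr// ltr1n.
pose F m j : set mE := (fun x : mE => (x : E) + s m j *: v : mE) @^-1` N m.
have mF m j : measurable (F m j).
  by rewrite -[F m j]setTI; exact: (measurable_translation (s m j *: v)).
have FN m j : leb (F m j) = leb (N m) by exact: lebesgue_shift.
have FQ m j : F m j `<=` Q.
  move=> x [[xab _] _]; rewrite /= in xab.
  have : `|- s m j| <= delta.
    by rewrite normrN gtr0_norm// ltW// (lt_le_trans (se m j))// ge_min lexx.
  move=> /(SQ _ _ (box_sub_closed_box xab)).
  by rewrite -addrA -scalerDl subrr scale0r addr0.
have tF m : trivIset setT (F m).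
  apply/trivIsetP => i j _ _ ij; apply/seteqP; split => // x [Fi Fj].
  have sij : s m j - s m i != 0.
    rewrite subr_eq0; apply/eqP => /(mulfI (lt0r_neq0 (eta0 m)))/invr_inj/eqP.
    by rewrite eqr_nat !eqSS eq_sym (negbTE ij).
  apply: (isolated m _ (s m j - s m i) Fi).
    rewrite normr_gt0 sij /= ltr_norml.
    by have := s0 m i; have := s0 m j; have := se m i; have := se m j; lra.
  have [[xab fxc] _] := Fj; rewrite /= zero_extE in fxc; last first.
    by apply: QU; rewrite -[_ + _](addr0 _) -(scale0r v); apply: SQ; [exact: box_sub_closed_box|rewrite normr0 ltW].
  by rewrite -addrA -scalerDl [s m i + _]addrC subrK.
move=> m; have mQ : measurable (Q : set mE) by exact: compact_measurable.
have Qoo := lebesgue_compact_lty cQ.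
have bound M : (\sum_(i < M) leb (N m) <= leb Q)%E.
  rewrite (eq_bigr (fun i : 'I_M => leb (F m i))) => [|i _]; last by rewrite FN.
  rewrite -(measure_bigsetU leb (mF m) (tF m)).
  apply: le_measure; rewrite ?inE//; first exact: bigsetU_measurable.
  by rewrite -bigcup_mkord => x [i _ /FQ].
have Nfin : leb (N m) \is a fin_num.
  rewrite ge0_fin_numE//; apply: le_lt_trans Qoo.
  by have := bound 1%N; rewrite big_ord1.
have Qfin : leb Q \is a fin_num by rewrite ge0_fin_numE.
rewrite -(fineK Nfin); congr (_%:E); apply/eqP; rewrite eq_le fine_ge0// andbT.
rewrite leNgt; apply/negP => r0.
set r := fine _ in r0.
have := bound (Num.bound (fine (leb Q) / r)).
rewrite -(fineK Nfin) -(fineK Qfin) sumEFin lee_fin sumr_const card_ord -/r leNgt => /negP; apply.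
rewrite -mulr_natl -ltr_pdivrMr//; apply: archi_boundP.
by rewrite divr_ge0// ?fine_ge0// ltW.
Qed.

End partial_continuous.

(** * Derivatives of products and inverses, uniqueness of weak derivatives *)

Section derive_calculus.
Context {R : realType} {V : normedModType R}.

Lemma is_derive_mulr (f g : V -> R) x v df dg : is_derive x v f df -> is_derive x v g dg ->
  is_derive x v (fun y => f y * g y) (df * g x + f x * dg).
Proof.
move=> Hf Hg; have H := is_deriveM Hf Hg.
by apply: is_derive_eq H _; rewrite addrC mulrC.
Qed.

Lemma is_derive_sumr (I : Type) (s : seq I) (f : I -> V -> R) x v df :
  (forall i, is_derive x v (f i) (df i)) ->
  is_derive x v (fun y => \sum_(i <- s) f i y) (\sum_(i <- s) df i).
Proof.
move=> Hf; elim: s => [|i s IH].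
  rewrite big_nil (_ : (fun y => _) = cst 0); first exact: is_derive_cst.
  by apply/funext => y; rewrite big_nil.
rewrite big_cons (_ : (fun y => _) = f i + (fun y => \sum_(j <- s) f j y)).
  exact: is_deriveD.
by apply/funext => y; rewrite big_cons.
Qed.

Lemma derivable_is_derive (f : V -> R) x v : derivable f x v -> is_derive x v f ('D_v f x).
Proof. by move=> df; split. Qed.

Lemma derive_on_open (U : set V) (f g : V -> R) x v : open U -> U x ->
  (forall y, U y -> f y = g y) -> 'D_v f x = 'D_v g x.
Proof.
move=> oU Ux fg; apply: near_eq_derive; apply: filterS (open_nbhs_nbhs _) => [y|]; first exact: fg.
by split.
Qed.

End derive_calculus.

Lemma cvg_prodr (R : realType) (T : Type) (F : set_system T) {FF : Filter F} (I : Type)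
    (s : seq I) (f : I -> T -> R) (l : I -> R) :
  (forall i, f i t @[t --> F] --> l i) ->
  (\prod_(i <- s) f i t) @[t --> F] --> \prod_(i <- s) l i.
Proof.
move=> fl; elim: s => [|i s IH].
  rewrite big_nil (_ : (fun t => _) = cst 1); first exact: cvg_cst.
  by apply/funext => t; rewrite big_nil.
rewrite big_cons (_ : (fun t => _) = fun t => f i t * \prod_(j <- s) f j t).
  exact: (cvgM (fl i) IH).
by apply/funext => t; rewrite big_cons.
Qed.

Section inverse_limit.
Context {R : realType} {T : Type} (F : set_system T) {FF : Filter F}.

Lemma cvg_det m (A : T -> 'M[R]_m) (B : 'M[R]_m) :
  (forall a b, A t a b @[t --> F] --> B a b) -> \det (A t) @[t --> F] --> \det B.
Proof.
move=> AB; apply: cvg_sumr => s; apply: cvgMl_tmp; apply: cvg_prodr => i; exact: AB.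
Qed.

Lemma near_unitmx m (A : T -> 'M[R]_m) (B : 'M[R]_m) :
  (forall a b, A t a b @[t --> F] --> B a b) -> B \in unitmx ->
  \forall t \near F, A t \in unitmx.
Proof.
move=> AB; rewrite unitmxE unitfE => B0.
have := cvg_det AB; move/cvgrPdist_lt => /(_ `|\det B|); rewrite normr_gt0 => /(_ B0).
apply: filterS => t Ht; rewrite unitmxE unitfE; apply/eqP => A0.
by move: Ht; rewrite A0 subr0 ltxx.
Qed.

(** By the formula of Cramer. *)
Lemma cvg_invmx m (A : T -> 'M[R]_m) (B : 'M[R]_m) :
  (forall a b, A t a b @[t --> F] --> B a b) -> B \in unitmx ->
  forall i j, invmx (A t) i j @[t --> F] --> invmx B i j.
Proof.
move=> AB uB i j; have nu := near_unitmx AB uB.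
have E (C : 'M[R]_m) : C \in unitmx -> invmx C i j = (\det C)^-1 * ((-1) ^+ (j + i) *
    \det (row' j (col' i C))) by move=> uC; rewrite /invmx uC !mxE.
have H : (\det (A t))^-1 * ((-1) ^+ (j + i) * \det (row' j (col' i (A t)))) @[t --> F] -->
    (\det B)^-1 * ((-1) ^+ (j + i) * \det (row' j (col' i B))).
  apply: cvgM.
    by apply: cvgV; [move: uB; rewrite unitmxE unitfE|exact: cvg_det].
  apply: cvgMl_tmp; apply: cvg_det => a b; rewrite !mxE.
  by under eq_fun do rewrite !mxE; exact: AB.
rewrite E//; apply: cvg_trans H; apply: near_eq_cvg.
by apply: filterS nu => t uA; rewrite E.
Qed.

End inverse_limit.

Section derive_inverse.
Context {R : realType} {V : normedModType R}.

Lemma derivable_cvg_line (f : V -> R) (x v : V) : derivable f x v ->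
  f (h *: v + x) @[h --> (0 : R)^'] --> f x.
Proof.
move=> df; have H : h * (h^-1 *: (f (h *: v + x) - f x)) @[h --> (0 : R)^'] --> 0 * 'D_v f x.
  by apply: cvgM => //; apply: cvg_within; exact: cvg_id.
rewrite mul0r in H.
have H2 : f (h *: v + x) - f x @[h --> (0 : R)^'] --> (0 : R).
  apply: cvg_trans H; apply: near_eq_cvg.
  have : \forall h \near (0 : R)^', h != 0.
    have : \forall h \near (0 : R), h != 0 -> h != 0.
      by apply/nbhs_ballP; exists 1 => //=.
    by [].
  by apply: filterS => h h0; rewrite /GRing.scale /= mulVKf.
have H3 : (f x : R) @[h --> (0 : R)^'] --> f x by exact: cvg_cst.
exact: (cvg_sub0 H2 H3).
Qed.

(** The resolvent identity divided by h, in the limit. *)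
Lemma is_derive_invmx m (A : V -> 'M[R]_m) (x v : V) (dA : 'I_m -> 'I_m -> R) :
  (forall a b, is_derive x v (fun y => A y a b) (dA a b)) -> A x \in unitmx ->
  forall i j, is_derive x v (fun y => invmx (A y) i j)
    (- \sum_a \sum_b invmx (A x) i a * dA a b * invmx (A x) b j).
Proof.
move=> HA uA i j.
have cA a b : A (h *: v + x) a b @[h --> (0 : R)^'] --> A x a b.
  by have [dAab _] := HA a b; exact: (derivable_cvg_line dAab).
have nu : \forall h \near (0 : R)^', A (h *: v + x) \in unitmx by exact: near_unitmx cA uA.
have cP := cvg_invmx cA uA.
have lim : h^-1 *: (invmx (A (h *: v + x)) i j - invmx (A x) i j) @[h --> (0 : R)^'] -->
    - \sum_a \sum_b invmx (A x) i a * dA a b * invmx (A x) b j.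
  have H : - \sum_a \sum_b invmx (A (h *: v + x)) i a *
      (h^-1 *: (A (h *: v + x) a b - A x a b)) * invmx (A x) b j @[h --> (0 : R)^'] -->
      - \sum_a \sum_b invmx (A x) i a * dA a b * invmx (A x) b j.
    apply: cvgN; apply: cvg_sumr => a; apply: cvg_sumr => b.
    apply: cvgMr_tmp; apply: cvgM; first exact: cP.
    by have [d1 d2] := HA a b; rewrite -d2; exact: d1.
  apply: cvg_trans H; apply: near_eq_cvg; apply: filterS nu => h uh.
  rewrite invmx_diff// scalerN; congr (- _).
  rewrite scaler_sumr; apply: eq_bigr => a _; rewrite scaler_sumr; apply: eq_bigr => b _.
  by rewrite /GRing.scale /=; ring.
by split; [apply/cvg_ex; eexists; exact: lim|exact: cvg_lim lim].
Qed.

End derive_inverse.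

Section weak_partial_unique.
Context {R : realType} {n : nat}.
Local Notation E := 'rV[R]_n.
Local Notation mE := (borel 'rV[R]_n).
Local Notation leb := (@lebesgue R n).
Variables (U : set E) (k : 'I_n).
Hypothesis oU : open U.

Lemma weak_partialP u w : is_weak_partial U k u w -> is_weak_partial U k u (weak_partial U k u).
Proof. by move=> uw; apply: (@xgetPex _ (fun=> 0) (is_weak_partial U k u)); exists w. Qed.

Lemma measurable_weak_partial u :
  measurable_fun (U : set mE) (weak_partial U k u : mE -> R).
Proof.
have [[w uw]|no] := pselect (exists w, is_weak_partial U k u w).
  by have [_ [] //] := weak_partialP uw.
rewrite /weak_partial xgetPN; first exact: measurable_cst.
by move=> w uw; apply: no; exists w.
Qed.

(** The difference of two weak derivatives annihilates all test functions. *)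
Lemma weak_partial_unique u w w' : is_weak_partial U k u w -> is_weak_partial U k u w' ->
  \forall x \ae leb, U x -> w x = w' x.
Proof.
move=> [_ Lw Hw] [_ Lw' Hw'].
have mU : measurable (U : set mE) by exact: open_measurable_borel.
have Ld : Lp_loc 1 U (fun x => w x - w' x).
  apply: Lp_loc1_ae => //; first by apply: measurable_funB; [case: Lw|case: Lw'].
  move=> Q cQ QU.
  exists (fun x : mE => ((w : mE -> R) \_ Q) x - ((w' : mE -> R) \_ Q) x).
    exact: (integrable_realB measurableT (Lp_loc1_integrable oU Lw cQ QU)
      (Lp_loc1_integrable oU Lw' cQ QU)).
  by apply: aeW => x Qx; rewrite !patchE mem_set.
have int (f : E -> R) phi : Lp_loc 1 U f -> test_function U phi ->
    leb.-integrable (U : set mE) (EFin \o (fun x : mE => f x * phi x)).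
  move=> Lf tphi; have [_ cS SU] := tphi.
  have [D D0 phiD] := test_function_bounded tphi.
  have cphi := test_function_continuous tphi.
  have mphi : measurable_fun setT (phi : mE -> R).
    by apply: continuous_measurable_borel => [|x _]; [exact: openT|exact: cphi].
  have H := integrable_mul_supported (compact_measurable cS) (integrable_compact oU cS SU Lf)
    mphi phiD (fun x => test_function_out (@subset_refl _ _)).
  have := integrableS measurableT mU (@subsetT _ _) H.
  by apply: eq_integrable => // x /set_mem Ux /=; rewrite zero_extE.
have := fundamental_lemma oU Ld.
have H : forall phi, test_function U phi -> (\int[leb]_(x in U) ((w x - w' x) * phi x)%:E = 0)%E.
  move=> phi tphi; have i1 := int _ _ Lw tphi; have i2 := int _ _ Lw' tphi.
  have -> : (\int[leb]_(x in U) ((w x - w' x) * phi x)%:E =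
     \int[leb]_(x in U) ((w x * phi x)%:E - (w' x * phi x)%:E))%E.
    by apply: eq_integral => x _; rewrite mulrBl EFinB.
  rewrite (integralB mU i1 i2).
  have -> : (\int[leb]_(x in U) (w x * phi x)%:E = \int[leb]_(x in U) (w' x * phi x)%:E)%E.
    by apply: oppe_inj; rewrite -Hw// -Hw'.
  by rewrite subee//; exact: integrable_fin_num i2.
move=> /(_ H); apply: aeS => x Hx Ux; apply/eqP; rewrite -subr_eq0; apply/eqP; exact: Hx.
Qed.

End weak_partial_unique.

(** * Symmetry of second derivatives and flat metrics *)

Lemma subrBC (V : zmodType) (p q r t : V) : p - q - (r - t) = p - r - (q - t).
Proof. by rewrite !opprB !addrA [p - q + t]addrAC [p - r + t]addrAC [LHS]addrAC. Qed.

Lemma cancel_pairs (V : zmodType) (s s' a b c d : V) : s = s' -> a = c -> b = d ->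
  s - a - (s' - b) + (c - d) = 0.
Proof. by move=> -> -> ->; rewrite subrBC subrr sub0r addNr. Qed.

Lemma mulr4AC (S : comPzRingType) (p q r t : S) : p * (q * r * t) = p * q * (r * t).
Proof. by rewrite !mulrA. Qed.

Section schwarz.
Context {R : realType} {n : nat}.
Local Notation E := 'rV[R]_n.
Local Notation e_ k := (delta_mx 0 k : E).

Lemma plane_nbhs (W : set E) (i j : 'I_n) (x : E) : open W -> W x ->
  exists2 d : R, 0 < d & forall s t, `|s| < d -> `|t| < d -> W (x + s *: e_ i + t *: e_ j).
Proof.
move=> oW Wx; have /nbhs_ballP[e /= e0 sub] : nbhs x W by exact: open_nbhs_nbhs.
exists (e / 2) => [|s t se te]; first by rewrite divr_gt0.
apply: sub; split => // a b; rewrite /ball /= !mxE opprD addrA opprD addrA subrr add0r.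
rewrite -opprD normrN (le_lt_trans (ler_normD _ _))// (splitr e).
have B (c : R) (d : bool) : `|c| < e / 2 -> `|c * d%:R| < e / 2.
  by case: d; rewrite ?mulr1// mulr0 normr0 divr_gt0.
by apply: ltrD; exact: B.
Qed.

(** Two applications of the mean value theorem to the second difference. *)
Lemma second_difference (W : set E) (f : E -> R) (i j : 'I_n) (x : E) (d s : R) :
  (forall s t, `|s| < d -> `|t| < d -> W (x + s *: e_ i + t *: e_ j)) ->
  (forall y, W y -> derivable f y (e_ i)) ->
  (forall y, W y -> derivable (partial i f) y (e_ j)) ->
  0 < s < d -> exists a b : R, [/\ `|a| <= s, `|b| <= s &
    f (x + s *: e_ i + s *: e_ j) - f (x + s *: e_ i) - (f (x + s *: e_ j) - f x) =
    partial j (partial i f) (x + a *: e_ i + b *: e_ j) * s * s].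
Proof.
move=> Wd df ddf /andP[s0 sd].
have d0 : 0 < d by exact: lt_trans sd.
pose phi (t : R) := f (x + s *: e_ j + t *: e_ i) - f (x + t *: e_ i).
pose dphi (t : R) := partial i f (x + s *: e_ j + t *: e_ i) - partial i f (x + t *: e_ i).
have W1 t : `|t| < d -> W (x + t *: e_ i).
  by move=> td; have := Wd t 0 td; rewrite normr0 scale0r addr0 => /(_ d0).
have W2 t : `|t| < d -> W (x + s *: e_ j + t *: e_ i).
  by move=> td; rewrite addrAC; apply: Wd => //; rewrite gtr0_norm.
have Hphi (t : R) : `|t| < d -> is_derive t 1 phi (dphi t).
  move=> td; apply: is_deriveB; apply: is_derive_along; apply: derivable_is_derive; apply: df.
    exact: W2.
  exact: W1.
have cphi a b : 0 <= a -> b < d -> {within `[a, b], continuous phi}.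
  move=> a0 bd; apply: derivable_within_continuous => t; rewrite in_itv /= => /andP[ta tb].
  have td : `|t| < d by rewrite ger0_norm; [exact: le_lt_trans bd|exact: le_trans ta].
  by have [] := Hphi t td.
have inner t : 0 < t < s -> `|t| < d.
  by move=> /andP[t0 ts]; rewrite gtr0_norm// (lt_trans ts).
have [|a] := @MVT R phi dphi 0 s s0 _ (cphi 0 s (lexx 0) sd).
  by move=> t; rewrite in_itv /= => /inner; exact: Hphi.
rewrite in_itv /= subr0 => as_ Ea.
have ad := inner a as_.
pose psi (t : R) := partial i f (x + a *: e_ i + t *: e_ j).
have Hpsi (t : R) : `|t| < d -> is_derive t 1 psi (partial j (partial i f) (x + a *: e_ i + t *: e_ j)).
  by move=> td; apply: is_derive_along; apply: derivable_is_derive; apply: ddf; exact: Wd.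
have [||b] := @MVT R psi (fun t => partial j (partial i f) (x + a *: e_ i + t *: e_ j)) 0 s s0.
- by move=> t; rewrite in_itv /= => /inner; exact: Hpsi.
- apply: derivable_within_continuous => t; rewrite in_itv /= => /andP[t0 ts].
  have td : `|t| < d by rewrite ger0_norm// (le_lt_trans ts).
  by have [] := Hpsi t td.
rewrite in_itv /= subr0 => /andP[b0 bs] Eb.
have /andP[a0 aS] := as_.
exists a, b; split; rewrite ?gtr0_norm ?ltW//.
rewrite -Eb /psi scale0r addr0.
have -> : x + a *: e_ i + s *: e_ j = x + s *: e_ j + a *: e_ i by rewrite addrAC.
rewrite -/(dphi a) -Ea /phi !scale0r !addr0 addrAC.
have -> : x + s *: e_ j + s *: e_ i = x + s *: e_ i + s *: e_ j by rewrite addrAC.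
ring.
Qed.

(** The second difference is symmetric in the two directions, and divided by s^2 it
    converges to either mixed derivative. *)
Lemma schwarz (W : set E) (f : E -> R) (i j : 'I_n) (x : E) : open W -> W x ->
  (forall k y, W y -> derivable f y (e_ k)) ->
  (forall k l y, W y -> derivable (partial k f) y (e_ l)) ->
  (forall k l y, W y -> {for y, continuous (partial k (partial l f))}) ->
  partial i (partial j f) x = partial j (partial i f) x.
Proof.
move=> oW Wx df ddf cf; apply/eqP; rewrite -subr_eq0 -normr_eq0; apply/eqP/le_anti.
rewrite normr_ge0 andbT; apply/ler_addgt0Pr => e e0; rewrite add0r.
have e2 : 0 < e / 2 by rewrite divr_gt0.
have near k l : \forall y \near x, `|partial k (partial l f) x - partial k (partial l f) y| < e / 2.
  by have /cvgrPdist_lt := cf k l x Wx; apply.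
have : \forall y \near x, `|partial i (partial j f) x - partial i (partial j f) y| < e / 2 /\
    `|partial j (partial i f) x - partial j (partial i f) y| < e / 2.
  exact: filterI (near i j) (near j i).
move=> /nbhs_ballP[r /= r0 sub].
have oB : open (ball x r) by exact: ball_open.
have [d1 d10 B1] := @plane_nbhs (ball x r) i j x oB (ballxx _ r0).
have [d2 d20 B2] := @plane_nbhs (ball x r) j i x oB (ballxx _ r0).
have [d3 d30 B3] := @plane_nbhs W i j x oW Wx.
have [d4 d40 B4] := @plane_nbhs W j i x oW Wx.
pose d := Num.min (Num.min d1 d2) (Num.min d3 d4).
have d0 : 0 < d by rewrite !lt_min d10 d20 d30.
pose s := d / 2; have s0 : 0 < s by rewrite divr_gt0.
have sd : s < d by rewrite ltr_pdivrMr// ltr_pMr// ltr1n.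
have [sd1 sd2 sd3 sd4] : [/\ s < d1, s < d2, s < d3 & s < d4].
  by move: sd; rewrite !lt_min -andbA => /and4P[].
have [|a [b [as_ bs E1]]] := second_difference (s := s) B3 (df i) (ddf i j); first by rewrite s0.
have [|a' [b' [as' bs' E2]]] := second_difference (s := s) B4 (df j) (ddf j i); first by rewrite s0.
have : partial j (partial i f) (x + a *: e_ i + b *: e_ j) =
       partial i (partial j f) (x + a' *: e_ j + b' *: e_ i).
  apply: (mulIf (lt0r_neq0 s0)); apply: (mulIf (lt0r_neq0 s0)).
  apply: etrans (esym E1) (etrans _ E2).
  have -> : x + s *: e_ j + s *: e_ i = x + s *: e_ i + s *: e_ j by rewrite addrAC.
  exact: subrBC.
have [_ H1] := sub _ (B1 _ _ (le_lt_trans as_ sd1) (le_lt_trans bs sd1)).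
have [H2 _] := sub _ (B2 _ _ (le_lt_trans as' sd2) (le_lt_trans bs' sd2)).
move=> Eq; rewrite Eq in H1.
rewrite (splitr e); apply: le_trans (ler_distD (partial i (partial j f) (x + a' *: e_ j + b' *: e_ i)) _ _) _.
rewrite distrC in H1; exact: (lerD (ltW H2) (ltW H1)).
Qed.

End schwarz.

Section flatness.
Context {R : realType} {n : nat}.
Local Notation E := 'rV[R]_n.
Local Notation e_ k := (delta_mx 0 k : E).
Variables (W : set E) (tau : 'I_n -> E -> R) (H : E -> 'M[R]_n).
Hypotheses (oW : open W) (stau : forall m, smooth_on W (tau m)).

Definition jac (x : E) : 'M[R]_n := \matrix_(i, m) partial i (tau m) x.

Hypotheses (HJ : forall x, W x -> H x = jac x *m (jac x)^T)
  (uJ : forall x, W x -> jac x \in unitmx).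

Local Notation D2 i j m := (partial i (partial j (tau m))).
Local Notation D3 l i j m := (partial l (partial i (partial j (tau m)))).
Local Notation B := (fun x => invmx (jac x)).

Let dtau k m y : W y -> derivable (tau m) y (e_ k).
Proof. by move=> Wy; have [_] := stau m [::] Wy; exact. Qed.

Let d2tau k l m y : W y -> derivable (partial k (tau m)) y (e_ l).
Proof. by move=> Wy; have [_] := stau m [:: k] Wy; exact. Qed.

Let d3tau k l p m y : W y -> derivable (D2 k l m) y (e_ p).
Proof. by move=> Wy; have [_] := stau m [:: k; l] Wy; exact. Qed.

Let D2C i j m x : W x -> D2 i j m x = D2 j i m x.
Proof.
move=> Wx; apply: (@schwarz R n W (tau m) i j x oW Wx) => [k y|k l y|k l y] Wy.
- exact: dtau.
- exact: d2tau.
- by have [] := stau m [:: k; l] Wy.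
Qed.

Let D3C k i j m x : W x -> D3 k i j m x = D3 j i k m x.
Proof.
move=> Wx.
have -> : D3 k i j m x = D3 k j i m x by apply: derive_on_open oW Wx _ => y; exact: D2C.
have -> : D3 j i k m x = D3 j k i m x by apply: derive_on_open oW Wx _ => y; exact: D2C.
apply: (@schwarz R n W (partial i (tau m)) k j x oW Wx) => [k' y|k' l y|k' l y] Wy.
- exact: d2tau.
- exact: d3tau.
- by have [] := stau m [:: k'; l; i] Wy.
Qed.

Let partial_metric l a b x : W x ->
  partial l (fun y => H y a b) x = \sum_m (D2 l a m x * jac x b m + jac x a m * D2 l b m x).
Proof.
move=> Wx; rewrite /partial (@derive_on_open _ _ W _
  (fun y => \sum_m (partial a (tau m) y * partial b (tau m) y)))//; last first.
  by move=> y Wy; rewrite HJ// mxE; apply: eq_bigr => m _; rewrite !mxE.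
rewrite (@derive_val _ _ _ _ _ _ _ (is_derive_sumr _ (fun m => is_derive_mulr
  (derivable_is_derive (@d2tau a l m x Wx)) (derivable_is_derive (@d2tau b l m x Wx))))).
by apply: eq_bigr => m _; rewrite !mxE.
Qed.

(** H^-1 J = (J J^T)^-1 J = (J^T)^-1. *)
Let inv_metric_jac x k m : W x -> \sum_l inv_metric H x k l * jac x l m = B x m k.
Proof.
move=> Wx; have u := uJ Wx; have ut : (jac x)^T \in unitmx by rewrite unitmx_tr.
have -> : \sum_l inv_metric H x k l * jac x l m = (inv_metric H x *m jac x) k m by rewrite mxE.
have -> : inv_metric H x *m jac x = (B x)^T.
  rewrite /inv_metric HJ// trmx_inv -[LHS]mulmx1 -(mulmxV ut) mulmxA -(mulmxA _ (jac x)).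
  by rewrite mulVmx ?mul1mx// unitmx_mul u.
by rewrite mxE.
Qed.

(** In a flat metric the Christoffel symbols are the coefficients of dJ J^-1,
   where J is the differential of an isometry to Euclidean space. *)
Lemma flat_christoffel k i j x : W x -> christoffel H k i j x = \sum_m D2 i j m x * B x m k.
Proof.
move=> Wx; rewrite /christoffel.
have -> : \sum_l inv_metric H x k l *
    (partial i (fun y => H y j l) x + partial j (fun y => H y i l) x
     - partial l (fun y => H y i j) x) =
    \sum_l \sum_m 2 * (D2 i j m x * (inv_metric H x k l * jac x l m)).
  apply: eq_bigr => l _; rewrite !partial_metric// -big_split -sumrB mulr_sumr.
  apply: eq_bigr => m _ /=.
  rewrite (@D2C j i m x Wx) (@D2C l i m x Wx) (@D2C l j m x Wx).
  move: (D2 i j m x) (D2 i l m x) (D2 j l m x) (jac x _ _) (jac x _ _) (jac x _ _) => p q r a b c.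
  by ring.
rewrite exchange_big mulr_sumr; apply: eq_bigr => m _ /=.
by rewrite -mulr_sumr mulKf ?pnatr_eq0// -mulr_sumr inv_metric_jac.
Qed.

(** The second sum is the derivative of J^-1, rewritten with Christoffel symbols. *)
Let partial_christoffel l k i j x : W x -> partial l (christoffel H k i j) x =
  \sum_m D3 l i j m x * B x m k - \sum_a christoffel H a i j x * christoffel H k l a x.
Proof.
move=> Wx; rewrite /partial (@derive_on_open _ _ W _
  (fun y => \sum_m (D2 i j m y * B y m k)))//; last by move=> y Wy; exact: flat_christoffel.
have dJ a b : is_derive x (e_ l) (fun y => jac y a b) (D2 l a b x).
  rewrite (_ : (fun y => _) = partial a (tau b)); last by apply/funext => y; rewrite mxE.
  exact: derivable_is_derive (@d2tau a l b x Wx).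
have dB m := is_derive_invmx dJ (uJ Wx) m k.
rewrite (@derive_val _ _ _ _ _ _ _ (is_derive_sumr _ (fun m => is_derive_mulr
  (derivable_is_derive (@d3tau i j l m x Wx)) (dB m)))).
rewrite big_split /=; congr (_ + _).
under [in RHS]eq_bigr do rewrite !flat_christoffel//.
rewrite -sumrN.
under eq_bigr do rewrite mulrN mulr_sumr -sumrN.
rewrite exchange_big; apply: eq_bigr => a _ /=.
rewrite big_distrl -sumrN; apply: eq_bigr => m _ /=; congr (- _).
rewrite !mulr_sumr; apply: eq_bigr => b _; exact: mulr4AC.
Qed.

(** In the difference of two derivatives of Christoffel symbols the third derivatives
    cancel by symmetry, and what remains cancels with the quadratic terms. *)
Lemma flat_ricci i j x : W x -> ricci H i j x = 0.
Proof.
move=> Wx; rewrite /ricci -big_split big1// => k _ /=.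
rewrite !partial_christoffel// sumrB.
apply: cancel_pairs.
- by apply: eq_bigr => m _; rewrite (@D3C k i j m x Wx).
- by apply: eq_bigr => a _; exact: mulrC.
- by apply: eq_bigr => a _; exact: mulrC.
Qed.

End flatness.

(** * Positive forms and contractions in a frame *)

Section positive_forms.
Context {R : realType} {n : nat}.
Implicit Types (A G H : 'M[R]_n) (w y z : 'rV[R]_n).

Lemma inner_product_ge0 A w : inner_product A -> 0 <= quad A w.
Proof.
move=> [_ A0]; have [->|w0] := eqVneq w 0; first by rewrite /quad !mul0mx mxE.
exact: ltW (A0 w w0).
Qed.

Lemma inner_product_unit A : inner_product A -> A \in unitmx.
Proof.
move=> [_ A0]; rewrite -row_free_unit -kermx_eq0; apply/negPn/negP => /rowV0Pn[w /sub_kermxP wA w0].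
by have := A0 w w0; rewrite /quad wA mul0mx mxE ltxx.
Qed.

Lemma quad_delta A i : quad A (delta_mx 0 i) = A i i.
Proof. by rewrite /quad -rowE trmx_delta -colE !mxE. Qed.

Lemma quad_shift A w y (c : R) : quad A (w + c *: y) =
  quad A w + c * ((w *m A *m y^T) 0 0 + (y *m A *m w^T) 0 0) + c ^+ 2 * quad A y.
Proof.
rewrite /quad linearD linearZ /= !mulmxDl !mulmxDr -!scalemxAl -!scalemxAr.
rewrite !mxE; ring.
Qed.

(** Inversion reverses the order of positive definite forms: expand the
   nonnegative number H(y - C z) for y = w G^-1 and z = w H^-1. *)
Lemma inv_quad_le H G (C : R) : inner_product H -> inner_product G -> 0 < C ->
  (forall w, quad H w <= C * quad G w) ->
  forall w, quad (invmx G) w <= C * quad (invmx H) w.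
Proof.
move=> iH iG C0 HG w.
have uH := inner_product_unit iH; have uG := inner_product_unit iG.
have [sH _] := iH; have [sG _] := iG.
have siH : (invmx H)^T = invmx H by rewrite trmx_inv sH.
have siG : (invmx G)^T = invmx G by rewrite trmx_inv sG.
pose y := w *m invmx G; pose z := w *m invmx H.
(* This choice makes both cross terms equal to G^-1(w). *)
have := inner_product_ge0 (y + (- C) *: z) iH; rewrite quad_shift.
have -> : y *m H *m z^T = w *m invmx G *m w^T.
  by rewrite /z trmx_mul siH -!mulmxA (mulmxA H) mulmxV// mul1mx mulmxA.
have -> : z *m H *m y^T = w *m invmx G *m w^T.
  by rewrite /z /y trmx_mul siG -(mulmxA w) mulVmx// mulmx1 mulmxA.
have -> : quad H z = quad (invmx H) w.
  by rewrite /quad /z trmx_mul siH -(mulmxA w) mulVmx// mulmx1 mulmxA.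
have := HG y.
have -> : quad G y = quad (invmx G) w.
  by rewrite /quad /y trmx_mul siG -(mulmxA w) mulVmx// mulmx1 mulmxA.
rewrite -/(quad (invmx G) w); set p := quad (invmx G) w; set q := quad (invmx H) w.
set s := quad H y => H1 H2.
have : C * p <= C * (C * q) by nra.
by rewrite ler_pM2l.
Qed.

(** Evaluate the form on the sum and on the difference of two basis vectors. *)
Lemma psd_entry A (c : R) : A^T = A -> (forall w, 0 <= quad A w) ->
  (forall i, A i i <= c) -> forall i j, `|A i j| <= c.
Proof.
move=> sA A0 Ac i j.
have E (s : R) : quad A (delta_mx 0 i + s *: delta_mx 0 j) = A i i + s * (A i j *+ 2) + s ^+ 2 * A j j.
  rewrite quad_shift !quad_delta -!rowE !trmx_delta -!colE !mxE.
  have -> : A j i = A i j by rewrite -{1}sA mxE.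
  by rewrite mulr2n.
have H1 := A0 (delta_mx 0 i + 1 *: delta_mx 0 j); have H2 := A0 (delta_mx 0 i + (-1) *: delta_mx 0 j).
rewrite E mulr2n in H1; rewrite E mulr2n in H2.
have H3 := Ac i; have H4 := Ac j.
by rewrite ler_norml; apply/andP; split; lra.
Qed.

End positive_forms.

Section sums.
Context {R : realType} {I : finType}.

Lemma sum_nested4 (F : I -> I -> I -> I -> R) : \sum_i \sum_j \sum_k \sum_l F i j k l =
  \sum_(p : (I * I) * (I * I)) F p.1.1 p.1.2 p.2.1 p.2.2.
Proof.
rewrite pair_bigA /= -(pair_bigA _ (fun p q : I * I => F p.1 p.2 q.1 q.2)) /=.
by apply: eq_bigr => p _; rewrite pair_bigA.
Qed.

Lemma sum_nested6 (F : I -> I -> I -> I -> I -> I -> R) :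
  \sum_i \sum_j \sum_k \sum_l \sum_u \sum_v F i j k l u v =
  \sum_(p : ((I * I) * (I * I)) * (I * I)) F p.1.1.1 p.1.1.2 p.1.2.1 p.1.2.2 p.2.1 p.2.2.
Proof.
rewrite (sum_nested4 (fun i j k l => \sum_u \sum_v F i j k l u v)).
rewrite -(pair_bigA _ (fun (p : (I * I) * (I * I)) (q : I * I) =>
  F p.1.1 p.1.2 p.2.1 p.2.2 q.1 q.2)) /=.
by apply: eq_bigr => p _; rewrite pair_bigA.
Qed.

Lemma sum_pairs2 (J : finType) (f g : J -> R) :
  \sum_(p : J * J) f p.1 * g p.2 = (\sum_i f i) * \sum_i g i.
Proof.
rewrite big_distrl; rewrite -(pair_bigA _ (fun i j => f i * g j)) /=.
by apply: eq_bigr => i _; rewrite big_distrr.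
Qed.

Lemma sum_pairs3 (J : finType) (f g h : J -> R) :
  \sum_(p : (J * J) * J) f p.1.1 * g p.1.2 * h p.2 = (\sum_i f i) * (\sum_i g i) * \sum_i h i.
Proof.
rewrite -sum_pairs2 big_distrl.
rewrite -(pair_bigA _ (fun (p : J * J) k => f p.1 * g p.2 * h k)) /=.
by apply: eq_bigr => p _; rewrite big_distrr.
Qed.

(** A contraction of two tensors which are linear combinations of the elements
   of a frame is determined by its values on the frame. *)
Lemma bilinear_frame (L TX TY SX SY : finType) (coef : L -> R) (alpha : L -> SX) (beta : L -> SY)
    (X : SX -> R) (X' : TX -> R) (eX : TX -> SX -> R) (Y : SY -> R) (Y' : TY -> R) (eY : TY -> SY -> R) :
  (forall i, X i = \sum_t X' t * eX t i) -> (forall i, Y i = \sum_t Y' t * eY t i) ->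
  \sum_(l : L) coef l * (X (alpha l) * Y (beta l)) =
  \sum_t \sum_s X' t * Y' s * \sum_(l : L) coef l * (eX t (alpha l) * eY s (beta l)).
Proof.
move=> HX HY.
under eq_bigr do rewrite HX HY big_distrlr big_distrr.
rewrite exchange_big; apply: eq_bigr => t _.
under eq_bigr do rewrite big_distrr.
rewrite exchange_big; apply: eq_bigr => s _.
rewrite big_distrr; apply: eq_bigr => l _ /=.
move: (coef l) (X' t) (Y' s) (eX _ _) (eY _ _) => a b c d e; ring.
Qed.

Lemma ler_sum_const (T : finType) (f : T -> R) (c : R) : (forall t, `|f t| <= c) ->
  `|\sum_t f t| <= #|T|%:R * c.
Proof.
move=> fc; apply: le_trans (ler_norm_sum _ _ _) _.
by rewrite mulr_natl -sumr_const; apply: ler_sum.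
Qed.

Lemma bilinear_bound (TX TY : finType) (X' : TX -> R) (Y' : TY -> R) (c : TX -> TY -> R) (NX NY C : R) :
  (forall t, `|X' t| <= NX) -> (forall t, `|Y' t| <= NY) -> (forall t s, `|c t s| <= C) ->
  `|\sum_t \sum_s X' t * Y' s * c t s| <= #|TX|%:R * (#|TY|%:R * (NX * NY * C)).
Proof.
move=> HX HY Hc; apply: ler_sum_const => t; apply: ler_sum_const => s.
by rewrite !normrM ler_pM// ?mulr_ge0// ler_pM.
Qed.

End sums.

Section frames.
Context {R : realType} {n : nat}.
Local Notation I := 'I_n.
Variables (J : 'M[R]_n).
Hypothesis uJ : J \in unitmx.
Local Notation B := (invmx J).
Local Notation T2 := (I * I)%type.
Local Notation T3 := (I * I * I)%type.
Local Notation L4 := (T2 * T2)%type.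
Local Notation L6 := (T2 * T2 * T2)%type.

Lemma JB i j : \sum_k J i k * B k j = (i == j)%:R.
Proof. by have := mulmxV uJ => /matrixP/(_ i j); rewrite !mxE. Qed.

(** The columns of J form a frame, b1 is the dual one, and products of them give the
    frame and the coframe for tensors of rank 2 and 3. Multi-indices are tuples, so
    that one sum replaces several nested ones. *)
Definition e1 (t i : I) : R := J i t.
Definition e3 (t i : T3) : R := J i.1.1 t.1.1 * J i.1.2 t.1.2 * J i.2 t.2.
Definition b1 (t i : I) : R := B t i.
Definition b2 (t i : T2) : R := B t.1 i.1 * B t.2 i.2.
Definition b3 (t i : T3) : R := B t.1.1 i.1.1 * B t.1.2 i.1.2 * B t.2 i.2.

Lemma sum_dual (T : finType) (e b : T -> T -> R) (X : T -> R) :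
  (forall i j, \sum_t b t j * e t i = (i == j)%:R) ->
  forall i, X i = \sum_t (\sum_j b t j * X j) * e t i.
Proof.
move=> Hbe i; under eq_bigr do rewrite big_distrl.
rewrite exchange_big (bigD1 i)//= [X in _ + X]big1 ?addr0 => [|j ji].
  transitivity (X i * \sum_t b t i * e t i).
    by rewrite Hbe eqxx mulr1.
  rewrite big_distrr; apply: eq_bigr => t _ /=; move: (X i) (b t i) (e t i) => p q r; ring.
transitivity (X j * \sum_t b t j * e t i).
  rewrite big_distrr; apply: eq_bigr => t _ /=; move: (X j) (b t j) (e t i) => p q r; ring.
by rewrite Hbe eq_sym (negbTE ji) mulr0.
Qed.

Lemma dual1 i j : \sum_t b1 t j * e1 t i = (i == j)%:R.
Proof. by rewrite -JB; apply: eq_bigr => t _; rewrite mulrC. Qed.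

Lemma dual3 i j : \sum_t b3 t j * e3 t i = (i == j)%:R.
Proof.
case: i j => [[i1 i2] i3] [[j1 j2] j3].
transitivity (\sum_(p : T3) (J i1 p.1.1 * B p.1.1 j1) * (J i2 p.1.2 * B p.1.2 j2) * (J i3 p.2 * B p.2 j3)).
  apply: eq_bigr => t _; rewrite /b3 /e3 /=.
  move: (B _ _) (B _ _) (B _ _) (J _ _) (J _ _) (J _ _) => p q r s u v; ring.
rewrite (sum_pairs3 (fun k => J i1 k * B k j1) (fun k => J i2 k * B k j2)
  (fun k => J i3 k * B k j3)) !JB.
by rewrite -!natrM !mulnb.
Qed.

Definition fr1 (X : I -> R) (t : I) : R := \sum_j b1 t j * X j.
Definition fr2 (X : T2 -> R) (t : T2) : R := \sum_j b2 t j * X j.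
Definition fr3 (X : T3 -> R) (t : T3) : R := \sum_j b3 t j * X j.

Lemma fr1E X i : X i = \sum_t fr1 X t * e1 t i. Proof. exact: sum_dual dual1 i. Qed.
Lemma fr3E X i : X i = \sum_t fr3 X t * e3 t i. Proof. exact: sum_dual dual3 i. Qed.

Definition frP (P : 'M[R]_n) : 'M[R]_n := J^T *m P *m J.

Lemma frPE (P : 'M[R]_n) (a b : I) :
  \sum_(p : T2) P p.1 p.2 * (J p.1 a * J p.2 b) = frP P a b.
Proof.
rewrite /frP mxE -(pair_bigA _ (fun i j => P i j * (J i a * J j b))) /= exchange_big.
apply: eq_bigr => j _ /=; rewrite mxE big_distrl; apply: eq_bigr => i _ /=.
rewrite mxE; move: (P i j) (J i a) (J j b) => p q r; ring.
Qed.

Lemma contraction4 (P Q : 'M[R]_n) (a b c d : I) :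
  \sum_(l : L4) (P l.1.1 l.1.2 * Q l.2.1 l.2.2) *
    ((J l.1.1 a * J l.1.2 b) * (J l.2.1 c * J l.2.2 d)) = frP P a b * frP Q c d.
Proof.
rewrite -!frPE -(sum_pairs2 (fun p : T2 => P p.1 p.2 * (J p.1 a * J p.2 b))
  (fun p : T2 => Q p.1 p.2 * (J p.1 c * J p.2 d))).
by apply: eq_bigr => l _; rewrite mulrACA.
Qed.

Lemma contraction6 (P : 'M[R]_n) (a b c d e f : I) :
  \sum_(l : L6) (P l.1.1.1 l.1.1.2 * P l.1.2.1 l.1.2.2 * P l.2.1 l.2.2) *
    ((J l.1.1.1 a * J l.1.1.2 b) * (J l.1.2.1 c * J l.1.2.2 d) * (J l.2.1 e * J l.2.2 f)) =
  frP P a b * frP P c d * frP P e f.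
Proof.
rewrite -!frPE -(sum_pairs3 (fun p : T2 => P p.1 p.2 * (J p.1 a * J p.2 b))
  (fun p : T2 => P p.1 p.2 * (J p.1 c * J p.2 d)) (fun p : T2 => P p.1 p.2 * (J p.1 e * J p.2 f))).
by apply: eq_bigr => l _; rewrite mulrACA; congr (_ * _); rewrite mulrACA.
Qed.

(** A triple contraction with one matrix P of two tensors of rank 3. The six indices
    are grouped in pairs, the pairs contracted with P; alpha and beta select which of
    them are indices of X and of Y. All the quadratic terms have this shape. *)
Definition contract6 (P : 'M[R]_n) (alpha beta : L6 -> T3) (X Y : T3 -> R) : R :=
  \sum_(l : L6) (P l.1.1.1 l.1.1.2 * P l.1.2.1 l.1.2.2 * P l.2.1 l.2.2) *
    (X (alpha l) * Y (beta l)).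

(** gamma is the inverse of the pair (alpha, beta), which distributes the six
   indices over the two tensors. *)
Lemma contract6E (P : 'M[R]_n) (alpha beta : L6 -> T3) (gamma : T3 -> T3 -> L6) (X Y : T3 -> R) :
  (forall t s l, e3 t (alpha l) * e3 s (beta l) =
     (J l.1.1.1 (gamma t s).1.1.1 * J l.1.1.2 (gamma t s).1.1.2) *
     (J l.1.2.1 (gamma t s).1.2.1 * J l.1.2.2 (gamma t s).1.2.2) *
     (J l.2.1 (gamma t s).2.1 * J l.2.2 (gamma t s).2.2)) ->
  contract6 P alpha beta X Y = \sum_t \sum_s fr3 X t * fr3 Y s *
    (frP P (gamma t s).1.1.1 (gamma t s).1.1.2 * frP P (gamma t s).1.2.1 (gamma t s).1.2.2 *
     frP P (gamma t s).2.1 (gamma t s).2.2).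
Proof.
move=> H; rewrite /contract6 (bilinear_frame _ _ _ (fr3E X) (fr3E Y)).
apply: eq_bigr => t _; apply: eq_bigr => s _; congr (_ * _).
by rewrite -contraction6; apply: eq_bigr => l _; rewrite H.
Qed.

(** In the frame the contraction is a sum of bounded terms, and their number depends on
    the dimension only. *)
Lemma contract6_bound (P : 'M[R]_n) (alpha beta : L6 -> T3) (gamma : T3 -> T3 -> L6)
    (X Y : T3 -> R) (C NX NY : R) :
  (forall t s l, e3 t (alpha l) * e3 s (beta l) =
     (J l.1.1.1 (gamma t s).1.1.1 * J l.1.1.2 (gamma t s).1.1.2) *
     (J l.1.2.1 (gamma t s).1.2.1 * J l.1.2.2 (gamma t s).1.2.2) *
     (J l.2.1 (gamma t s).2.1 * J l.2.2 (gamma t s).2.2)) ->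
  (forall i j, `|frP P i j| <= C) -> (forall t, `|fr3 X t| <= NX) -> (forall t, `|fr3 Y t| <= NY) ->
  `|contract6 P alpha beta X Y| <= #|{: T3}|%:R * (#|{: T3}|%:R * (NX * NY * (C * C * C))).
Proof.
move=> H PC HX HY; rewrite (contract6E _ _ _ H); apply: bilinear_bound => // t s.
by rewrite !normrM !ler_pM// mulr_ge0.
Qed.

End frames.

(** * Norms in an orthonormal frame and the quadratic estimate *)

Section nested_sums.
Context {R : realType} {I : finType}.

Lemma sum_nested3 (F : I -> I -> I -> R) :
  \sum_i \sum_j \sum_k F i j k = \sum_(t : I * I * I) F t.1.1 t.1.2 t.2.
Proof. by rewrite pair_bigA /= (pair_bigA _ (fun (p : I * I) k => F p.1 p.2 k)). Qed.

Lemma sum_square (T : finType) (b : T -> T -> R) (X : T -> R) :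
  \sum_t \sum_s (\sum_u b u t * b u s) * X t * X s = \sum_u (\sum_t b u t * X t) ^+ 2.
Proof.
transitivity (\sum_t \sum_s \sum_u (b u t * X t) * (b u s * X s)).
  apply: eq_bigr => t _; apply: eq_bigr => s _; rewrite -mulrA big_distrl.
  by apply: eq_bigr => u _; rewrite mulrACA.
under eq_bigr do rewrite exchange_big.
by rewrite exchange_big; apply: eq_bigr => u _; rewrite expr2 big_distrlr.
Qed.

Lemma sum_product_pair (p : R) (f g : I -> I -> R) :
  \sum_v p * ((\sum_l f v l) * \sum_m g v m) = \sum_l \sum_v \sum_m p * (f v l * g v m).
Proof.
rewrite exchange_big; apply: eq_bigr => v _; rewrite big_distrlr big_distrr.
by apply: eq_bigr => l _; rewrite big_distrr.
Qed.

Lemma sum_product_move (f : I -> I -> I -> I -> R) (g : I -> I -> I -> R) :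
  \sum_j \sum_v (\sum_a \sum_b f j v a b) * (\sum_l g j v l) =
  \sum_a \sum_b \sum_j \sum_v \sum_l f j v a b * g j v l.
Proof.
transitivity (\sum_j \sum_v \sum_a \sum_b \sum_l f j v a b * g j v l).
  apply: eq_bigr => j _; apply: eq_bigr => v _; rewrite big_distrl; apply: eq_bigr => a _.
  by rewrite big_distrl; apply: eq_bigr => b _; rewrite big_distrr.
under eq_bigr do rewrite exchange_big.
rewrite exchange_big; apply: eq_bigr => a _ /=.
under eq_bigr do rewrite exchange_big.
by rewrite exchange_big.
Qed.

End nested_sums.

Section frame_norms.
Context {R : realType} {n : nat}.
Local Notation I := 'I_n.
Local Notation E := 'rV[R]_n.
Local Notation T3 := (I * I * I)%type.
Local Notation L6 := (I * I * (I * I) * (I * I))%type.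
Local Notation L4 := (I * I * (I * I))%type.
Variables (J : 'M[R]_n).
Hypothesis uJ : J \in unitmx.
Local Notation B := (invmx J).
Local Notation Q := (invmx (J *m J^T)).

Lemma inv_frame : Q = B^T *m B.
Proof.
have ut : J^T \in unitmx by rewrite unitmx_tr.
have uQ : J *m J^T \in unitmx by rewrite unitmx_mul uJ.
apply: (can_inj (mulmxK uQ)); rewrite mulVmx// -mulmxA (mulmxA B) mulVmx// mul1mx.
by rewrite -trmx_mul mulmxV// trmx1.
Qed.

Lemma inv_frameE i j : Q i j = \sum_u B u i * B u j.
Proof. by rewrite inv_frame mxE; apply: eq_bigr => u _; rewrite mxE. Qed.

(** The frame is orthonormal: the inverse metric has the identity matrix as its
    components. *)
Lemma frP_inv : frP J Q = 1%:M.
Proof.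
rewrite /frP inv_frame mulmxA -trmx_mul mulVmx// trmx1 mul1mx.
by rewrite mulVmx.
Qed.

Lemma norm_le_sqrt (T : finType) (f : T -> R) t : `|f t| <= Num.sqrt (\sum_s f s ^+ 2).
Proof.
rewrite -sqrtr_sqr; apply: ler_wsqrtr; rewrite (bigD1 t)//= lerDl.
by apply: sumr_ge0 => s _; exact: sqr_ge0.
Qed.

Variables (H : E -> 'M[R]_n) (x : E).
Hypothesis HJ : H x = J *m J^T.

(** In the frame the squared norm is the sum of the squares of the components. *)
Lemma frame_norm03 (V : I -> I -> I -> E -> R) t :
  `|fr3 J (fun t => V t.1.1 t.1.2 t.2 x) t| <= norm03 H V x.
Proof.
apply: le_trans (norm_le_sqrt _ t) _; apply: ler_wsqrtr; rewrite le_eqVlt; apply/orP; left; apply/eqP.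
rewrite /fr3 -sum_square /inv_metric HJ.
rewrite [RHS](eq_bigr (fun i => \sum_j \sum_k \sum_(s : T3) Q i s.1.1 * Q j s.1.2 * Q k s.2
    * V i j k x * V s.1.1 s.1.2 s.2 x)); last first.
  move=> i _; apply: eq_bigr => j _; apply: eq_bigr => k _.
  by rewrite (sum_nested3 (fun a b c => Q i a * Q j b * Q k c * V i j k x * V a b c x)).
rewrite [RHS](sum_nested3 (fun i j k => \sum_(s : T3) Q i s.1.1 * Q j s.1.2 * Q k s.2
    * V i j k x * V s.1.1 s.1.2 s.2 x)).
apply: eq_bigr => p _; apply: eq_bigr => s _; congr (_ * _ * _).
rewrite !inv_frameE -(sum_pairs3 (fun u => B u p.1.1 * B u s.1.1) (fun u => B u p.1.2 * B u s.1.2)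
  (fun u => B u p.2 * B u s.2)).
apply: eq_bigr => u _; rewrite /b3.
move: (B _ _) (B _ _) (B _ _) (B _ _) (B _ _) (B _ _) => b1 b2 b3 b4 b5 b6; ring.
Qed.

Lemma frame_norm02 (T : E -> 'M[R]_n) a b : `|(B *m T x *m B^T) a b| <= norm02 H T x.
Proof.
have -> : (B *m T x *m B^T) a b = fr2 J (fun t => T x t.1 t.2) (a, b).
  rewrite mxE /fr2 -(pair_bigA _ (fun i j => b2 J (a, b) (i, j) * T x i j)) /= exchange_big.
  apply: eq_bigr => j _; rewrite mxE big_distrl; apply: eq_bigr => i _; rewrite mxE /b2 /=.
  move: (B _ _) (B _ _) (T x i j) => p q r; ring.
apply: le_trans (norm_le_sqrt _ (a, b)) _; apply: ler_wsqrtr.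
rewrite le_eqVlt; apply/orP; left; apply/eqP.
rewrite /fr2 -sum_square /inv_metric HJ.
rewrite [RHS](sum_nested4 (fun i j k l => Q i k * Q j l * T x i j * T x k l)).
rewrite -(pair_bigA _ (fun p q : I * I => Q p.1 q.1 * Q p.2 q.2 * T x p.1 p.2 * T x q.1 q.2)) /=.
apply: eq_bigr => p _; apply: eq_bigr => s _; congr (_ * _ * _).
rewrite !inv_frameE -(sum_pairs2 (fun u => B u p.1 * B u s.1) (fun u => B u p.2 * B u s.2)).
by apply: eq_bigr => u _; rewrite /b2 mulrACA.
Qed.

Lemma frame_grad_norm (phi : E -> R) t :
  `|fr1 J (fun i => partial i phi x) t| <= grad_norm H phi x.
Proof.
apply: le_trans (norm_le_sqrt _ t) _; apply: ler_wsqrtr; rewrite le_eqVlt; apply/orP; left; apply/eqP.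
rewrite /fr1 -sum_square /inv_metric HJ.
apply: eq_bigr => p _; apply: eq_bigr => s _; congr (_ * _ * _).
by rewrite inv_frameE.
Qed.

End frame_norms.

Section quadratic_bound.
Context {R : realType} {n : nat}.
Local Notation I := 'I_n.
Local Notation T3 := (I * I * I)%type.
Local Notation L6 := (I * I * (I * I) * (I * I))%type.
Local Notation L4 := (I * I * (I * I))%type.
Variables (J : 'M[R]_n).
Hypothesis uJ : J \in unitmx.

(** Gamma with its upper index lowered by g. *)
Definition low_gamma (V : T3 -> R) (t : T3) : R :=
  2^-1 * (V t + V (t.1.2, t.1.1, t.2) - V (t.2, t.1.1, t.1.2)).

Lemma fr3_perm (V : T3 -> R) (sigma : T3 -> T3) t : injective sigma ->
  (forall t i, b3 J t i = b3 J (sigma t) (sigma i)) ->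
  fr3 J (fun i => V (sigma i)) t = fr3 J V (sigma t).
Proof.
move=> isig H; rewrite /fr3 [RHS](reindex_inj isig) /=.
by apply: eq_bigr => i _; rewrite H.
Qed.

Lemma fr3_low_gamma (V : T3 -> R) (N : R) : (forall t, `|fr3 J V t| <= N) ->
  forall t, `|fr3 J (low_gamma V) t| <= 2 * N.
Proof.
move=> HN t.
have -> : fr3 J (low_gamma V) t = 2^-1 * (fr3 J V t + fr3 J V (t.1.2, t.1.1, t.2)
    - fr3 J V (t.2, t.1.1, t.1.2)).
  rewrite -(@fr3_perm V (fun t => (t.1.2, t.1.1, t.2))); last 2 first.
  - by move=> [[a b] c] [[a' b'] c'] /= [-> -> ->].
  - by move=> u i; rewrite /b3 /= (mulrC (_ u.1.1 _)).
  rewrite -(@fr3_perm V (fun t => (t.2, t.1.1, t.1.2))); last 2 first.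
  - by move=> [[a b] c] [[a' b'] c'] /= [-> -> ->].
  - by move=> u i; rewrite /b3 /= mulrC mulrA.
  rewrite /fr3 -big_split -sumrB big_distrr; apply: eq_bigr => i _ /=; rewrite /low_gamma.
  move: (b3 _ _ _) (V _) (V _) (V _) => p q r s; ring.
have := HN t; have := HN (t.1.2, t.1.1, t.2); have := HN (t.2, t.1.1, t.1.2).
move: (fr3 J V _) (fr3 J V _) (fr3 J V _) => a b c H1 H2 H3.
rewrite normrM gtr0_norm ?invr_gt0// ler_pdivrMl//.
apply: le_trans (ler_normB _ _) _; apply: le_trans (lerD (ler_normD _ _) (lexx _)) _.
have N0 : 0 <= N by exact: le_trans (normr_ge0 _) H1.
by move: (`|a|) (`|b|) (`|c|) H1 H2 H3 => a' b' c' H1 H2 H3; lra.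
Qed.

Variables (P : 'M[R]_n) (V : T3 -> R).
Let L := low_gamma V.
Let Ga k i j : R := \sum_l P k l * L (i, j, l).
Let DP v i j : R := - \sum_a \sum_b P i a * V (v, a, b) * P b j.

(* The four quadratic terms, once Gamma and D g^-1 are expanded: the maps say at
   which of the six contracted indices the two tensors of rank 3 are taken. *)
Let t1 := contract6 P (fun l : L6 => (l.1.1.1, l.1.1.2, l.1.2.2)) (fun l => (l.2.1, l.1.2.1, l.2.2)) L L.
Let t2 := contract6 P (fun l : L6 => (l.2.1, l.1.1.1, l.1.2.2)) (fun l => (l.1.1.2, l.1.2.1, l.2.2)) L L.
Let t3 := contract6 P (fun l : L6 => (l.2.1, l.1.1.2, l.1.2.1)) (fun l => (l.1.1.1, l.1.2.2, l.2.2)) V L.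
Let t4 := contract6 P (fun l : L6 => (l.1.1.1, l.1.1.2, l.1.2.1)) (fun l => (l.2.1, l.1.2.2, l.2.2)) V L.

Let t1E : \sum_i \sum_j \sum_u \sum_v P i j * (Ga u i j * Ga v v u) = t1.
Proof.
rewrite /t1 /contract6 -(sum_nested6 (fun i j u l v m => (P i j * P u l * P v m) * (L (i, j, l) * L (v, u, m)))).
apply: eq_bigr => i _; apply: eq_bigr => j _; apply: eq_bigr => u _.
rewrite (sum_product_pair _ (fun v l => P u l * L (i, j, l)) (fun v m => P v m * L (v, u, m))).
apply: eq_bigr => l _; apply: eq_bigr => v _; apply: eq_bigr => m _.
by rewrite (mulrACA (P u l)) !mulrA.
Qed.

Let t2E : \sum_i \sum_j \sum_u \sum_v P i j * (Ga u v i * Ga v j u) = t2.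
Proof.
rewrite /t2 /contract6 -(sum_nested6 (fun i j u l v m => (P i j * P u l * P v m) * (L (v, i, l) * L (j, u, m)))).
apply: eq_bigr => i _; apply: eq_bigr => j _; apply: eq_bigr => u _.
rewrite (sum_product_pair _ (fun v l => P u l * L (v, i, l)) (fun v m => P v m * L (j, u, m))).
apply: eq_bigr => l _; apply: eq_bigr => v _; apply: eq_bigr => m _.
by rewrite (mulrACA (P u l)) !mulrA.
Qed.

Let t3E : \sum_i \sum_j \sum_v DP v i j * Ga v i j = - t3.
Proof.
rewrite /t3 /contract6 -(sum_nested6 (fun i a b j v l => (P i a * P b j * P v l) * (V (v, a, b) * L (i, j, l)))).
rewrite -sumrN; apply: eq_bigr => i _.
under eq_bigr do under eq_bigr do rewrite mulNr.
under eq_bigr do rewrite sumrN.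
rewrite sumrN; congr (- _).
rewrite (sum_product_move (fun j v a b => P i a * V (v, a, b) * P b j) (fun j v l => P v l * L (i, j, l))).
apply: eq_bigr => a _; apply: eq_bigr => b _; apply: eq_bigr => j _; apply: eq_bigr => v _.
by apply: eq_bigr => l _; rewrite (mulrAC (P i a)) mulrACA.
Qed.

Let t4E : \sum_i \sum_j \sum_v DP i i j * Ga v v j = - t4.
Proof.
rewrite /t4 /contract6 -(sum_nested6 (fun i a b j v l => (P i a * P b j * P v l) * (V (i, a, b) * L (v, j, l)))).
rewrite -sumrN; apply: eq_bigr => i _.
under eq_bigr do under eq_bigr do rewrite mulNr.
under eq_bigr do rewrite sumrN.
rewrite sumrN; congr (- _).
rewrite (sum_product_move (fun j v a b => P i a * V (i, a, b) * P b j) (fun j v l => P v l * L (v, j, l))).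
apply: eq_bigr => a _; apply: eq_bigr => b _; apply: eq_bigr => j _; apply: eq_bigr => v _.
by apply: eq_bigr => l _; rewrite (mulrAC (P i a)) mulrACA.
Qed.

(** Each of the four terms is a triple contraction of P with two tensors whose frame
    components are at most 2 N. The terms t1 and t2 contain two factors low_gamma and
    count 4 each, t3 and t4 contain one and count 2 each; whence the constant 12. *)
Lemma quadratic_bound (C N : R) : (forall i j, `|frP J P i j| <= C) -> (forall t, `|fr3 J V t| <= N) ->
  `|\sum_i \sum_j \sum_u \sum_v P i j * (Ga u i j * Ga v v u - Ga u v i * Ga v j u)
    - \sum_i \sum_j \sum_v DP v i j * Ga v i j + \sum_i \sum_j \sum_v DP i i j * Ga v v j| <=
  12 * (#|{: T3}|%:R * (#|{: T3}|%:R * (N * N * (C * C * C)))).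
Proof.
move=> PC VN; have LN := fr3_low_gamma VN.
have -> : \sum_i \sum_j \sum_u \sum_v P i j * (Ga u i j * Ga v v u - Ga u v i * Ga v j u) = t1 - t2.
  rewrite -t1E -t2E -sumrB; apply: eq_bigr => i _; rewrite -sumrB; apply: eq_bigr => j _.
  rewrite -sumrB; apply: eq_bigr => u _; rewrite -sumrB; apply: eq_bigr => v _.
  by rewrite mulrBr.
rewrite t3E t4E opprK.
have H1 : `|t1| <= #|{: T3}|%:R * (#|{: T3}|%:R * (2 * N * (2 * N) * (C * C * C))).
  apply: (contract6_bound uJ (gamma := fun t s => ((t.1.1, t.1.2), (s.1.2, t.2), (s.1.1, s.2)))) => //.
  move=> t s l; rewrite /e3 /=.
  move: (J _ _) (J _ _) (J _ _) (J _ _) (J _ _) (J _ _) => j1 j2 j3 j4 j5 j6; ring.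
have H2 : `|t2| <= #|{: T3}|%:R * (#|{: T3}|%:R * (2 * N * (2 * N) * (C * C * C))).
  apply: (contract6_bound uJ (gamma := fun t s => ((t.1.2, s.1.1), (s.1.2, t.2), (t.1.1, s.2)))) => //.
  move=> t s l; rewrite /e3 /=.
  move: (J _ _) (J _ _) (J _ _) (J _ _) (J _ _) (J _ _) => j1 j2 j3 j4 j5 j6; ring.
have H3 : `|t3| <= #|{: T3}|%:R * (#|{: T3}|%:R * (N * (2 * N) * (C * C * C))).
  apply: (contract6_bound uJ (gamma := fun t s => ((s.1.1, t.1.2), (t.2, s.1.2), (t.1.1, s.2)))) => //.
  move=> t s l; rewrite /e3 /=.
  move: (J _ _) (J _ _) (J _ _) (J _ _) (J _ _) (J _ _) => j1 j2 j3 j4 j5 j6; ring.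
have H4 : `|t4| <= #|{: T3}|%:R * (#|{: T3}|%:R * (N * (2 * N) * (C * C * C))).
  apply: (contract6_bound uJ (gamma := fun t s => ((t.1.1, t.1.2), (t.2, s.1.2), (s.1.1, s.2)))) => //.
  move=> t s l; rewrite /e3 /=.
  move: (J _ _) (J _ _) (J _ _) (J _ _) (J _ _) (J _ _) => j1 j2 j3 j4 j5 j6; ring.
have tri (a b c d : R) : `|a - b + c - d| <= `|a| + `|b| + `|c| + `|d|.
  apply: le_trans (ler_normB _ _) _; rewrite lerD2r.
  by apply: le_trans (ler_normD _ _) _; rewrite lerD2r; exact: ler_normB.
apply: le_trans (tri _ _ _ _) _.
apply: le_trans (lerD (lerD (lerD H1 H2) H3) H4) _.
move: (#|_|%:R : R) => m; rewrite le_eqVlt; apply/orP; left; apply/eqP; ring.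
Qed.

End quadratic_bound.

(** * The inverse of a metric of low regularity in a chart *)

Lemma mulmx3E (S : pzRingType) (m : nat) (A M B : 'M[S]_m) i j :
  (A *m M *m B) i j = \sum_a \sum_b A i a * M a b * B b j.
Proof.
rewrite exchange_big mxE; apply: eq_bigr => b _.
by rewrite mxE big_distrl.
Qed.

Section pointwise_continuity.
Context {R : realType} {V : topologicalType}.

Lemma continuous_mulr (f g : V -> R) x : {for x, continuous f} -> {for x, continuous g} ->
  {for x, continuous (fun y => f y * g y)}.
Proof. by move=> cf cg; exact: cvgM cf cg. Qed.

Lemma continuous_sumr (I : Type) (s : seq I) (f : I -> V -> R) x :
  (forall i, {for x, continuous (f i)}) -> {for x, continuous (fun y => \sum_(i <- s) f i y)}.
Proof. by move=> cf; exact: (@cvg_sumr R V (nbhs x) _ I s f (fun i => f i x)) cf. Qed.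

End pointwise_continuity.

Section continuous_Lp.
Context {R : realType} {n : nat}.
Local Notation E := 'rV[R]_n.
Local Notation mE := (borel 'rV[R]_n).
Local Notation leb := (@lebesgue R n).
Variable U : set E.
Hypothesis oU : open U.

Lemma continuous_compact_bounded (u : E -> R) (Q : set E) :
  (forall x, Q x -> {for x, continuous u}) -> compact Q ->
  exists2 C : R, 0 <= C & forall x, Q x -> `|u x| <= C.
Proof.
move=> cu cQ; have cuQ : {within Q, continuous u}.
  by apply: continuous_in_subspaceT => x /set_mem; exact: cu.
have [M [_ MP]] := compact_bounded (continuous_compact cuQ cQ).
exists (`|M| + 1); first by rewrite addr_ge0.
move=> x Qx; apply: MP; last by exists x.
by rewrite ltr_pwDr// ler_norm.
Qed.

Lemma Lp_loc1_continuous (u : E -> R) : (forall x, U x -> {for x, continuous u}) -> Lp_loc 1 U u.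
Proof.
move=> cu; have mu : measurable_fun (U : set mE) (u : mE -> R).
  exact: continuous_measurable_borel.
apply: Lp_loc1_ae => // Q cQ QU.
have [C C0 uC] := continuous_compact_bounded (fun x Qx => cu x (QU x Qx)) cQ.
have mQ : measurable (Q : set mE) by exact: compact_measurable.
exists (fun x : mE => (u \_ Q) x); last by apply: aeW => x Qx; rewrite patchE mem_set.
apply: (@integrable_compact_bounded _ _ _ C) cQ _ _ _.
- have muQ : measurable_fun (Q : set mE) (u : mE -> R).
    by apply: measurable_funS mu => //; exact: open_measurable_borel.
  exact: ((measurable_restrictT (u : mE -> R) mQ).1 muQ).
- by move=> x; rewrite patchE; case: ifPn => [/set_mem/uC//|_]; rewrite normr0.
- by move=> x Qx; rewrite patchE memNset.
Qed.

Lemma Lp_loc1D (u w : E -> R) : Lp_loc 1 U u -> Lp_loc 1 U w -> Lp_loc 1 U (fun x => u x + w x).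
Proof.
move=> Lu Lw; apply: Lp_loc1_ae => //; first by apply: measurable_funD; [case: Lu|case: Lw].
move=> Q cQ QU; exists (fun x : mE => ((u : mE -> R) \_ Q) x + ((w : mE -> R) \_ Q) x).
  exact: (integrable_realD measurableT (Lp_loc1_integrable oU Lu cQ QU) (Lp_loc1_integrable oU Lw cQ QU)).
by apply: aeW => x Qx; rewrite !patchE mem_set.
Qed.

End continuous_Lp.

Section chart_metrics.
Context {R : realType} {n : nat}.
Local Notation E := 'rV[R]_n.
Local Notation mE := (borel 'rV[R]_n).
Local Notation leb := (@lebesgue R n).
Local Notation e_ k := (delta_mx 0 k : E).
Variables (U : set E) (H G : E -> 'M[R]_n).
Hypotheses (oU : open U) (sH : forall a b, smooth_on U (fun x => H x a b))
  (iH : forall x, U x -> inner_product (H x)).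

Local Notation T := (diff_metric H G).
Local Notation P := (inv_metric G).

Lemma cH a b x : U x -> {for x, continuous (fun y => H y a b)}.
Proof. by move=> Ux; have [] := sH a b [::] Ux. Qed.

Lemma dH a b k x : U x -> derivable (fun y => H y a b) x (e_ k).
Proof. by move=> Ux; have [_] := sH a b [::] Ux; exact. Qed.

Lemma cdH a b k x : U x -> {for x, continuous (partial k (fun y => H y a b))}.
Proof. by move=> Ux; have [] := sH a b [:: k] Ux. Qed.

Lemma cinvH a b x : U x -> {for x, continuous (fun y => inv_metric H y a b)}.
Proof.
move=> Ux; apply: (cvg_invmx (F := nbhs x) (A := H) (B := H x)).
  by move=> a' b'; exact: cH.
exact: inner_product_unit (iH Ux).
Qed.

Lemma continuous_christoffel k i j x : U x -> {for x, continuous (christoffel H k i j)}.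
Proof.
move=> Ux; apply: (@continuous_mulr _ _ (cst 2^-1)); first exact: cst_continuous.
apply: continuous_sumr => l; apply: continuous_mulr; first exact: cinvH.
exact: (continuousB (continuousD (@cdH j l i x Ux) (@cdH i l j x Ux)) (@cdH i j l x Ux)).
Qed.

(** The vanishing of Dh in coordinates: partial derivatives of h are expressed by
    Christoffel symbols. *)
Lemma metric_compatible k a b x : U x -> partial k (fun y => H y a b) x =
  \sum_l (christoffel H l k a x * H x l b + christoffel H l k b x * H x a l).
Proof.
move=> Ux; have uH := inner_product_unit (iH Ux); have [sHx _] := iH Ux.
have sym i j y : U y -> H y i j = H y j i.
  by move=> Uy; have [sHy _] := iH Uy; rewrite -{1}sHy mxE.
have psym k' i j : partial k' (fun y => H y i j) x = partial k' (fun y => H y j i) x.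
  by apply: derive_on_open oU Ux _ => y; exact: sym.
have siH i j : inv_metric H x i j = inv_metric H x j i.
  have : (inv_metric H x)^T = inv_metric H x by rewrite /inv_metric trmx_inv sHx.
  by move=> /matrixP/(_ j i); rewrite mxE.
have inv1 (f : 'I_n -> R) b' :
    \sum_l (2^-1 * \sum_m inv_metric H x l m * f m) * H x l b' = 2^-1 * f b'.
  transitivity (2^-1 * \sum_m f m * (inv_metric H x *m H x) m b').
    rewrite mulr_sumr; under eq_bigr do rewrite mulr_sumr big_distrl.
    rewrite exchange_big; apply: eq_bigr => m _ /=; rewrite mxE !mulr_sumr.
    apply: eq_bigr => l _; rewrite (siH l m).
    move: (inv_metric H x m l) (f m) (H x l b') => p q r; ring.
  rewrite mulVmx// (bigD1 b')//= mxE eqxx mulr1 big1 ?addr0// => m /negbTE mb.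
  by rewrite mxE mb mulr0.
rewrite big_split /=; under [X in _ + X]eq_bigr do rewrite (sym a)//.
rewrite !inv1 (psym k b a) (psym b k a) (psym a k b).
move: (partial k _ x) (partial a _ x) (partial b _ x) => p q r.
by field.
Qed.

Variable C : R.
Hypotheses (C0 : 0 < C)
  (mG : forall a b, measurable_fun (U : set mE) ((fun x => G x a b) : mE -> R))
  (mP : forall a b, measurable_fun (U : set mE) ((fun x => P x a b) : mE -> R))
  (aeG : \forall x \ae leb, U x -> inner_product (G x) /\
     forall w, C^-1 * quad (H x) w <= quad (G x) w <= C * quad (H x) w)
  (WT : forall a b, W1p_loc 2%:E U (fun x => T x a b)).

Lemma inv_metric_quad x : U x -> inner_product (G x) ->
  (forall w, C^-1 * quad (H x) w <= quad (G x) w <= C * quad (H x) w) ->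
  forall w, quad (P x) w <= C * quad (inv_metric H x) w.
Proof.
move=> Ux iG HG; apply: inv_quad_le => //; first exact: iH.
by move=> w; have /andP[] := HG w; rewrite mulrC ler_pdivrMr// mulrC.
Qed.

Lemma inv_inner_product (A : 'M[R]_n) : inner_product A -> (invmx A)^T = invmx A /\
  forall w, 0 <= quad (invmx A) w.
Proof.
move=> iA; have uA := inner_product_unit iA; have [sA _] := iA.
have siA : (invmx A)^T = invmx A by rewrite trmx_inv sA.
split => // w; have := inner_product_ge0 (w *m invmx A) iA.
by rewrite /quad trmx_mul siA -(mulmxA w) mulVmx// mulmx1 mulmxA.
Qed.

(** The comparison g >= h / C inverts to g^-1 <= C h^-1, and h^-1 is continuous; for a
    positive form, bounds for the diagonal are bounds for all the entries. *)
Lemma inv_metric_bounded (Q : set E) : compact Q -> Q `<=` U ->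
  exists D : R, \forall x \ae leb, Q x -> G x \in unitmx /\ forall i j, `|invmx (G x) i j| <= D.
Proof.
move=> cQ QU.
have [D D0 HD] : exists2 D : R, 0 <= D & forall x, Q x -> `|\sum_i inv_metric H x i i| <= D.
  apply: continuous_compact_bounded cQ => x Qx; apply: continuous_sumr => i.
  by apply: cinvH; exact: QU.
exists (C * D); apply: aeS aeG => x Hx Qx; have Ux := QU x Qx; have [iG HG] := Hx Ux.
split; first exact: inner_product_unit.
have [siG pG] := inv_inner_product iG; have [siH pH] := inv_inner_product (iH Ux).
apply: psd_entry => // i.
rewrite -quad_delta; apply: le_trans (inv_metric_quad Ux iG HG _) _.
rewrite ler_pM2l// quad_delta; apply: le_trans (HD x Qx).
apply: le_trans (ler_norm _); rewrite (bigD1 i)//= lerDl; apply: sumr_ge0 => j _.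
by rewrite -quad_delta; exact: pH.
Qed.

Lemma weak_partial_T k a b : is_weak_partial U k (fun x => T x a b) (weak_partial U k (fun x => T x a b)).
Proof. by have [_ /(_ k)[]] := WT a b. Qed.

(** Apply the rule for inverse matrices to g = h + e, the sum of a C^1 matrix and a
    weakly differentiable one. *)
Lemma weak_partial_inv_metric k i j :
  is_weak_partial U k (fun x => P x i j) (fun x => - \sum_a \sum_b invmx (G x) i a *
    (partial k (fun y => H y a b) x + weak_partial U k (fun y => T y a b) x) * invmx (G x) b j).
Proof.
have cdHU a b x : U x -> {for x, continuous (partial k (fun y => H y a b))} by exact: cdH.
have LwT a b : Lp_loc 1 U (weak_partial U k (fun y => T y a b)) by have [] := weak_partial_T k a b.
apply: (weak_partial_inverse oU mG mP inv_metric_bounded (z := fun a b x =>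
  partial k (fun y => H y a b) x + weak_partial U k (fun y => T y a b) x)) => [a b|a b S cS SU].
  apply: Lp_loc1D; [exact: oU| |exact: LwT].
  apply: Lp_loc1_continuous; [exact: oU|exact: cdHU].
have -> : (fun x => G x a b) = (fun x => H x a b + T x a b).
  by apply/funext => x; rewrite /diff_metric !mxE addrCA subrr addr0.
have mT : measurable_fun (U : set mE) ((fun x => T x a b) : mE -> R).
  by have [[]] := weak_partial_T k a b.
apply: L1_incrementD => //.
- by apply: continuous_measurable_borel => // x; exact: cH.
- by apply: continuous_measurable_borel; [exact: oU|exact: cdHU].
- by have [] := LwT a b.
- apply: L1_increment_C1 => // x Ux; first exact: cH.
  by split; [exact: dH|exact: cdH].
- by apply: L1_increment_weak => //; exact: weak_partial_T.
Qed.

(** D g^-1 = - g^-1 (D e) g^-1, since D h = 0. *)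
Lemma cov_deriv_inv_metric : \forall x \ae leb, U x -> forall k i j,
  cov_deriv20 U H P k i j x = - \sum_a \sum_b P x i a * De U H G k a b x * P x b j.
Proof.
have aeW3 : \forall x \ae leb, forall (kij : 'I_n * 'I_n * 'I_n), U x ->
    weak_partial U kij.1.1 (fun y => P y kij.1.2 kij.2) x =
    - \sum_a \sum_b invmx (G x) kij.1.2 a * (partial kij.1.1 (fun y => H y a b) x +
      weak_partial U kij.1.1 (fun y => T y a b) x) * invmx (G x) b kij.2.
  apply: filter_forall => -[[k i] j] /=.
  have Hw := weak_partial_inv_metric k i j.
  exact: (@weak_partial_unique R n U k oU _ _ _ (weak_partialP Hw) Hw).
apply: aeS2 aeW3 aeG => x Hw HG Ux k i j.
have [iG _] := HG Ux; have uG := inner_product_unit iG.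
rewrite /cov_deriv20 (Hw (k, i, j) Ux) /=.
pose Gm : 'M[R]_n := \matrix_(a, l) christoffel H l k a x.
pose V : 'M[R]_n := \matrix_(a, b) De U H G k a b x.
have VE a b : partial k (fun y => H y a b) x + weak_partial U k (fun y => T y a b) x =
    (V + (Gm *m G x + G x *m Gm^T)) a b.
  rewrite !mxE metric_compatible// /De /cov_deriv02 -big_split /=.
  rewrite [LHS]addrC -[RHS]addrA; congr (_ + _); rewrite -sumrN -big_split; apply: eq_bigr => l _ /=.
  rewrite !mxE; move: (christoffel _ _ _ _ _) (christoffel _ _ _ _ _) => p q.
  move: (H x l b) (H x a l) (G x l b) (G x a l) => r s t u; ring.
under eq_bigr do under eq_bigr do rewrite VE.
have -> : \sum_a \sum_b P x i a * De U H G k a b x * P x b j = (P x *m V *m P x) i j.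
  by rewrite mulmx3E; apply: eq_bigr => a _; apply: eq_bigr => b _; rewrite mxE.
rewrite -mulmx3E.
have -> : \sum_l (christoffel H i k l x * P x l j + christoffel H j k l x * P x i l) =
    (Gm^T *m P x + P x *m Gm) i j.
  rewrite !mxE -big_split; apply: eq_bigr => l _ /=; rewrite !mxE.
  by rewrite (mulrC (P x i l)).
have -> : invmx (G x) *m (V + (Gm *m G x + G x *m Gm^T)) *m invmx (G x) =
    P x *m V *m P x + (Gm^T *m P x + P x *m Gm).
  rewrite !mulmxDr !mulmxDl /inv_metric; congr (_ + _).
  by rewrite addrC !mulmxA mulVmx// mul1mx -!mulmxA mulmxV// mulmx1.
rewrite [in X in - X]mxE opprD -addrA addNr addr0.
by [].
Qed.

End chart_metrics.

(** * Measurability and pointwise estimates in a chart *)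

Section chart_measurability.
Context {R : realType} {n : nat}.
Local Notation E := 'rV[R]_n.
Local Notation mE := (borel 'rV[R]_n).
Local Notation leb := (@lebesgue R n).
Local Notation mfun U f := (measurable_fun (U : set mE) (f : mE -> R)).
Variables (U : set E) (H G : E -> 'M[R]_n).
Hypotheses (oU : open U) (sH : forall a b, smooth_on U (fun x => H x a b))
  (iH : forall x, U x -> inner_product (H x))
  (mG : forall a b, mfun U (fun x => G x a b))
  (mP : forall a b, mfun U (fun x => inv_metric G x a b)).

Let cont (f : E -> R) : (forall x, U x -> {for x, continuous f}) -> mfun U f.
Proof. exact: continuous_measurable_borel. Qed.

Lemma measurable_metric a b : mfun U (fun x => H x a b).
Proof. by apply: cont => x; exact: cH. Qed.

Lemma measurable_inv_metric a b : mfun U (fun x => inv_metric H x a b).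
Proof. by apply: cont => x; exact: cinvH. Qed.

Lemma measurable_christoffel k i j : mfun U (christoffel H k i j).
Proof. by apply: cont => x; exact: continuous_christoffel. Qed.

Lemma measurable_partial_christoffel l k i j : mfun U (partial l (christoffel H k i j)).
Proof. by apply: measurable_partial => // x; exact: continuous_christoffel. Qed.

Lemma measurable_ricci i j : mfun U (ricci H i j).
Proof.
apply: measurable_funD; apply: measurable_sum => k.
  by apply: measurable_funB; exact: measurable_partial_christoffel.
apply: measurable_sum => l; apply: measurable_funB; apply: measurable_funM;
  exact: measurable_christoffel.
Qed.

Lemma measurable_scal : mfun U (scal H).
Proof.
apply: measurable_sum => i; apply: measurable_sum => j; apply: measurable_funM.
  exact: measurable_inv_metric.
exact: measurable_ricci.
Qed.

Lemma measurable_diff_metric a b : mfun U (fun x => diff_metric H G x a b).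
Proof.
rewrite (_ : (fun x => _) = (fun x => G x a b - H x a b)); last first.
  by apply/funext => x; rewrite /diff_metric !mxE.
apply: measurable_funB; [exact: mG|exact: measurable_metric].
Qed.

Lemma measurable_De k i j : mfun U (De U H G k i j).
Proof.
apply: measurable_funB; first exact: measurable_weak_partial.
apply: measurable_sum => l; apply: measurable_funD; apply: measurable_funM;
  solve [exact: measurable_christoffel | exact: measurable_diff_metric].
Qed.

Lemma measurable_cov_deriv20 k i j : mfun U (cov_deriv20 U H (inv_metric G) k i j).
Proof.
apply: measurable_funD; first exact: measurable_weak_partial.
apply: measurable_sum => l; apply: measurable_funD; apply: measurable_funM;
  solve [exact: measurable_christoffel | exact: mP].
Qed.

Lemma measurable_Gam k i j : mfun U (Gam U H G k i j).
Proof.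
apply: measurable_funM => //; apply: measurable_sum => l; apply: measurable_funM; first exact: mP.
by apply: measurable_funB; [apply: measurable_funD|]; exact: measurable_De.
Qed.

Lemma measurable_QS : mfun U (QS U H G).
Proof.
apply: measurable_funD; last first.
  do 3 apply: measurable_sum => ?; apply: measurable_funM; first exact: measurable_cov_deriv20.
  exact: measurable_Gam.
apply: measurable_funB; last first.
  do 3 apply: measurable_sum => ?; apply: measurable_funM; first exact: measurable_cov_deriv20.
  exact: measurable_Gam.
apply: measurable_funD; last first.
  do 4 apply: measurable_sum => ?; apply: measurable_funM; first exact: mP.
  by apply: measurable_funB; apply: measurable_funM; exact: measurable_Gam.
apply: measurable_funD; first exact: measurable_scal.
do 2 apply: measurable_sum => ?; apply: measurable_funM; last exact: measurable_ricci.
by apply: measurable_funB; [exact: mP|exact: measurable_inv_metric].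
Qed.

Lemma measurable_flux (A : E -> 'M[R]_n) phi : (forall a b, mfun U (fun x => A x a b)) ->
  (forall x, U x -> {for x, continuous phi}) -> mfun U (flux A U H G phi).
Proof.
move=> mA cphi; do 4 apply: measurable_sum => ?.
apply: measurable_funM; last by apply: measurable_funN; exact: measurable_partial.
apply: measurable_funM; last exact: measurable_De.
by apply: measurable_funB; apply: measurable_funM; exact: mA.
Qed.

Let msqrt f : mfun U f -> mfun U (fun x => Num.sqrt (f x)).
Proof. move=> mf; have ms : measurable_fun setT (@Num.sqrt R).
  by apply: continuous_measurable_fun; exact: sqrt_continuous.
exact: (measurableT_comp ms mf). Qed.

Lemma measurable_norm02 : mfun U (norm02 H (diff_metric H G)).
Proof.
apply: msqrt; do 4 apply: measurable_sum => ?.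
by repeat apply: measurable_funM; solve [exact: measurable_inv_metric | exact: measurable_diff_metric].
Qed.

Lemma measurable_norm03 : mfun U (norm03 H (De U H G)).
Proof.
apply: msqrt; do 6 apply: measurable_sum => ?.
by repeat apply: measurable_funM; solve [exact: measurable_inv_metric | exact: measurable_De].
Qed.

End chart_measurability.

Section chart_estimates.
Context {R : realType} {n : nat}.
Local Notation E := 'rV[R]_n.
Local Notation I := 'I_n.
Local Notation T3 := (I * I * I)%type.
Local Notation L4 := (I * I * (I * I))%type.

Definition contract4 (P Q : 'M[R]_n) (alpha : L4 -> T3) (X : T3 -> R) (Y : I -> R) : R :=
  \sum_(l : L4) (P l.1.1 l.1.2 * Q l.2.1 l.2.2) * (X (alpha l) * Y l.1.1).

Lemma contract4_bound (J P Q : 'M[R]_n) (alpha : L4 -> T3) (gamma : T3 -> I -> L4)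
    (X : T3 -> R) (Y : I -> R) (CP CQ NX NY : R) : J \in unitmx ->
  (forall t s l, e3 J t (alpha l) * e1 J s l.1.1 =
     (J l.1.1 (gamma t s).1.1 * J l.1.2 (gamma t s).1.2) *
     (J l.2.1 (gamma t s).2.1 * J l.2.2 (gamma t s).2.2)) ->
  (forall i j, `|frP J P i j| <= CP) -> (forall i j, `|frP J Q i j| <= CQ) ->
  (forall t, `|fr3 J X t| <= NX) -> (forall t, `|fr1 J Y t| <= NY) ->
  `|contract4 P Q alpha X Y| <= #|{: T3}|%:R * (#|{: I}|%:R * (NX * NY * (CP * CQ))).
Proof.
move=> uJ Hg HP HQ HX HY.
rewrite /contract4 (bilinear_frame (fun l : L4 => P l.1.1 l.1.2 * Q l.2.1 l.2.2)
  alpha (fun l : L4 => l.1.1) (fr3E uJ X) (fr1E uJ Y)).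
apply: bilinear_bound => // t s.
under eq_bigr do rewrite Hg.
by rewrite contraction4 normrM ler_pM.
Qed.

Variables (U : set E) (H G : E -> 'M[R]_n) (x : E) (J : 'M[R]_n) (C : R).
Hypotheses (uJ : J \in unitmx) (HJ : H x = J *m J^T) (C0 : 0 < C) (iG : inner_product (G x))
  (pG : forall w, quad (inv_metric G x) w <= C * quad (inv_metric H x) w).
Local Notation P := (inv_metric G x).
Local Notation Q := (inv_metric H x).
Let V : T3 -> R := fun t => De U H G t.1.1 t.1.2 t.2 x.

Lemma quad_frP (A : 'M[R]_n) w : quad (frP J A) w = quad A (w *m J^T).
Proof. by rewrite /quad /frP trmx_mul trmxK !mulmxA. Qed.

Let frQ : frP J Q = 1%:M.
Proof. by rewrite /inv_metric HJ frP_inv. Qed.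

(** g^-1 <= C h^-1, and in the frame h^-1 is the identity. *)
Lemma frP_bound i j : `|frP J P i j| <= C.
Proof.
have [siG posG] := inv_inner_product iG.
apply: psd_entry => [||k].
- by rewrite /frP !trmx_mul trmxK siG mulmxA.
- by move=> w; rewrite quad_frP; exact: posG.
rewrite -quad_delta quad_frP; apply: le_trans (pG _) _.
by rewrite -quad_frP frQ quad_delta mxE eqxx mulr1.
Qed.

(** In an orthonormal frame, g^-1 - h^-1 = - g^-1 e. *)
Lemma frP_diff_bound i j :
  `|frP J (P - Q) i j| <= n%:R * (C * norm02 H (diff_metric H G) x).
Proof.
have uG := inner_product_unit iG.
have uH : H x \in unitmx by rewrite HJ unitmx_mul uJ unitmx_tr.
have -> : frP J (P - Q) = - (frP J P *m (invmx J *m diff_metric H G x *m (invmx J)^T)).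
  have uJt : J^T \in unitmx by rewrite unitmx_tr.
  have -> : P - Q = - (P *m diff_metric H G x *m Q).
    rewrite /diff_metric mulmxBr mulmxBl mulVmx// mul1mx -mulmxA mulmxV// mulmx1.
    by rewrite opprB.
  rewrite /frP mulmxN mulNmx; congr (- _).
  by rewrite /inv_metric HJ inv_frame// !mulmxA mulmxKV// mulmxK.
rewrite mxE normrN mxE.
apply: le_trans (ler_sum_const (c := C * norm02 H (diff_metric H G) x) _) _.
  by move=> a; rewrite normrM ler_pM ?frP_bound ?frame_norm02.
by rewrite card_ord.
Qed.

Lemma fluxE (A : E -> 'M[R]_n) phi : flux A U H G phi x =
  - (contract4 (A x) (A x) (fun l => (l.2.1, l.1.2, l.2.2)) V (fun i => partial i phi x) -
     contract4 (A x) (A x) (fun l => (l.1.2, l.2.1, l.2.2)) V (fun i => partial i phi x)).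
Proof.
rewrite /contract4 -(sum_nested4 (fun i j k l => (A x i j * A x k l) * (V (k, j, l) * partial i phi x))).
rewrite -(sum_nested4 (fun i k j l => (A x i k * A x j l) * (V (k, j, l) * partial i phi x))).
rewrite -sumrB -sumrN; apply: eq_bigr => i _.
rewrite [X in _ - X]exchange_big -sumrB -sumrN; apply: eq_bigr => j _ /=.
rewrite -sumrB -sumrN; apply: eq_bigr => k _; rewrite -sumrB -sumrN; apply: eq_bigr => l _.
rewrite /V /=.
move: (A x i j) (A x k l) (A x i k) (A x j l) (De _ _ _ _ _ _ _) (partial _ _ _) => p q r s t u.
by ring.
Qed.

Lemma contract4B (A B : 'M[R]_n) alpha X Y :
  contract4 A A alpha X Y - contract4 B B alpha X Y =
  contract4 (A - B) A alpha X Y + contract4 B (A - B) alpha X Y.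
Proof.
rewrite /contract4 -sumrB -big_split; apply: eq_bigr => l _ /=; rewrite !mxE.
move: (A _ _) (A _ _) (B _ _) (B _ _) (X _) (Y _) => p q r s t u; ring.
Qed.

(** The difference of the products of two inverse metrics contains a factor
    g^-1 - h^-1, which is bounded by |e|; the other factors are bounded. *)
Lemma flux_diff_bound phi :
  `|flux (inv_metric G) U H G phi x - flux (inv_metric H) U H G phi x| <=
  2 * (n%:R ^+ 5 * (C ^+ 2 + C)) *
    (norm02 H (diff_metric H G) x * norm03 H (De U H G) x * grad_norm H phi x).
Proof.
set N2 := norm02 _ _ _; set N3 := norm03 _ _ _; set N1 := grad_norm _ _ _.
have HX t : `|fr3 J V t| <= N3 by exact: frame_norm03.
have HY t : `|fr1 J (fun i => partial i phi x) t| <= N1 by exact: frame_grad_norm.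
have HQ i j : `|frP J Q i j| <= 1.
  by rewrite frQ mxE; case: (i == j); rewrite ?normr1// normr0.
have bound alpha gamma : (forall t s l, e3 J t (alpha l) * e1 J s l.1.1 =
     (J l.1.1 (gamma t s).1.1 * J l.1.2 (gamma t s).1.2) *
     (J l.2.1 (gamma t s).2.1 * J l.2.2 (gamma t s).2.2)) ->
    `|contract4 P P alpha V (fun i => partial i phi x) -
      contract4 Q Q alpha V (fun i => partial i phi x)| <=
    n%:R ^+ 5 * (C ^+ 2 + C) * (N2 * N3 * N1).
  move=> Hg; rewrite contract4B.
  have B1 := contract4_bound uJ Hg frP_diff_bound frP_bound HX HY.
  have B2 := contract4_bound uJ Hg HQ frP_diff_bound HX HY.
  apply: le_trans (ler_normD _ _) _; apply: le_trans (lerD B1 B2) _.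
  rewrite !card_prod card_ord !natrM -/N2 le_eqVlt; apply/orP; left; apply/eqP.
  have E (m n1 n2 n3 c : R) : m * m * m * (m * (n3 * n1 * (m * (c * n2) * c))) +
      m * m * m * (m * (n3 * n1 * (1 * (m * (c * n2))))) =
      m ^+ 5 * (c ^+ 2 + c) * (n2 * n3 * n1) by ring.
  exact: E.
rewrite !fluxE.
have b1 := bound (fun l => (l.2.1, l.1.2, l.2.2)) (fun t s => ((s, t.1.2), (t.1.1, t.2))).
have b2 := bound (fun l => (l.1.2, l.2.1, l.2.2)) (fun t s => ((s, t.1.1), (t.1.2, t.2))).
set a1 := contract4 P P _ _ _ in b1 *; set a2 := contract4 P P _ _ _ in b2 *.
set a3 := contract4 Q Q _ _ _ in b1 *; set a4 := contract4 Q Q _ _ _ in b2 *.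
have -> : - (a1 - a2) - - (a3 - a4) = (a2 - a4) - (a1 - a3) by ring.
apply: le_trans (ler_normB _ _) _; rewrite -mulrA mulr_natl mulr2n; apply: lerD.
  apply: b2 => t s l; rewrite /e3 /e1 /=.
  move: (J _ _) (J _ _) (J _ _) (J _ _) => j1 j2 j3 j4; ring.
apply: b1 => t s l; rewrite /e3 /e1 /=.
move: (J _ _) (J _ _) (J _ _) (J _ _) => j1 j2 j3 j4; ring.
Qed.

(** With vanishing Ricci curvature only the terms quadratic in De are left, as D g^-1 is
    itself expressed by De. *)
Lemma flat_QS_bound : (forall i j, ricci H i j x = 0) ->
  (forall k i j, cov_deriv20 U H (inv_metric G) k i j x =
     - \sum_a \sum_b P i a * De U H G k a b x * P b j) ->
  `|QS U H G x| <= 12 * (n%:R ^+ 6 * C ^+ 3) * norm03 H (De U H G) x ^+ 2.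
Proof.
move=> ric0 DP.
have HX t : `|fr3 J V t| <= norm03 H (De U H G) x by exact: frame_norm03.
have := quadratic_bound uJ (P := P) (V := V) frP_bound HX.
rewrite !card_prod card_ord !natrM.
have -> : 12 * (n%:R * n%:R * n%:R * (n%:R * n%:R * n%:R * (norm03 H (De U H G) x *
   norm03 H (De U H G) x * (C * C * C)))) = 12 * (n%:R ^+ 6 * C ^+ 3) * norm03 H (De U H G) x ^+ 2.
  have E (m p q : R) : 12 * (m * m * m * (m * m * m * (p * p * (q * q * q)))) =
    12 * (m ^+ 6 * q ^+ 3) * p ^+ 2 by ring.
  exact: E.
have scal0 : scal H x = 0 by rewrite /scal big1// => i _; rewrite big1// => j _; rewrite ric0 mulr0.
have ric2 : \sum_i \sum_j (P i j - Q i j) * ricci H i j x = 0.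
  by rewrite big1// => i _; rewrite big1// => j _; rewrite ric0 mulr0.
have GaE k i j : Gam U H G k i j x = \sum_l P k l * low_gamma V (i, j, l).
  rewrite /Gam mulr_sumr; apply: eq_bigr => l _; rewrite /low_gamma /V /=.
  by rewrite mulrCA.
rewrite /QS /= scal0 ric2 !add0r.
move=> B; apply: le_trans B; rewrite le_eqVlt; apply/orP; left; apply/eqP; congr (`| _ |).
congr (_ - _ + _).
- apply: eq_bigr => i _; apply: eq_bigr => j _; apply: eq_bigr => u _; apply: eq_bigr => v _.
  by rewrite !GaE.
- apply: eq_bigr => i _; apply: eq_bigr => j _; apply: eq_bigr => v _.
  by rewrite DP GaE.
- apply: eq_bigr => i _; apply: eq_bigr => j _; apply: eq_bigr => v _.
  by rewrite DP GaE.
Qed.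

End chart_estimates.

(** * From the charts to the manifold *)

Section jacobian_partial.
Context {R : realType} {n : nat}.
Local Notation E := 'rV[R]_n.
Local Notation e_ k := (delta_mx 0 k : E).

(** At a point where f is not differentiable, the chosen differential is 0. *)
Lemma jacobian_neq0_differentiable (f : E -> E) (x : E) : jacobian f x != 0 -> differentiable f x.
Proof.
move=> J0; apply/diffP; apply: contrapT => nd; move/eqP: J0; apply.
apply/matrixP => i j; rewrite /jacobian /lin1_mx !mxE /diff /=.
rewrite xgetPN; last first.
  move=> df Hdf; apply: nd; rewrite /diff; exact: (@xgetPex _ point (fun g : {linear E -> E} => _) (ex_intro _ df Hdf)).
by rewrite mxE.
Qed.

Lemma jacobianE (f : E -> E) (x : E) i j : differentiable f x ->
  jacobian f x i j = partial i (fun y => f y 0 j) x.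
Proof.
move=> df.
have := deriveEjacobian (e_ i) df.
rewrite -rowE derive_mx; last exact: diff_derivable.
by move/rowP/(_ j); rewrite !mxE.
Qed.

End jacobian_partial.

Section manifold_atlas.
Context {R : realType} {n : nat} {M : ptopologicalType}.
Local Notation E := 'rV[R]_n.
Local Notation mE := (borel 'rV[R]_n).
Local Notation mM := (borel M).
Local Notation leb := (@lebesgue R n).
Variable A : nat -> chart R n M.
Hypothesis atlas : smooth_atlas A.
Local Notation D i := (chart_dom (A i)).
Local Notation U i := (chart_img (A i)).
Local Notation phi i := (chart_map (A i)).
Local Notation psi i := (chart_inv (A i)).

Lemma open_chart_dom i : open (D i).
Proof. by have [_ /(_ i)[[oD oU] _ _ _] _ _] := atlas. Qed.

Lemma open_chart_img i : open (U i).
Proof. by have [_ /(_ i)[[oD oU] _ _ _] _ _] := atlas. Qed.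

Lemma chart_mapK i q : D i q -> psi i (phi i q) = q.
Proof. by have [_ /(_ i)[_ + _ _] _ _] := atlas; apply. Qed.

Lemma chart_map_continuous i q : D i q -> {for q, continuous (phi i)}.
Proof. by have [_ /(_ i)[_ _ + _] _ _] := atlas; apply. Qed.

Lemma chart_inv_continuous i x : U i x -> {for x, continuous (psi i)}.
Proof. by have [_ /(_ i)[_ _ _ +] _ _] := atlas; apply. Qed.

Lemma chart_inv_dom i x : U i x -> D i (psi i x).
Proof. by move=> [q Dq <-]; rewrite chart_mapK. Qed.

Lemma chart_invK i x : U i x -> phi i (psi i x) = x.
Proof. by move=> [q Dq <-]; rewrite chart_mapK. Qed.

Lemma chart_map_img i q : D i q -> U i (phi i q).
Proof. by move=> Dq; exists q. Qed.

Lemma chart_atP q : D (chart_at A q) q /\ forall j, (j < chart_at A q)%N -> ~ D j q.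
Proof.
have [_ _ _ /(_ q)[i Di]] := atlas.
have ex : exists i, `[< D i q >] by exists i; apply/asboolP.
apply: (@xgetPex _ 0%N [set i | D i q /\ forall j, (j < i)%N -> ~ D j q]).
case: (ex_minnP ex) => m /asboolP Dm mm; exists m; split => // j jm /asboolP/mm.
by rewrite leqNgt jm.
Qed.

Lemma chart_at_dom q : D (chart_at A q) q.
Proof. by have [] := chart_atP q. Qed.

Lemma chart_at_eq q i : D i q -> (forall j, (j < i)%N -> ~ D j q) -> chart_at A q = i.
Proof.
move=> Di mi; have [Dc mc] := chart_atP q.
apply/eqP; rewrite eqn_leq; apply/andP; split; rewrite leqNgt; apply/negP.
  by move=> /mc.
by move=> /mi.
Qed.

Lemma measurable_chart_map i (N : set mE) : measurable N ->
  measurable ((D i `&` phi i @^-1` N) : set mM).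
Proof.
move=> mN; have oD := open_chart_dom i.
have mf : measurable_fun (D i : set mM) (phi i : mM -> mE).
  by apply: measurable_borel_fun => // q; exact: chart_map_continuous.
exact: mf (open_measurable_borel oD) N mN.
Qed.

Lemma measurable_chart_cell i : measurable ([set q | chart_at A q = i] : set mM).
Proof.
rewrite (_ : [set q | _] = D i `\` \bigcup_(j in `I_i) D j).
  apply: measurableD; first by apply: open_measurable_borel; exact: open_chart_dom.
  apply: bigcup_measurable => j _; apply: open_measurable_borel; exact: open_chart_dom.
apply/seteqP; split => q /=.
  move=> <-; split; first exact: chart_at_dom.
  by move=> [j /= ji]; have [_] := chart_atP q; apply.
by move=> [Di nD]; apply: chart_at_eq => // j ji Dj; apply: nD; exists j.
Qed.

(** M is the countable union of the Borel cells on which a given chart is used. *)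
Lemma measurable_eval_scalar (F : nat -> E -> R) :
  (forall i, measurable_fun (U i : set mE) (F i : mE -> R)) ->
  measurable_fun setT (eval_scalar A F : mM -> R).
Proof.
move=> mF _ Y mY; rewrite setTI.
rewrite (_ : _ @^-1` Y = \bigcup_i ([set q | chart_at A q = i] `&`
    (D i `&` phi i @^-1` (U i `&` F i @^-1` Y)))).
  apply: bigcupT_measurable => i; apply: measurableI; first exact: measurable_chart_cell.
  apply: measurable_chart_map; apply: mF => //.
  by apply: open_measurable_borel; exact: open_chart_img.
apply/seteqP; split => q /=.
  move=> Yq; exists (chart_at A q) => //=; split => //.
  by split; [exact: chart_at_dom|split => //; apply: chart_map_img; exact: chart_at_dom].
by move=> [i _ /= [<- [_ [_]]]].
Qed.

Lemma locally_lipschitz_continuous (f : M -> R) i x : locally_lipschitz A f -> U i x ->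
  {for x, continuous (in_chart A f i)}.
Proof.
move=> lf Ux; have [V nV [C [_ HC]]] := lf i x Ux.
have LC := HC (`|C| + 1) (ltac:(by rewrite ltr_pwDr// ler_norm)).
set L := `|C| + 1 in LC; have L0 : 0 < L by rewrite ltr_wpDl.
apply: (proj2 (@cvgrPdist_le R R E (nbhs x) _ (in_chart A f i) (in_chart A f i x))) => e e0.
have eL : 0 < e / L by rewrite divr_gt0.
have : \forall y \near x, V y /\ `|x - y| < e / L.
  apply: filterI => //.
  by apply/nbhs_ballP; exists (e / L) => // y; rewrite -ball_normE.
apply: filterS => y [Vy xy].
have := LC (x, y) (conj (nbhs_singleton nV) Vy) => /= H.
apply: le_trans H _; rewrite mulrC -ler_pdivlMr//; exact: ltW.
Qed.

Lemma in_chart_eval (f : M -> R) : f = eval_scalar A (in_chart A f).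
Proof. by apply/funext => q; rewrite /eval_scalar /in_chart /= chart_mapK//; exact: chart_at_dom. Qed.

Lemma measurable_locally_lipschitz (f : M -> R) : locally_lipschitz A f ->
  measurable_fun setT (f : mM -> R).
Proof.
move=> lf; rewrite (in_chart_eval f); apply: measurable_eval_scalar => i.
apply: continuous_measurable_borel; first exact: open_chart_img.
by move=> x; exact: locally_lipschitz_continuous.
Qed.

Variables (h : tensor2 R n) (mu : {measure set mM -> \bar R}).
Hypotheses (sh : smooth_metric A h) (vol : volume_measure A h mu).

(** The volume measure has a density in the chart, so null sets of the chart are null
    sets on M. *)
Lemma ae_chart i (P : E -> Prop) : (\forall x \ae leb, U i x -> P x) ->
  \forall q \ae mu, D i q -> P (phi i q).
Proof.
move=> [N [mN N0 HN]]; exists (D i `&` phi i @^-1` N); split.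
- exact: measurable_chart_map.
- rewrite (vol (measurable_chart_map i mN) (@subIsetl _ _ _)).
  rewrite (_ : phi i @` _ = U i `&` N); last first.
    apply/seteqP; split => x /=.
      by move=> [q [Dq Nq] <-]; split => //; exact: chart_map_img.
    move=> [Ux Nx]; exists (psi i x); last exact: chart_invK.
    by split; [exact: chart_inv_dom|rewrite /= chart_invK].
  have mU : measurable (U i : set mE) by apply: open_measurable_borel; exact: open_chart_img.
  apply: null_set_integral.
  - exact: measurableI.
  - apply/measurable_EFinP.
    have ms : measurable_fun setT (@Num.sqrt R).
      by apply: continuous_measurable_fun; exact: sqrt_continuous.
    apply: (measurableT_comp ms); apply: (measurable_funS mU (@subIsetl _ _ _)).
    apply: continuous_measurable_borel; first exact: open_chart_img.
    move=> x Ux; apply: (cvg_det (F := nbhs x) (A := h i) (B := h i x)) => a b.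
    by have [+ _ _] := sh i => /(_ a b [::] x Ux)[].
  - apply/eqP; rewrite eq_le measure_ge0 andbT -N0.
    by apply: le_measure; rewrite ?inE//; exact: measurableI.
- by move=> q /= H; apply: contrapT => nB; apply: H => Dq; apply: contrapT => nP; apply: nB;
    split => //; apply: HN => /(_ (chart_map_img Dq)).
Qed.

Lemma ae_chart_at (P : nat -> E -> Prop) : (forall i, \forall x \ae leb, U i x -> P i x) ->
  \forall q \ae mu, P (chart_at A q) (phi (chart_at A q) q).
Proof.
move=> HP; have : \forall q \ae mu, forall i, D i q -> P i (phi i q).
  by apply/ae_foralln => i; exact: ae_chart.
by apply: aeS => q; apply; exact: chart_at_dom.
Qed.

End manifold_atlas.

Section flat_end.
Context {R : realType} {n : nat} {M : ptopologicalType}.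
Local Notation E := 'rV[R]_n.
Variables (A : nat -> chart R n M) (K : set M) (R0 : R) (Phi : chart R n M) (h : tensor2 R n) (r : M -> R).
Hypotheses (n0 : (0 < n)%N) (rm : reference_manifold A K R0 Phi) (bg : background_metric A K Phi h r).

(** The positive matrix h = J J^T is not 0, so neither is J, the Jacobian matrix of the
    change to the chart at infinity. That change is therefore differentiable, its
    Jacobian matrix consists of partial derivatives, and flatness follows. *)
Lemma end_flat i x : chart_img (A i) x -> ~ K (chart_inv (A i) x) ->
  exists J : 'M[R]_n, [/\ J \in unitmx, h i x = J *m J^T & forall a b, ricci (h i) a b x = 0].
Proof.
have [atlas _ _ cPhi [domPhi _ sPhi]] := rm.
have [sh _ _ hJ _] := bg.
move=> Ux Kx; have Hsh := sh i.
pose W : set E := chart_map (A i) @` (chart_dom (A i) `&` chart_dom Phi).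
have WE y : W y <-> chart_img (A i) y /\ ~ K (chart_inv (A i) y).
  split.
    move=> [q [Dq Pq] <-]; split; first exact: chart_map_img.
    by rewrite (chart_mapK atlas)//; move: Pq; rewrite domPhi.
  move=> [Uy Ky]; exists (chart_inv (A i) y); last exact: (chart_invK atlas).
  by split; [exact: (chart_inv_dom atlas)|rewrite domPhi].
have oW : open W.
  rewrite openE => y /WE[Uy Ky].
  have n1 : nbhs y (chart_img (A i)).
    by apply: open_nbhs_nbhs; split => //; exact: (open_chart_img atlas).
  have n2 : nbhs y (chart_inv (A i) @^-1` chart_dom Phi).
    apply: (chart_inv_continuous atlas Uy); apply: open_nbhs_nbhs; split; first by have [[]] := cPhi.
    by rewrite domPhi.
  apply: filterS (filterI n1 n2) => z [Uz Pz]; apply/WE; split => //.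
  by move: Pz; rewrite /= domPhi.
pose tau (m : 'I_n) (y : E) := transition (A i) Phi y 0 m.
have stau m : smooth_on W (tau m) by have [+ _] := sPhi i; apply.
have inner y : W y -> inner_product (h i y).
  by move=> /WE[Uy _]; have [_ + _] := Hsh; apply.
have hJW y : W y -> h i y = jac tau y *m (jac tau y)^T.
  move=> Wy; have /WE[Uy Ky] := Wy; have E1 := hJ i y Uy Ky.
  (* If J were 0, h would be 0, which is not positive definite in dimension n > 0. *)
  have J0 : jacobian (transition (A i) Phi) y != 0.
    apply/eqP => J0; have [_ pos] := inner y Wy.
    have : 0 < quad (h i y) (delta_mx 0 (Ordinal n0)).
      apply: pos; apply/eqP => /matrixP/(_ 0 (Ordinal n0)); rewrite !mxE !eqxx.
      by move/eqP; rewrite oner_eq0.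
    by rewrite E1 /= J0 mul0mx /quad mulmx0 mul0mx mxE ltxx.
  rewrite E1; have -> // : jacobian (transition (A i) Phi) y = jac tau y.
  by apply/matrixP => a b; rewrite jacobianE ?mxE//; exact: jacobian_neq0_differentiable.
have uJ y : W y -> jac tau y \in unitmx.
  move=> Wy; have := inner_product_unit (inner y Wy).
  by rewrite hJW// unitmx_mul => /andP[].
have Wx : W x by apply/WE.
exists (jac tau x); split; [exact: uJ|exact: hJW|].
by move=> a b; apply: (flat_ricci oW stau hJW uJ).
Qed.

End flat_end.

(** * Integrability and the mass *)

Section integrability.
Context d (T : measurableType d) (R : realType) (mu : {measure set T -> \bar R}).

(** An extended real integral is the difference of the integrals of the positive and of
    the negative part, hence finite only if both are. *)
Lemma integrable_fin_integral (f : T -> \bar R) : measurable_fun setT f ->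
  (\int[mu]_x f x)%E \is a fin_num -> mu.-integrable setT f.
Proof.
move=> mf; rewrite integralE.
have p0 : (0 <= \int[mu]_x (f^\+ x)%E)%E by exact: integral_ge0.
have m0 : (0 <= \int[mu]_x (f^\- x)%E)%E by exact: integral_ge0.
have mp : measurable_fun setT (f^\+)%E by exact: measurable_funepos.
have mm : measurable_fun setT (f^\-)%E by exact: measurable_funeneg.
move=> fin; apply/integrableP; split => //.
have -> : (\int[mu]_x `|f x| = \int[mu]_x (f^\+ x) + \int[mu]_x (f^\- x))%E.
  rewrite -ge0_integralD//; apply: eq_integral => x _.
  by have := fune_abse f => /(congr1 (@^~ x)).
move: p0 m0 fin; move: (\int[mu]_x _)%E (\int[mu]_x _)%E => [p| |] [m| |] //= _ _ _.
exact: ltry.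
Qed.

Lemma integrable_ae_bound (f g : T -> R) : measurable_fun setT f ->
  mu.-integrable setT (EFin \o g) -> {ae mu, forall x, `|f x| <= g x} ->
  mu.-integrable setT (EFin \o f).
Proof.
move=> mf gi fg; have mg : measurable_fun setT g by exact: integrable_real_measurable gi.
apply/integrableP; split; first exact/measurable_EFinP.
have /integrableP[_] := gi; apply: le_lt_trans.
apply: ae_ge0_le_integral => //.
- by apply: measurableT_comp => //; exact/measurable_EFinP.
- by apply: measurableT_comp => //; exact/measurable_EFinP.
- by apply: aeS fg => x fx _; rewrite /= lee_fin; apply: le_trans fx _; exact: ler_norm.
Qed.

Lemma integrable_root (f : T -> R) (p : R) : 0 < p -> measurable_fun setT f ->
  (forall x, 0 <= f x) -> ((\int[mu]_x (f x)%:E) `^ p^-1 < +oo)%E ->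
  mu.-integrable setT (EFin \o f).
Proof.
move=> p0 mf f0 H; apply/integrableP; split; first exact/measurable_EFinP.
rewrite (eq_integral (fun x => (f x)%:E)) => [|x _]; last by rewrite /= ger0_norm.
rewrite ltey; apply/eqP => E; move: H; rewrite E poweRyr ?ltxx//.
by rewrite invr_eq0 gt_eqF.
Qed.

End integrability.

Section mass.
Context (R : realType) (n : nat) (M : ptopologicalType).
Local Notation E := 'rV[R]_n.
Local Notation mM := (borel M).
Local Notation leb := (@lebesgue R n).
Variables (A : nat -> chart R n M) (K : set M) (R0 : R) (Phi : chart R n M)
  (h : tensor2 R n) (r : M -> R) (mu : {measure set (borel M) -> \bar R}) (g : tensor2 R n).
Hypotheses (n3 : (3 <= n)%N) (rm : reference_manifold A K R0 Phi)
  (bg : background_metric A K Phi h r) (vol : volume_measure A h mu)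
  (ag : asymptotically_euclidean A h r mu 2%:E ((n%:R - 2) / 2) g).
Local Notation U i := (chart_img (A i)).

Let atlas : smooth_atlas A. Proof. by have [] := rm. Qed.
Let sh : smooth_metric A h. Proof. by have [] := bg. Qed.
Let r0 q : 0 < r q. Proof. by have [_ _ + _ _] := bg; apply. Qed.
Let oU i : open (U i). Proof. exact: (open_chart_img atlas). Qed.
Let sH i a b : smooth_on (U i) (fun x => h i x a b). Proof. by have [+ _ _] := sh i; apply. Qed.
Let iH i x : U i x -> inner_product (h i x). Proof. by have [_ + _] := sh i; apply. Qed.
Let mG i a b : measurable_fun (U i : set (borel E)) ((fun x => g i x a b) : borel E -> R).
Proof. by have [_ [+ _] _ _ _] := ag; apply. Qed.
Let mP i a b : measurable_fun (U i : set (borel E)) ((fun x => inv_metric (g i) x a b) : borel E -> R).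
Proof. by have [_ _ [+ _] _ _] := ag; apply. Qed.
Let WT i a b : W1p_loc 2%:E (U i) (fun x => diff_metric (h i) (g i) x a b).
Proof. by have [_ _ _ [+ _] _] := ag; apply. Qed.

Let aeG : exists2 C : R, 0 < C & forall i, \forall x \ae leb, U i x -> inner_product (g i x) /\
  forall w, C^-1 * quad (h i x) w <= quad (g i x) w <= C * quad (h i x) w.
Proof.
have [[aem _] _ _ _ [C C1 HC]] := ag; exists C; first exact: lt_trans C1.
move=> i; have [ae1 _] := aem i; apply: aeS2 ae1 (HC i) => x H1 H2 Ux.
by split; [exact: H1|exact: H2].
Qed.

Local Notation N2 := (eval_scalar A (fun i => norm02 (h i) (diff_metric (h i) (g i)))).
Local Notation N3 := (eval_scalar A (fun i => norm03 (h i) (De (U i) (h i) (g i)))).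
Local Notation Q := (eval_scalar A (fun i => QS (U i) (h i) (g i))).
Local Notation FP phi := (eval_scalar A (fun i =>
  flux (inv_metric (g i)) (U i) (h i) (g i) (in_chart A phi i))).
Local Notation FH phi := (eval_scalar A (fun i =>
  flux (inv_metric (h i)) (U i) (h i) (g i) (in_chart A phi i))).
Local Notation dn phi := (eval_scalar A (fun i => grad_norm (h i) (in_chart A phi i))).

Let mN2 : measurable_fun setT (N2 : mM -> R).
Proof. by apply: (measurable_eval_scalar atlas) => i; exact: (measurable_norm02 (@oU i) (@sH i) (@iH i) (@mG i)). Qed.

Let mN3 : measurable_fun setT (N3 : mM -> R).
Proof. by apply: (measurable_eval_scalar atlas) => i; exact: (measurable_norm03 (@oU i) (@sH i) (@iH i) (@mG i)). Qed.

Let mQ : measurable_fun setT (Q : mM -> R).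
Proof. by apply: (measurable_eval_scalar atlas) => i; exact: (measurable_QS (@oU i) (@sH i) (@iH i) (@mG i) (@mP i)). Qed.

Let mFP phi : locally_lipschitz A phi -> measurable_fun setT (FP phi : mM -> R).
Proof.
move=> lphi; apply: (measurable_eval_scalar atlas) => i; apply: (measurable_flux (@oU i) (@sH i) (@iH i) (@mG i)) => //.
by move=> x; exact: (locally_lipschitz_continuous lphi).
Qed.

Let mFH phi : locally_lipschitz A phi -> measurable_fun setT (FH phi : mM -> R).
Proof.
move=> lphi; apply: (measurable_eval_scalar atlas) => i; apply: (measurable_flux (@oU i) (@sH i) (@iH i) (@mG i)).
  by move=> a b; exact: (measurable_inv_metric (@oU i) (@sH i) (@iH i)).
by move=> x; exact: (locally_lipschitz_continuous lphi).
Qed.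

Let mr : measurable_fun setT (r : mM -> R).
Proof.
rewrite (in_chart_eval atlas r); apply: (measurable_eval_scalar atlas) => i.
apply: continuous_measurable_borel; first exact: oU.
by move=> x Ux; have [_ sr _ _ _] := bg; have [+ _] := sr i [::] x Ux.
Qed.

(** The weights r^(2 tau - n) and r^(2 (tau + 1) - n) with tau = (n - 2) / 2 are r^-2
    and 1. *)
Let weighted_N2_N3 : mu.-integrable setT (EFin \o (fun q => (r q)^-2 * N2 q ^+ 2)) /\
  mu.-integrable setT (EFin \o (fun q => N3 q ^+ 2)).
Proof.
have [_ _ _ [_ fin] _] := ag.
have N20 q : 0 <= N2 q by exact: sqrtr_ge0.
have N30 q : 0 <= N3 q by exact: sqrtr_ge0.
have [f2 f3] : (@weighted_norm R n M r mu 2%:E ((n%:R - 2) / 2) N2 < +oo)%E /\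
    (@weighted_norm R n M r mu 2%:E ((n%:R - 2) / 2 + 1) N3 < +oo)%E.
  split.
    exact: (le_lt_trans (leeDl _ (poweR_ge0 _ _)) fin).
  exact: (le_lt_trans (leeDr _ (poweR_ge0 _ _)) fin).
split.
  apply: (@integrable_root _ _ _ _ _ 2) => //.
  - apply: measurable_funM; last exact: measurable_funX.
    rewrite (_ : (fun q => _) = (fun q => r q `^ (- 2%:R))); last first.
      by apply/funext => q; rewrite powRN powR_mulrn// ltW.
    exact: (measurableT_comp (measurable_powR _) mr).
  - by move=> q; rewrite mulr_ge0 ?sqr_ge0// invr_ge0 sqr_ge0.
  move: f2; rewrite /weighted_norm.
  have -> // : (\int[mu]_q (r q `^ (2 * ((n%:R - 2) / 2) - n%:R) * N2 q `^ 2)%R%:E =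
     \int[mu]_q ((r q) ^- 2 * N2 q ^+ 2)%:E)%E.
  apply: eq_integral => q _; rewrite (_ : 2 * ((n%:R - 2) / 2) - n%:R = - 2%:R :> R); last by field.
  by rewrite powRN !powR_mulrn//; exact: ltW.
apply: (@integrable_root _ _ _ _ _ 2) => //.
- exact: measurable_funX.
- by move=> q; exact: sqr_ge0.
move: f3; rewrite /weighted_norm.
have -> // : (\int[mu]_q (r q `^ (2 * ((n%:R - 2) / 2 + 1) - n%:R) * N3 q `^ 2)%R%:E =
   \int[mu]_q (N3 q ^+ 2)%:E)%E.
apply: eq_integral => q _; rewrite (_ : 2 * ((n%:R - 2) / 2 + 1) - n%:R = 0 :> R); last by field.
by rewrite powRr0 mul1r powR_mulrn.
Qed.

(** Chart by chart, almost everywhere, from the two estimates in an orthonormal frame. *)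
Let off_K : exists C : R, \forall q \ae mu, ~ K q -> `|Q q| <= C * N3 q ^+ 2 /\
  forall phi, `|FP phi q - FH phi q| <= C * (N2 q * N3 q * dn phi q).
Proof.
have [C C0 HC] := aeG.
pose C1 := 12 * (n%:R ^+ 6 * C ^+ 3); pose C2 := 2 * (n%:R ^+ 5 * (C ^+ 2 + C)).
have n0 : (0 < n)%N by exact: leq_trans n3.
have C00 := ltW C0.
have C10 : 0 <= C1 by rewrite mulr_ge0// mulr_ge0// exprn_ge0.
have C20 : 0 <= C2 by rewrite mulr_ge0// mulr_ge0 ?exprn_ge0// addr_ge0// exprn_ge0.
exists (C1 + C2).
have loc i : \forall x \ae leb, U i x -> ~ K (chart_inv (A i) x) ->
   `|QS (U i) (h i) (g i) x| <= (C1 + C2) * norm03 (h i) (De (U i) (h i) (g i)) x ^+ 2 /\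
   forall phi : E -> R,
    `|flux (inv_metric (g i)) (U i) (h i) (g i) phi x - flux (inv_metric (h i)) (U i) (h i) (g i) phi x| <=
    (C1 + C2) * (norm02 (h i) (diff_metric (h i) (g i)) x * norm03 (h i) (De (U i) (h i) (g i)) x *
      grad_norm (h i) phi x).
  have cov := cov_deriv_inv_metric (@oU i) (@sH i) (@iH i) C0 (@mG i) (@mP i) (HC i) (@WT i).
  apply: aeS2 (HC i) cov => x Hx Hcov Ux Kx.
  have [iG HG] := Hx Ux.
  have [J [uJ HJ ric]] := end_flat n0 rm bg Ux Kx.
  have pG := inv_metric_quad (@iH i) C0 Ux iG HG.
  split.
    have B := flat_QS_bound uJ HJ iG pG ric (Hcov Ux).
    apply: le_trans B _.
    by apply: ler_wpM2r; [exact: sqr_ge0|rewrite lerDl].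
  move=> phi; apply: le_trans (flux_diff_bound (U i) uJ HJ iG pG phi) _.
  by apply: ler_wpM2r; [rewrite !mulr_ge0 ?sqrtr_ge0|rewrite lerDr].
have locU i : \forall x \ae leb, U i x -> (fun (i : nat) (x : E) => ~ K (chart_inv (A i) x) ->
   `|QS (U i) (h i) (g i) x| <= (C1 + C2) * norm03 (h i) (De (U i) (h i) (g i)) x ^+ 2 /\
   forall phi : E -> R,
    `|flux (inv_metric (g i)) (U i) (h i) (g i) phi x - flux (inv_metric (h i)) (U i) (h i) (g i) phi x| <=
    (C1 + C2) * (norm02 (h i) (diff_metric (h i) (g i)) x * norm03 (h i) (De (U i) (h i) (g i)) x *
      grad_norm (h i) phi x)) i x by exact: loc.
apply: aeS (ae_chart_at atlas sh vol locU) => q Hq Kq.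
have [|H1 H2] := Hq; first by rewrite (chart_mapK atlas)//; exact: (chart_at_dom atlas).
by split=> // phi; exact: H2.
Qed.

(** A level set need not have interior points; the
    derivative vanishes at almost all of its points all the same. *)
Let flux_on_one phi : locally_lipschitz A phi -> \forall q \ae mu, phi q = 1 ->
  FP phi q = 0 /\ FH phi q = 0.
Proof.
move=> lphi.
have loc i : \forall x \ae leb, U i x -> (fun (i : nat) (x : E) => in_chart A phi i x = 1 ->
    forall k, partial k (in_chart A phi i) x = 0) i x.
  have H (k : 'I_n) : \forall x \ae leb, U i x -> in_chart A phi i x = 1 ->
      partial k (in_chart A phi i) x = 0.
    apply: level_set_partial; first exact: oU.
    by move=> x; exact: (locally_lipschitz_continuous lphi).
  have H2 : \forall x \ae leb, forall k, U i x -> in_chart A phi i x = 1 ->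
      partial k (in_chart A phi i) x = 0 by exact: filter_forall.
  by apply: aeS H2 => x Hx Ux one k; exact: Hx.
apply: aeS (ae_chart_at atlas sh vol loc) => q Hq one.
have flux0 (B : E -> 'M[R]_n) : flux B (U (chart_at A q)) (h (chart_at A q)) (g (chart_at A q))
    (in_chart A phi (chart_at A q)) (chart_map (A (chart_at A q)) q) = 0.
  do 4 (rewrite /flux big1// => ? _).
  rewrite Hq ?oppr0 ?mulr0//.
  by rewrite /in_chart /= (chart_mapK atlas)//; exact: (chart_at_dom atlas).
by split; exact: flux0.
Qed.

Variable S : M -> R.
Hypotheses (Si : mu.-integrable setT (EFin \o S)) (scalS : forall phi,
  locally_lipschitz A phi -> compactly_supported phi ->
  scal_distribution A h mu g phi = (\int[mu]_q (phi q * S q)%R%:E)%E).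

Section cutoff.
Variable chi : nat -> M -> R.
Hypothesis cut : cutoff_sequence A h r mu K chi.

Let lip a : locally_lipschitz A (chi a). Proof. by have [/(_ a)[]] := cut. Qed.
Let supp a : compactly_supported (chi a). Proof. by have [/(_ a)[]] := cut. Qed.
Let mchi a : measurable_fun setT (chi a : mM -> R).
Proof. exact: (measurable_locally_lipschitz atlas). Qed.
Let chiK a q : K q -> chi a q = 1. Proof. by have [_ _ + _ _] := cut; apply. Qed.

Let chi_bound : exists2 C : R, 0 < C & \forall q \ae mu, forall a,
  `|chi a q| <= C /\ r q * dn (chi a) q <= C.
Proof.
have [_ [C C0 HC] _ _ _] := cut; exists C => //; apply/ae_foralln => a.
apply: aeS (HC a) => q Hq.
have d0 : 0 <= r q * dn (chi a) q by rewrite mulr_ge0 ?sqrtr_ge0// ltW.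
by split; apply: le_trans Hq; rewrite ?lerDl// lerDr.
Qed.

Let chi_eventually q : \forall a \near \oo, chi a q = 1.
Proof.
have [_ _ _ mono cover] := cut.
have : (\bigcup_a (chi a @^-1` [set 1])) q by rewrite cover.
move=> [a _ /= Ha]; exists a => //= b ab; have {}ab : (a <= b)%N := ab.
elim: b ab => [|b IH]; first by rewrite leqn0 => /eqP <-.
by rewrite leq_eqVlt => /orP[/eqP <-//|/IH]; exact: mono.
Qed.

Let integrable_chiM (C : R) (f : M -> R) a : 0 < C -> (\forall q \ae mu, forall a, `|chi a q| <= C) ->
  mu.-integrable setT (EFin \o f) -> mu.-integrable setT (EFin \o (fun q => chi a q * f q)).
Proof.
move=> C0 HC fi; have mf : measurable_fun setT (f : mM -> R) by exact: integrable_real_measurable fi.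
apply: (@integrable_ae_bound _ mM _ mu _ (fun q : mM => C * `|f q|)).
- exact: measurable_funM.
- by apply: integrable_realZ => //; exact: integrable_norm.
- by apply: aeS HC => q /(_ a) Hq; rewrite normrM ler_wpM2r.
Qed.

Let L a q := FP (chi a) q + chi a q * Q q.

Let mL a : measurable_fun setT (L a : mM -> R).
Proof. by apply: measurable_funD; [exact: mFP|exact: (measurable_funM (@mchi a) mQ)]. Qed.

(** The distribution takes a finite value on the cutoff, and a function whose integral
    is finite is integrable. *)
Let integral_L a : mu.-integrable setT (EFin \o L a) /\
  (\int[mu]_q L a q)%R = (\int[mu]_q (chi a q * S q))%R.
Proof.
have [C C0 HC] := chi_bound.
have HC' : \forall q \ae mu, forall a, `|chi a q| <= C by apply: aeS HC => q Hq b; have [] := Hq b.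
have i1 := integrable_chiM a C0 HC' Si.
have eq := scalS (@lip a) (@supp a).
split.
  apply: integrable_fin_integral; first exact/measurable_EFinP.
  rewrite (_ : (\int[mu]_q _ = \int[mu]_q (chi a q * S q)%:E)%E); last exact: eq.
  exact: integrable_fin_num i1.
by rewrite /Rintegral; congr (fine _); exact: eq.
Qed.

(** Outside K, Q is bounded by |De|^2. On K the flux of the cutoff vanishes and Q is the
    integrand of the distribution, known to be integrable. *)
Let integrable_Q : mu.-integrable setT (EFin \o Q).
Proof.
have [C HC] := off_K; have [_ i3] := weighted_N2_N3.
have [i1 _] := integral_L 0.
apply: (@integrable_ae_bound _ mM _ mu _ (fun q : mM => `|L 0%N q| + `|C| * N3 q ^+ 2)) => //.
  by apply: integrable_realD => //; [exact: integrable_norm|exact: integrable_realZ].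
apply: aeS2 HC (flux_on_one (@lip 0)) => q Hq H1.
have [Kq|Kq] := pselect (K q).
  have one := chiK 0 Kq; have [F0 _] := H1 one.
  by rewrite /L F0 one add0r mul1r lerDl mulr_ge0// sqr_ge0.
have [H _] := Hq Kq; apply: le_trans H _; rewrite -[leLHS]add0r; apply: lerD => //.
by apply: ler_wpM2r; [exact: sqr_ge0|exact: ler_norm].
Qed.

Let diff a q := FP (chi a) q - FH (chi a) q.

(** |e| |De| |D chi| <= C (|e| / r) |De|, as r |D chi| is bounded, and then by the
    inequality 2 u v <= u^2 + v^2. *)
Let diff_bound : exists2 G : M -> R, mu.-integrable setT (EFin \o G) &
  \forall q \ae mu, forall a, `|diff a q| <= G q /\ (chi a q = 1 -> diff a q = 0).
Proof.
have [C HC] := off_K; have [D D0 HD] := chi_bound; have [i2 i3] := weighted_N2_N3.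
exists (fun q => `|C| * D * ((r q)^-2 * N2 q ^+ 2 + N3 q ^+ 2)).
  by apply: integrable_realZ => //; exact: integrable_realD.
have H1 : \forall q \ae mu, forall a, chi a q = 1 -> diff a q = 0.
  apply/ae_foralln => a; apply: aeS (flux_on_one (@lip a)) => q Hq one.
  by have [F0 F1] := Hq one; rewrite /diff F0 F1 subrr.
have HDZ : \forall q \ae mu, (forall a, `|chi a q| <= D /\ r q * dn (chi a) q <= D) /\
    forall a, chi a q = 1 -> diff a q = 0 by apply: aeS2 HD H1 => q; split.
apply: aeS2 HC HDZ => q Hq [Dq Zq] a; split; last exact: Zq.
have N20 : 0 <= N2 q by exact: sqrtr_ge0.
have N30 : 0 <= N3 q by exact: sqrtr_ge0.
have G0 : 0 <= (r q)^-2 * N2 q ^+ 2 + N3 q ^+ 2.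
  by rewrite addr_ge0 ?sqr_ge0// mulr_ge0 ?sqr_ge0// invr_ge0 sqr_ge0.
have [Kq|Kq] := pselect (K q).
  by rewrite Zq ?normr0 ?mulr_ge0 ?(ltW D0)//; exact: chiK.
have [_ /(_ (chi a)) H] := Hq Kq; have [_ rd] := Dq a.
have d0 : 0 <= dn (chi a) q by exact: sqrtr_ge0.
have dr : dn (chi a) q <= D / r q by rewrite ler_pdivlMr// mulrC.
apply: le_trans H _; apply: (@le_trans _ _ (`|C| * (N2 q * N3 q * dn (chi a) q))).
  by apply: ler_wpM2r; [rewrite !mulr_ge0|exact: ler_norm].
rewrite -[leRHS]mulrA; apply: ler_wpM2l => //.
apply: (@le_trans _ _ (N2 q * N3 q * (D / r q))); first by apply: ler_wpM2l; rewrite ?mulr_ge0.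
have -> : N2 q * N3 q * (D / r q) = D * (((r q)^-1 * N2 q) * N3 q).
  move: (N2 q) (N3 q) (r q)^-1 => u v w; ring.
apply: ler_wpM2l; first exact: ltW.
have -> : (r q)^-2 * N2 q ^+ 2 = ((r q)^-1 * N2 q) ^+ 2 by rewrite exprMn exprVn.
move: ((r q)^-1 * N2 q) (N3 q) => u v; nra.
Qed.

Let cvg_chiM (C : R) (f : M -> R) : 0 < C -> (\forall q \ae mu, forall a, `|chi a q| <= C) ->
  mu.-integrable setT (EFin \o f) ->
  (\int[mu]_q (chi a q * f q))%R @[a --> \oo] --> (\int[mu]_q f q)%R.
Proof.
move=> C0 HC fi; have mf : measurable_fun setT (f : mM -> R) by exact: integrable_real_measurable fi.
apply: (@Rdominated_convergence _ mM _ mu _ _ _ (fun q : mM => C * `|f q|)) => //.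
- by move=> a; exact: measurable_funM.
- apply: aeW => q _; have H := chi_eventually q.
  have cc : f q @[a --> \oo] --> f q by exact: cvg_cst.
  apply: cvg_trans cc; apply: near_eq_cvg; apply: filterS H => a ->.
  by rewrite mul1r.
- by apply: integrable_realZ => //; exact: integrable_norm.
- by apply: aeS HC => q Hq a _; rewrite normrM ler_wpM2r.
Qed.

Lemma mass_integral_limit :
  (forall a, mu.-integrable setT (EFin \o FH (chi a))) /\
  (\int[mu]_q FH (chi a) q)%R @[a --> \oo] --> (\int[mu]_q S q)%R - (\int[mu]_q Q q)%R.
Proof.
have [D D0 HD] := chi_bound; have [G Gi HG] := diff_bound.
have HD' : \forall q \ae mu, forall a, `|chi a q| <= D by apply: aeS HD => q Hq b; have [] := Hq b.
have mdiff a : measurable_fun setT (diff a : mM -> R).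
  by apply: measurable_funB; [exact: mFP|exact: mFH].
have idiff a : mu.-integrable setT (EFin \o diff a).
  by apply: (integrable_ae_bound _ Gi) => //; apply: aeS HG => q /(_ a)[].
have icQ a := integrable_chiM a D0 HD' integrable_Q.
(* F_h(chi) = (F_g(chi) + chi Q) - chi Q - (F_g(chi) - F_h(chi)). *)
have E a : FH (chi a) = (fun q => L a q - chi a q * Q q - diff a q).
  by apply/funext => q; rewrite /L /diff; ring.
have iLQ a := integrable_realB measurableT (integral_L a).1 (icQ a).
split; first by move=> a; rewrite E; exact: (integrable_realB measurableT (iLQ a) (idiff a)).
have I a : (\int[mu]_q FH (chi a) q)%R = (\int[mu]_q (chi a q * S q))%R -
    (\int[mu]_q (chi a q * Q q))%R - (\int[mu]_q diff a q)%R.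
  rewrite -(integral_L a).2 E.
  by rewrite (RintegralB measurableT (iLQ a) (idiff a)) (RintegralB measurableT (integral_L a).1 (icQ a)).
have lim0 : (\int[mu]_q diff a q)%R @[a --> \oo] --> (\int[mu]_q (cst 0 q : R))%R.
  apply: (@Rdominated_convergence _ mM _ mu _ _ _ (G : mM -> R)) => //.
  - apply: aeS HG => q Hq _; have H := chi_eventually q.
    have cc : (0 : R) @[a --> \oo] --> (0 : R) by exact: cvg_cst.
    apply: cvg_trans cc; apply: near_eq_cvg; apply: filterS H => a one.
    by have [_ ->] := Hq a.
  - by apply: aeS HG => q Hq a _; have [] := Hq a.
rewrite Rintegral_cst// mul0r in lim0.
have lim3 : (\int[mu]_q (chi a q * S q))%R - (\int[mu]_q (chi a q * Q q))%R -
    (\int[mu]_q diff a q)%R @[a --> \oo] --> (\int[mu]_q S q)%R - (\int[mu]_q Q q)%R - 0.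
  exact: (cvgB (cvgB (cvg_chiM D0 HD' Si) (cvg_chiM D0 HD' integrable_Q)) lim0).
rewrite subr0 in lim3.
by rewrite (_ : (fun a => _) = (fun a => (\int[mu]_q (chi a q * S q))%R -
  (\int[mu]_q (chi a q * Q q))%R - (\int[mu]_q diff a q)%R)); last exact/funext.
Qed.

Lemma mass_sequence_limit :
  mass_sequence A h mu g chi a @[a --> \oo] -->
  ((2 * (n%:R - 1) * @sphere_volume R n)^-1 * ((\int[mu]_q S q)%R - (\int[mu]_q Q q)%R))%:E.
Proof.
have [iF limF] := mass_integral_limit.
set c := _^-1.
have E a : mass_sequence A h mu g chi a = (c * (\int[mu]_q FH (chi a) q)%R)%:E.
  rewrite EFinM /mass_sequence /Rintegral fineK//.
  exact: integrable_fin_num (iF a).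
apply/fine_cvgP; split; first by apply: nearW => a; rewrite E.
rewrite (_ : fine \o _ = (fun a => c * (\int[mu]_q FH (chi a) q)%R)).
  exact: cvgMl_tmp.
by apply/funext => a; rewrite /= E.
Qed.

End cutoff.

End mass.

Theorem theorem3p9 (R : realType) (n : nat) (M : ptopologicalType)
    (A : nat -> chart R n M) (K : set M) (R0 : R) (Phi : chart R n M)
    (h : tensor2 R n) (r : M -> R) (mu : {measure set (borel M) -> \bar R})
    (g : tensor2 R n) :
  (3 <= n)%N ->
  reference_manifold A K R0 Phi ->
  background_metric A K Phi h r ->
  volume_measure A h mu ->
  asymptotically_euclidean A h r mu 2%:E ((n%:R - 2) / 2) g ->
  has_scal_L1 A h mu g ->
  [/\ forall chi, cutoff_sequence A h r mu K chi ->
        [/\ cvgn (mass_sequence A h mu g chi) &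
            weak_ADM_mass A h mu g chi \is a fin_num] &
      forall chi chi', cutoff_sequence A h r mu K chi ->
        cutoff_sequence A h r mu K chi' ->
        weak_ADM_mass A h mu g chi = weak_ADM_mass A h mu g chi'].
Proof.
move=> n3 rm bg vol ag [S Si scalS].
have lim chi (cut : cutoff_sequence A h r mu K chi) :=
  mass_sequence_limit n3 rm bg vol ag Si scalS cut.
split=> [chi cut|chi chi' cut cut']; last first.
  exact: etrans (cvg_lim (@ereal_hausdorff R) (lim chi cut))
    (esym (cvg_lim (@ereal_hausdorff R) (lim chi' cut'))).
split; last by rewrite /weak_ADM_mass (cvg_lim (@ereal_hausdorff R) (lim chi cut)).
by apply/cvg_ex; eexists; exact: lim cut.
Qed.
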